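(* $\mathrm{Gr}_q$ is a quantum homogeneous superspace for the quantum supergroup $\mathrm{SL}_q(4|1)$; that is, the comultiplication $\Delta$ of $\mathrm{SL}_q(4|1)$ restricts to a map $$\Delta|_{\mathrm{Gr}_q}:\mathrm{Gr}_q\longrightarrow \mathrm{SL}_q(4|1)\otimes \mathrm{Gr}_q,$$ and this restriction is a coaction of $\mathrm{SL}_q(4|1)$ on $\mathrm{Gr}_q$.
   Context: $\mathbb{C}_q=\mathbb{C}[q,q^{-1}]$ with $q$ an indeterminate; tensor products are over $\mathbb{C}_q$ and are tensor products of superalgebras. Put $p(i)=0$ for $1\le i\le 4$ and $p(5)=1$. The quantum matrix superalgebra $\mathrm{M}_q(4|1)$ is the $\mathbb{C}_q$-superalgebra generated by $a_{ij}$, $1\le i,j\le 5$, of parity $\pi(a_{ij})=p(i)+p(j)$ mod $2$, subject to $a_{ij}^2=0$ for odd $a_{ij}$ and - $a_{ij}a_{il}=(-1)^{\pi(a_{ij})\pi(a_{il})}q^{(-1)^{p(i)+1}}a_{il}a_{ij}$ for $j<l$; - $a_{ij}a_{kj}=(-1)^{\pi(a_{ij})\pi(a_{kj})}q^{(-1)^{p(j)+1}}a_{kj}a_{ij}$ for $i<k$; - $a_{ij}a_{kl}=(-1)^{\pi(a_{ij})\pi(a_{kl})}a_{kl}a_{ij}$ for $i<k,\ j>l$ or $i>k,\ j<l$; - $a_{ij}a_{kl}-(-1)^{\pi(a_{ij})\pi(a_{kl})}a_{kl}a_{ij}=(-1)^{\pi(a_{ij})\pi(a_{kj})}(q^{-1}-q)a_{kj}a_{il}$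 for $i<k,\ j<l$. Let $D_1=\sum_{\sigma\in S_4}(-q)^{-\ell(\sigma)}a_{1\sigma(1)}\cdots a_{4\sigma(4)}$ and $D_2=a_{55}$. $\mathrm{GL}_q(4|1)=\mathrm{M}_q(4|1)[D_1^{-1},D_2^{-1}]$ is obtained by adjoining even two-sided inverses of $D_1,D_2$, and $\mathrm{SL}_q(4|1)=\mathrm{GL}_q(4|1)/\langle \mathrm{Ber}_q-1\rangle$, where $\mathrm{Ber}_q$ is the quantum Berezinian $\mathrm{Ber}_q=\Big(\sum_{\sigma\in S_4}(-q)^{-\ell(\sigma)}s_{1\sigma(1)}\cdots s_{4\sigma(4)}\Big)a_{55}^{-1}$ with $s_{ij}=a_{ij}-a_{i5}a_{55}^{-1}a_{5j}$. $\mathrm{SL}_q(4|1)$ is a Hopf superalgebra with comultiplication $\Delta(a_{ij})=\sum_k a_{ik}\otimes a_{kj}$ and counit $\epsilon(a_{ij})=\delta_{ij}$. The quantum super Grassmannian $\mathrm{Gr}_q$ is the sub-superalgebra of $\mathrm{SL}_q(4|1)$ generated by $D_{ij}=a_{i1}a_{j2}-q^{-1}a_{i2}a_{j1}$ for $1\le i<j\le 4$, $D_{i5}=a_{i1}a_{52}-q^{-1}a_{i2}a_{51}$ for $1\le i\le 4$, and $D_{55}=a_{51}a_{52}$. *)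

(* Defs.v *)
From HB Require Import structures.
From mathcomp Require Import all_boot all_order all_fingroup all_algebra.
From mathcomp Require Import generic_quotient ring_quotient fraction finmap.
From mathcomp.multinomials Require Import monalg.
From mathcomp Require Import boolp reals complex.

Set Implicit Arguments.
Unset Strict Implicit.
Unset Printing Implicit Defensive.

Import GRing.Theory.
Local Open Scope ring_scope.
Local Open Scope quotient_scope.

(* Superalgebras over K: a unital associative ring A with a central structure
   map [salg] from K (the K-module structure is k, x |-> salg k * x) and a
   Z/2-grading, given by the projections [spart i] onto the elements of parity
   i, where true stands for odd.  The library's algType is not used because it
   requires 1 != 0, which is not available a priori for an algebra given by
   generators and relations. *)
HB.mixin Record isSuperAlgebra (K : comNzRingType) A of GRing.PzRing A := {
  salg : {rmorphism K -> A};
  salgC : forall k (x : A), salg k * x = x * salg k;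
  spart : bool -> A -> A;
  spartD : forall i, {morph spart i : x y / x + y};
  spartZ : forall i k x, spart i (salg k * x) = salg k * spart i x;
  spart_sum : forall x, spart false x + spart true x = x;
  spart_spart : forall i j x,
    spart i (spart j x) = if i == j then spart j x else 0;
  spart1 : spart false 1 = 1;
  spartM : forall i j x y,
    spart (i (+) j) (spart i x * spart j y) = spart i x * spart j y
}.

#[short(type="superAlgType")]
HB.structure Definition SuperAlgebra (K : comNzRingType) :=
  {A of GRing.PzRing A & isSuperAlgebra K A}.

HB.mixin Record isSuperMorphism (K : comNzRingType) (A B : superAlgType K)
    (f : A -> B) := {
  supermorph_salg : forall k : K, f (salg k) = salg k;
  supermorph_spart : forall i x, f (@spart K _ i x) = spart i (f x)
}.

HB.structure Definition SuperMorphism (K : comNzRingType)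
    (A B : superAlgType K) :=
  {f of @GRing.RMorphism A B f & isSuperMorphism K A B f}.

Notation "{ 'supermorphism' A -> B }" := (@SuperMorphism.type _ A%type B%type)
  (at level 0, A at level 98, B at level 99,
   format "{ 'supermorphism'  A  ->  B }") : type_scope.

Section SuperTheory.
Variables (K : comNzRingType) (A : superAlgType K).
Implicit Types (x y : A) (i j : bool) (k : K).

Lemma spart_is_zmod_morphism i : zmod_morphism (@spart K A i).
Proof.
have s0 : @spart K A i 0 = 0 by apply: (addrI (spart i 0)); rewrite -spartD !addr0.
have sN y : @spart K A i (- y) = - spart i y.
  by apply: (addrI (spart i y)); rewrite -spartD !subrr.
by move=> x y; rewrite spartD sN.
Qed.

HB.instance Definition _ i :=
  GRing.isZmodMorphism.Build A A (@spart K A i) (spart_is_zmod_morphism i).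

Lemma spartK i x : spart i (spart i x) = spart i x.
Proof. by rewrite spart_spart eqxx. Qed.

Lemma spart_sumb x : \sum_(i : bool) spart i x = x.
Proof. by rewrite big_bool /= addrC spart_sum. Qed.

Lemma spart_hom i j x : spart i x = x -> spart j x = if j == i then x else 0.
Proof. by move=> <-; rewrite spart_spart; case: eqP => // ->. Qed.

Lemma spart1E i : spart i (1 : A) = if i then 0 else 1.
Proof. by rewrite (spart_hom i (@spart1 K A)); case: i. Qed.

Lemma spart_homM i j x y :
  spart i x = x -> spart j y = y -> spart (i (+) j) (x * y) = x * y.
Proof. by move=> <- <-; rewrite spartM. Qed.

Lemma spart_mul i x y :
  spart i (x * y) = \sum_(j : bool) spart j x * spart (i (+) j) y.
Proof.
rewrite -{1}(spart_sumb x) mulr_suml raddf_sum.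
apply: eq_bigr => j _; rewrite -{1}(spart_sumb y) mulr_sumr raddf_sum /=.
rewrite (bigD1 (i (+) j)) //= big1 ?addr0 => [|k nk].
  by rewrite -{1}(addbK j i) addbC spartM.
rewrite (spart_hom (i := j (+) k)) ?spartM //; case: eqP => // e.
by move: nk; rewrite e (addbC j k) addbK eqxx.
Qed.

Lemma salgA k x y : salg k * (x * y) = x * (salg k * y).
Proof. by rewrite mulrA salgC mulrA. Qed.

End SuperTheory.

Section Identity.
Variables (K : comNzRingType) (A : superAlgType K).

Fact idfun_salg (k : K) : idfun (salg k : A) = salg k. Proof. by []. Qed.
Fact idfun_spart i (x : A) : idfun (spart i x) = spart i (idfun x).
Proof. by []. Qed.

HB.instance Definition _ :=
  isSuperMorphism.Build K A A idfun idfun_salg idfun_spart.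
End Identity.

(* K itself, purely even *)
Section Regular.
Variable K : comNzRingType.

Definition regular_spart (i : bool) (x : K^o) : K^o := if i then 0 else x.
Local Notation sp := regular_spart.

Fact regular_spartD i : {morph sp i : x y / x + y}.
Proof. by case: i => x y //=; rewrite addr0. Qed.
Fact regular_spartZ i (k : K) x : sp i (k * x) = k * sp i x.
Proof. by case: i => //=; rewrite mulr0. Qed.
Fact regular_spart_sum x : sp false x + sp true x = x.
Proof. exact: addr0. Qed.
Fact regular_spart_spart i j x : sp i (sp j x) = if i == j then sp j x else 0.
Proof. by case: i; case: j. Qed.
Fact regular_spartM i j x y : sp (i (+) j) (sp i x * sp j y) = sp i x * sp j y.
Proof. by case: i; case: j; rewrite //= ?mul0r ?mulr0. Qed.

HB.instance Definition _ :=
  isSuperAlgebra.Build K K^o (salg := idfun : {rmorphism K -> K}) (@mulrC K)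
    regular_spartD regular_spartZ regular_spart_sum regular_spart_spart
    (erefl 1) regular_spartM.
End Regular.
(* Tensor product over K.  The underlying K-module of A (x) B is the quotient
   of the formal sums of pairs (a, b) by the bilinearity relations. *)
Section Tensor.
Variables (K : comNzRingType) (A B : superAlgType K).

Inductive tens_cong : seq (A * B) -> seq (A * B) -> Prop :=
| TensRefl s : tens_cong s s
| TensSym s t : tens_cong s t -> tens_cong t s
| TensTrans s t u : tens_cong s t -> tens_cong t u -> tens_cong s u
| TensCat s s' t t' :
    tens_cong s s' -> tens_cong t t' -> tens_cong (s ++ t) (s' ++ t')
| TensC s t : tens_cong (s ++ t) (t ++ s)
| Tens0 b : tens_cong [:: (0, b)] [::]
| TensDl a a' b : tens_cong [:: (a + a', b)] [:: (a, b); (a', b)]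
| TensDr a b b' : tens_cong [:: (a, b + b')] [:: (a, b); (a, b')]
| TensZ k a b : tens_cong [:: (salg k * a, b)] [:: (a, salg k * b)].

Definition tens_rel (s t : seq (A * B)) : bool := `[< tens_cong s t >].

Fact tens_rel_equiv : equiv_class_of tens_rel.
Proof.
split=> [s|s t|t s u].
- exact/asboolP/TensRefl.
- by apply/asboolP/asboolP; apply: TensSym.
- by move=> /asboolP st /asboolP tu; apply/asboolP/(TensTrans st tu).
Qed.

Canonical tens_equiv := EquivRelPack tens_rel_equiv.
Canonical tens_encModRel := defaultEncModRel tens_rel.

Definition tens := {eq_quot tens_rel}.

HB.instance Definition _ := Choice.on tens.
HB.instance Definition _ := EqQuotient.on tens.

Definition tsum (s : seq (A * B)) : tens := \pi_tens s.
Definition tpure (a : A) (b : B) : tens := tsum [:: (a, b)].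

Lemma tsum_eq s t : tens_cong s t -> tsum s = tsum t.
Proof. by move=> st; apply/eqmodP/asboolP. Qed.

Lemma tsum_repr x : tsum (repr x) = x.
Proof. exact: reprK. Qed.

Lemma tsum_cong s t : tsum s = tsum t -> tens_cong s t.
Proof. by move/eqmodP/asboolP. Qed.

Definition tens_opp_seq (s : seq (A * B)) := [seq (- u.1, u.2) | u <- s].
Definition tens_zero : tens := tsum [::].
Definition tens_add (x y : tens) : tens := tsum (repr x ++ repr y).
Definition tens_opp (x : tens) : tens := tsum (tens_opp_seq (repr x)).

Lemma tens_addE s t : tens_add (tsum s) (tsum t) = tsum (s ++ t).
Proof. by apply/tsum_eq/TensCat; apply/tsum_cong/tsum_repr. Qed.

Fact tens_addA : associative tens_add.
Proof.
move=> x y z; rewrite -(tsum_repr x) -(tsum_repr y) -(tsum_repr z).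
by rewrite !tens_addE catA.
Qed.

Fact tens_addC : commutative tens_add.
Proof. by move=> x y; apply/tsum_eq/TensC. Qed.

Fact tens_add0 : left_id tens_zero tens_add.
Proof. by move=> x; rewrite -(tsum_repr x) tens_addE. Qed.

Fact tens_addN : left_inverse tens_zero tens_opp tens_add.
Proof.
move=> x; rewrite -{2}(tsum_repr x) tens_addE; move: (repr x) => {x}.
elim=> [//|[a b] s IHs]; rewrite -[RHS]tens_add0 -[X in _ = tens_add _ X]IHs.
rewrite /tens_zero tens_addE; apply/tsum_eq; rewrite [tens_opp_seq _]/=.
apply: (@TensTrans _ (([:: (- a, b)] ++ [:: (a, b)]) ++ (tens_opp_seq s ++ s))).
  rewrite -[(a, b) :: s]cat1s -!catA !catA -cat1s.
  apply: TensCat (TensRefl s); rewrite -!catA; apply: TensCat; first exact: TensRefl.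
  exact: TensC.
apply: TensCat (TensRefl _).
by apply: TensTrans (TensSym (TensDl _ _ _)) _; rewrite addNr; apply: Tens0.
Qed.

HB.instance Definition _ :=
  GRing.isZmodule.Build tens tens_addA tens_addC tens_add0 tens_addN.

Lemma tsum_cat s t : tsum (s ++ t) = tsum s + tsum t.
Proof. by rewrite -tens_addE. Qed.

Lemma tsumE s : tsum s = \sum_(u <- s) tpure u.1 u.2.
Proof.
elim: s => [|[a b] s IHs]; first by rewrite big_nil.
by rewrite big_cons -IHs -tsum_cat.
Qed.

Lemma tpureDl a a' b : tpure (a + a') b = tpure a b + tpure a' b.
Proof. by rewrite -tsum_cat; apply/tsum_eq/TensDl. Qed.

Lemma tpureDr a b b' : tpure a (b + b') = tpure a b + tpure a b'.
Proof. by rewrite -tsum_cat; apply/tsum_eq/TensDr. Qed.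

Lemma tpureZ k a b : tpure (salg k * a) b = tpure a (salg k * b).
Proof. exact/tsum_eq/TensZ. Qed.

Fact tpure_is_zmod_morphism_l b : zmod_morphism (tpure^~ b).
Proof.
move=> x y; apply: (addIr (tpure y b)); rewrite -tpureDl !addrNK //.
Qed.
Fact tpure_is_zmod_morphism_r a : zmod_morphism (tpure a).
Proof.
move=> x y; apply: (addIr (tpure a y)); rewrite -tpureDr !addrNK //.
Qed.

HB.instance Definition _ a :=
  GRing.isZmodMorphism.Build B tens (tpure a) (tpure_is_zmod_morphism_r a).

Lemma tpure0l b : tpure 0 b = 0.
Proof. exact/tsum_eq/Tens0. Qed.

Lemma tpure0r a : tpure a 0 = 0.
Proof. exact: (raddf0 (tpure a)). Qed.

Lemma tens_ind (P : tens -> Prop) :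
  P 0 -> (forall a b, P (tpure a b)) -> (forall x y, P x -> P y -> P (x + y)) ->
  forall x, P x.
Proof.
move=> P0 Pp PD x; rewrite -(tsum_repr x) tsumE.
by elim/big_ind: _ => // u _; apply: Pp.
Qed.

Section Lift.
Variables (V : zmodType) (f : A -> B -> V).

(* The additive map sending tpure a b to f a b; meaningful when f is balanced. *)
Definition tens_lift (x : tens) : V := \sum_(u <- repr x) f u.1 u.2.

Definition balanced := [/\ forall a, {morph f a : b b' / b + b'},
  forall b, {morph f^~ b : a a' / a + a'}
  & forall k a b, f (salg k * a) b = f a (salg k * b)].

Hypothesis fP : balanced.

Lemma tens_lift_sum s : tens_lift (tsum s) = \sum_(u <- s) f u.1 u.2.
Proof.
case: fP => fDr fDl fZ; rewrite /tens_lift.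
have sumE (t t' : seq (A * B)) : tens_cong t t' ->
  \sum_(u <- t) f u.1 u.2 = \sum_(u <- t') f u.1 u.2; last first.
  by apply/sumE/tsum_cong/tsum_repr.
elim=> {s t t'} [//|s t _ ->//|s t u _ -> _ ->//|s s' t t' _ e _ e'|s t|b|a a' b|a b b'|k a b].
- by rewrite !big_cat /= e e'.
- by rewrite !big_cat /= addrC.
- by rewrite big_seq1 big_nil; apply: (addrI (f 0 b)); rewrite -fDl !addr0.
- by rewrite !big_cons !big_nil !addr0 fDl.
- by rewrite !big_cons !big_nil !addr0 fDr.
- by rewrite !big_seq1 fZ.
Qed.

Lemma tens_liftE a b : tens_lift (tpure a b) = f a b.
Proof. by rewrite tens_lift_sum big_seq1. Qed.

Lemma tens_liftD : {morph tens_lift : x y / x + y}.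
Proof.
move=> x y; rewrite -(tsum_repr x) -(tsum_repr y) -tsum_cat !tens_lift_sum.
by rewrite big_cat.
Qed.

Lemma tens_lift0 : tens_lift 0 = 0.
Proof. by apply: (addrI (tens_lift 0)); rewrite -tens_liftD !addr0. Qed.

End Lift.
End Tensor.

Arguments tpure {K A B} a b.
Notation "A ⊗ B" := (tens A%type B%type) (at level 35, right associativity) : type_scope.
Notation "a ⊗ b" := (tpure a b) (at level 35, right associativity) : ring_scope.

Section LiftAdditive.
Variables (K : comNzRingType) (A B : superAlgType K) (V : zmodType).

Lemma tens_lift_pt (f g : A -> B -> V) :
  (forall a b, f a b = g a b) -> tens_lift f =1 tens_lift g.
Proof. by move=> fg x; apply: eq_bigr. Qed.

Lemma tens_ext (f g : A ⊗ B -> V) :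
  {morph f : x y / x + y} -> {morph g : x y / x + y} ->
  (forall a b, f (a ⊗ b) = g (a ⊗ b)) -> f =1 g.
Proof.
move=> fD gD fg; have f0 : f 0 = 0 by apply: (addrI (f 0)); rewrite -fD !addr0.
have g0 : g 0 = 0 by apply: (addrI (g 0)); rewrite -gD !addr0.
by elim/tens_ind=> [|a b|x y ex ey]; rewrite ?f0 ?g0 ?fD ?gD ?ex ?ey.
Qed.
End LiftAdditive.

Section TensorSuper.
Variables (K : comNzRingType) (A B : superAlgType K).
Implicit Types (a c : A) (b d : B) (x y z : A ⊗ B) (i j : bool) (k : K).

(* (a ⊗ b)(c ⊗ d) = (-1)^(|b||c|) ac ⊗ bd for homogeneous b and c *)
Definition tens_mul2 a b c d : A ⊗ B :=
  \sum_(i : bool) \sum_(j : bool)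
    (salg ((-1) ^+ (i && j)) * (a * spart j c)) ⊗ (spart i b * d).

Definition tens_mul x y : A ⊗ B :=
  tens_lift (fun a b => tens_lift (tens_mul2 a b) y) x.

Definition tens_one : A ⊗ B := 1 ⊗ 1.
Definition tens_salg k : A ⊗ B := salg k ⊗ 1.

Definition tens_spart i x : A ⊗ B :=
  tens_lift (fun a b => \sum_(j : bool) spart j a ⊗ spart (i (+) j) b) x.

Lemma tens_mul2_balanced_r a b : balanced (tens_mul2 a b).
Proof.
split=> [c d d'|d c c'|k c d]; rewrite /tens_mul2 /= -?big_split /=.
all: apply: eq_bigr => i _; rewrite -?big_split /=; apply: eq_bigr => j _.
- by rewrite mulrDr tpureDr.
- by rewrite raddfD /= !mulrDr tpureDl.
- by rewrite spartZ -(salgA k a) -(salgA k (spart i b)) -tpureZ -(salgA k (salg _)).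
Qed.

Lemma tens_mul2_balanced_l c d : balanced (fun a b => tens_mul2 a b c d).
Proof.
split=> [a b b'|b a a'|k a b]; rewrite /tens_mul2 /= -?big_split /=.
all: apply: eq_bigr => i _; rewrite -?big_split /=; apply: eq_bigr => j _.
- by rewrite raddfD /= mulrDl tpureDr.
- by rewrite mulrDl mulrDr tpureDl.
- by rewrite spartZ -!mulrA -tpureZ (salgA k (salg _)).
Qed.

Let LD a b := tens_liftD (tens_mul2_balanced_r a b).
Let LE a b := tens_liftE (tens_mul2_balanced_r a b).
Let L0 a b := tens_lift0 (tens_mul2_balanced_r a b).

Lemma tens_mul_balanced y : balanced (fun a b => tens_lift (tens_mul2 a b) y).
Proof.
split=> [a b b'|b a a'|k a b] /=; elim/tens_ind: y => [|c d|x y ex ey].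
all: rewrite ?L0 ?LD ?LE ?addr0 //.
- by case: (tens_mul2_balanced_l c d) => + _ _; apply.
- by rewrite ex ey addrACA.
- by case: (tens_mul2_balanced_l c d) => _ + _; apply.
- by rewrite ex ey addrACA.
- by case: (tens_mul2_balanced_l c d) => _ _; apply.
- by rewrite ex ey.
Qed.

Lemma tens_mulDl : left_distributive tens_mul +%R.
Proof. by move=> x y z; rewrite /tens_mul (tens_liftD (tens_mul_balanced z)). Qed.

Lemma tens_mul0l x : tens_mul 0 x = 0.
Proof. by rewrite /tens_mul (tens_lift0 (tens_mul_balanced x)). Qed.

Lemma tens_mul_pure a b y : tens_mul (a ⊗ b) y = tens_lift (tens_mul2 a b) y.
Proof. by rewrite /tens_mul (tens_liftE (tens_mul_balanced y)). Qed.

Lemma tens_mulDr : right_distributive tens_mul +%R.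
Proof.
move=> x y z; elim/tens_ind: x => [|a b|x x' e e'].
- by rewrite !tens_mul0l addr0.
- by rewrite !tens_mul_pure LD.
- by rewrite !tens_mulDl e e' addrACA.
Qed.

Lemma tens_mul0r x : tens_mul x 0 = 0.
Proof. by apply: (addrI (tens_mul x 0)); rewrite -tens_mulDr !addr0. Qed.

Lemma tens_ind_hom (P : A ⊗ B -> Prop) : P 0 ->
  (forall i j a b, spart i a = a -> spart j b = b -> P (a ⊗ b)) ->
  (forall x y, P x -> P y -> P (x + y)) -> forall x, P x.
Proof.
move=> P0 Pp PD; apply: tens_ind => // a b.
rewrite -(spart_sum a) -(spart_sum b) tpureDl !tpureDr.
by apply: (PD); apply: (PD); apply: Pp (spartK _ _) (spartK _ _).
Qed.

Lemma tens_mul_hom i j a b c d : spart i b = b -> spart j c = c ->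
  tens_mul (a ⊗ b) (c ⊗ d) = (salg ((-1) ^+ (i && j)) * (a * c)) ⊗ (b * d).
Proof.
move=> hb hc; rewrite tens_mul_pure LE /tens_mul2.
rewrite (bigD1 i) //= [X in _ + X]big1 ?addr0 => [|i' /negbTE ni]; last first.
  by apply: big1 => j' _; rewrite (spart_hom _ hb) ni mul0r tpure0r.
rewrite (bigD1 j) //= [X in _ + X]big1 ?addr0 => [|j' /negbTE nj].
  by rewrite hb hc.
by rewrite (spart_hom _ hc) nj !mulr0 tpure0l.
Qed.

Lemma tens_mulA : associative tens_mul.
Proof.
move=> x y z; elim/tens_ind_hom: x => [|i1 j1 a b ha hb|x x' e e'].
- by rewrite !tens_mul0l.
- elim/tens_ind_hom: y => [|i2 j2 c d hc hd|y y' e e'].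
  + by rewrite tens_mul0r !tens_mul0l tens_mul0r.
  + elim/tens_ind_hom: z => [|i3 j3 u v hu hv|z z' e e'].
    * by rewrite !tens_mul0r.
    * rewrite (tens_mul_hom _ _ hd hu) (tens_mul_hom _ _ hb hc).
      rewrite (tens_mul_hom _ _ (spart_homM hb hd) hu).
      rewrite (tens_mul_hom (j := i2 (+) i3) _ _ hb); last first.
        by rewrite spartZ spart_homM.
      rewrite -(salgA _ a) !mulrA; congr (_ ⊗ _).
      rewrite -!rmorphM -!signr_addb.
      by congr (salg (_ ^+ nat_of_bool _) * _ * _ * _); case: j1 j2 i2 i3 {ha hb hc hd hu hv} => [] [] [] [].
    * by rewrite !tens_mulDr e e'.
  + by rewrite tens_mulDl !tens_mulDr !tens_mulDl e e'.
- by rewrite !tens_mulDl e e'.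
Qed.

Lemma tens_mul1l : left_id tens_one tens_mul.
Proof.
move=> x; elim/tens_ind_hom: x => [|i j a b ha hb|x y e e'].
- exact: tens_mul0r.
- rewrite (tens_mul_hom (i := false) _ _ _ ha) ?spart1 //=.
  by rewrite rmorph1 !mul1r.
- by rewrite tens_mulDr e e'.
Qed.

Lemma tens_mul1r : right_id tens_one tens_mul.
Proof.
move=> x; elim/tens_ind_hom: x => [|i j a b ha hb|x y e e'].
- exact: tens_mul0l.
- rewrite (tens_mul_hom (j := false) _ _ hb) ?spart1 // andbF.
  by rewrite rmorph1 mul1r !mulr1.
- by rewrite tens_mulDl e e'.
Qed.

HB.instance Definition _ := GRing.Zmodule_isPzRing.Build (tens A B)
  tens_mulA tens_mul1l tens_mul1r tens_mulDl tens_mulDr.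

Lemma tens_mulE i j a b c d : spart i b = b -> spart j c = c ->
  (a ⊗ b) * (c ⊗ d) = (salg ((-1) ^+ (i && j)) * (a * c)) ⊗ (b * d).
Proof. exact: tens_mul_hom. Qed.

Lemma spart_salg i k : spart i (salg k : A) = if i then 0 else salg k.
Proof. by rewrite -[salg k]mulr1 spartZ spart1E; case: i; rewrite ?mulr0. Qed.

Fact tens_salg_is_zmod_morphism : zmod_morphism tens_salg.
Proof. by move=> k l; rewrite /tens_salg raddfB /= tpure_is_zmod_morphism_l. Qed.

Fact tens_salg_is_monoid_morphism : monoid_morphism tens_salg.
Proof.
split=> [|k l]; first by rewrite /tens_salg rmorph1.
rewrite /tens_salg (tens_mulE (i := false) (j := false)) ?spart1 ?spart_salg //.
by rewrite rmorph1 mul1r mulr1 rmorphM.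
Qed.

HB.instance Definition _ :=
  GRing.isZmodMorphism.Build K (tens A B) tens_salg tens_salg_is_zmod_morphism.
HB.instance Definition _ :=
  GRing.isMonoidMorphism.Build K (tens A B) tens_salg tens_salg_is_monoid_morphism.

Lemma tens_salgM k a b : tens_salg k * (a ⊗ b) = (salg k * a) ⊗ b.
Proof.
rewrite -(spart_sum a) mulrDr !(tpureDl, mulrDr) /tens_salg.
by rewrite !(tens_mulE (i := false) _ _ _ (spartK _ _)) ?spart1 //= rmorph1 !mul1r.
Qed.

Fact tens_salgC k x : tens_salg k * x = x * tens_salg k.
Proof.
elim/tens_ind: x => [|a b|x y e e']; rewrite ?mulr0 ?mul0r //; last first.
  by rewrite mulrDr mulrDl e e'.
rewrite tens_salgM -(spart_sum b) !(tpureDr, mulrDl) /tens_salg.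
rewrite !(tens_mulE (j := false) _ _ (spartK _ _)) ?spart_salg //.
by rewrite !andbF rmorph1 !mul1r !mulr1 -!salgC.
Qed.

Lemma tens_spart_balanced i :
  balanced (fun a b => \sum_(j : bool) spart j a ⊗ spart (i (+) j) b : A ⊗ B).
Proof.
split=> [a b b'|b a a'|k a b]; rewrite /= -?big_split /=; apply: eq_bigr => j _.
- by rewrite spartD tpureDr.
- by rewrite spartD tpureDl.
- by rewrite !spartZ tpureZ.
Qed.

Fact tens_spartD i : {morph tens_spart i : x y / x + y}.
Proof. exact: tens_liftD (tens_spart_balanced i). Qed.

Let tens_spart0 i : tens_spart i 0 = 0.
Proof. exact: tens_lift0 (tens_spart_balanced i). Qed.

Lemma tens_spart_pure i a b :
  tens_spart i (a ⊗ b) = \sum_(j : bool) spart j a ⊗ spart (i (+) j) b.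
Proof. exact: tens_liftE (tens_spart_balanced i) a b. Qed.

Lemma tens_spart_hom i j l a b : spart j a = a -> spart l b = b ->
  tens_spart i (a ⊗ b) = if i == j (+) l then a ⊗ b else 0.
Proof.
move=> ha hb; rewrite tens_spart_pure (bigD1 j) //= big1 ?addr0 => [|j' nj].
  have -> : (i == j (+) l) = (i (+) j == l) by case: (i) (j) (l) => [] [] [].
  by rewrite ha (spart_hom _ hb); case: eqP; rewrite ?tpure0r.
by rewrite (spart_hom _ ha) (negbTE nj) tpure0l.
Qed.

Fact tens_spartZ i k x : tens_spart i (tens_salg k * x) = tens_salg k * tens_spart i x.
Proof.
elim/tens_ind_hom: x => [|j l a b ha hb|x y e e'].
- by rewrite mulr0 tens_spart0 mulr0.
- rewrite tens_salgM (tens_spart_hom _ ha hb).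
  rewrite (@tens_spart_hom i j l) ?spartZ ?ha //.
  by case: ifP; rewrite ?mulr0 ?tens_salgM.
- by rewrite mulrDr !tens_spartD mulrDr e e'.
Qed.

Fact tens_spart_sum x : tens_spart false x + tens_spart true x = x.
Proof.
elim/tens_ind_hom: x => [|j l a b ha hb|x y e e'].
- by rewrite !tens_spart0 addr0.
- by rewrite !(tens_spart_hom _ ha hb); case: (j (+) l); rewrite ?addr0 ?add0r.
- by rewrite !tens_spartD addrACA e e'.
Qed.

Fact tens_spart_spart i j x :
  tens_spart i (tens_spart j x) = if i == j then tens_spart j x else 0.
Proof.
elim/tens_ind_hom: x => [|m l a b ha hb|x y e e'].
- by rewrite !tens_spart0 if_same.
- rewrite (tens_spart_hom j ha hb); case: ifP => [/eqP->|]; last first.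
    by rewrite tens_spart0 if_same.
  by rewrite (tens_spart_hom i ha hb).
- by rewrite !tens_spartD e e'; case: ifP; rewrite ?addr0.
Qed.

Fact tens_spart1 : tens_spart false 1 = 1.
Proof. by rewrite (@tens_spart_hom false false false) ?spart1. Qed.

Fact tens_spartM i j x y : tens_spart (i (+) j) (tens_spart i x * tens_spart j y) =
  tens_spart i x * tens_spart j y.
Proof.
elim/tens_ind_hom: x => [|m l a b ha hb|x x' e e'].
- by rewrite !tens_spart0 mul0r tens_spart0.
- elim/tens_ind_hom: y => [|p q c d hc hd|y y' e e'].
  + by rewrite !tens_spart0 mulr0 tens_spart0.
  + rewrite (tens_spart_hom i ha hb) (tens_spart_hom j hc hd).
    case: eqP => [->|_]; last by rewrite mul0r tens_spart0.
    case: eqP => [->|_]; last by rewrite mulr0 tens_spart0.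
    rewrite (tens_mulE _ _ hb hc).
    rewrite (@tens_spart_hom _ (m (+) p) (l (+) q)) ?spartZ ?spart_homM //.
    by rewrite addbACA eqxx.
  + by rewrite tens_spartD mulrDr tens_spartD e e'.
- by rewrite tens_spartD mulrDl tens_spartD e e'.
Qed.

HB.instance Definition _ := isSuperAlgebra.Build K (tens A B) tens_salgC
  tens_spartD tens_spartZ tens_spart_sum tens_spart_spart tens_spart1 tens_spartM.

Lemma tens_salgZ k a b : salg k * (a ⊗ b) = (salg k * a) ⊗ b.
Proof. exact: tens_salgM. Qed.

End TensorSuper.
Section TensorMaps.
Variables (K : comNzRingType).

Definition tens_map (A B A' B' : superAlgType K)
    (f : {supermorphism A -> A'}) (g : {supermorphism B -> B'}) :
    A ⊗ B -> A' ⊗ B' :=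
  tens_lift (fun a b => f a ⊗ g b).

Lemma tens_map_balanced (A B A' B' : superAlgType K)
    (f : {supermorphism A -> A'}) (g : {supermorphism B -> B'}) :
  balanced (fun a b => f a ⊗ g b : A' ⊗ B').
Proof.
split=> [a b b'|b a a'|k a b] /=; rewrite ?rmorphD ?tpureDr ?tpureDl //.
by rewrite !rmorphM /= !supermorph_salg tpureZ.
Qed.

(* the canonical isomorphisms (A ⊗ B) ⊗ C = A ⊗ (B ⊗ C) and K ⊗ A = A *)
Definition tens_assoc (A B C : superAlgType K) : (A ⊗ B) ⊗ C -> A ⊗ (B ⊗ C) :=
  tens_lift (fun t c => tens_lift (fun a b => a ⊗ (b ⊗ c)) t).

Definition tens_unitl (A : superAlgType K) : K^o ⊗ A -> A :=
  tens_lift (fun (k : K^o) x => salg (k : K) * x).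

Lemma tens_mapE (A B A' B' : superAlgType K)
    (f : {supermorphism A -> A'}) (g : {supermorphism B -> B'}) a b :
  tens_map f g (a ⊗ b) = f a ⊗ g b.
Proof. exact: tens_liftE (tens_map_balanced f g) a b. Qed.

Lemma tens_assocE (A B C : superAlgType K) (a : A) (b : B) (c : C) :
  tens_assoc ((a ⊗ b) ⊗ c) = a ⊗ (b ⊗ c).
Proof.
have bal c' : balanced (fun a b => a ⊗ (b ⊗ c') : A ⊗ (B ⊗ C)).
  split=> [x y y'|y x x'|k x y] /=; rewrite ?tpureDl ?tpureDr ?tpureZ //.
  by rewrite tens_salgZ tpureZ.
have LE c' := tens_liftE (bal c'); have L0 c' := tens_lift0 (bal c').
have LD c' := tens_liftD (bal c').
rewrite /tens_assoc tens_liftE ?LE //.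
split=> [t d d'|d t t'|k t d] /=; rewrite ?LD //.
- elim/tens_ind: t => [|x y|x y e e'].
  + by rewrite !L0 addr0.
  + by rewrite !LE !tpureDr.
  + by rewrite !LD e e' addrACA.
- elim/tens_ind: t => [|x y|x y e e'].
  + by rewrite mulr0 !L0.
  + by rewrite tens_salgZ !LE !tpureZ tens_salgZ -tpureZ.
  + by rewrite mulrDr !LD e e'.
Qed.

Lemma tens_unitlE (A : superAlgType K) (k : K^o) (x : A) :
  tens_unitl (k ⊗ x) = salg (k : K) * x.
Proof.
rewrite /tens_unitl tens_liftE //.
split=> [{}k y y'|y l l'|l m y] /=; rewrite ?mulrDr ?rmorphD ?mulrDl //.
by rewrite rmorphM -mulrA salgA.
Qed.

(* H is meant to be a Hopf superalgebra with comultiplication Delta and counit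
   eps. *)
Definition is_coaction (H V : superAlgType K)
    (Delta : {supermorphism H -> H ⊗ H}) (eps : {supermorphism H -> K^o})
    (delta : {supermorphism V -> H ⊗ V}) : Prop :=
  (forall v, tens_assoc (tens_map Delta idfun (delta v)) =
             tens_map idfun delta (delta v)) /\
  (forall v, tens_unitl (tens_map eps idfun (delta v)) = v).

End TensorMaps.

(* The quotient of A by the graded two-sided ideal generated by S.  When the
   elements of S are homogeneous this is the two-sided ideal generated by S. *)
Section Quotient.
Variables (K : comNzRingType) (A : superAlgType K) (S : A -> Prop).

Inductive graded_ideal : A -> Prop :=
| GIdealGen i s : S s -> graded_ideal (spart i s)
| GIdeal0 : graded_ideal 0
| GIdealD x y : graded_ideal x -> graded_ideal y -> graded_ideal (x + y)
| GIdealM a x b : graded_ideal x -> graded_ideal (a * x * b).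

Definition gideal : {pred A} := fun x => `[< graded_ideal x >].

Fact gideal_zmod_closed : zmod_closed gideal.
Proof.
split=> [|x y /asboolP Ix /asboolP Iy]; apply/asboolP; first exact: GIdeal0.
by apply: GIdealD => //; have := GIdealM (-1) 1 Iy; rewrite mulN1r mulr1.
Qed.

HB.instance Definition _ := GRing.isZmodClosed.Build A gideal gideal_zmod_closed.

Lemma gidealM a x b : x \in gideal -> a * x * b \in gideal.
Proof. by move=> /asboolP Ix; apply/asboolP/GIdealM. Qed.

Lemma gideal_mem s : S s -> s \in gideal.
Proof.
by move=> Ss; rewrite -(spart_sum s) rpredD //; apply/asboolP; constructor.
Qed.

Lemma gideal_spart i x : x \in gideal -> spart i x \in gideal.
Proof.
move=> /asboolP Ix; elim: Ix i => {x} [j s Ss|j|x y _ Ix _ Iy j|a x b _ Ix j].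
- move=> j'; rewrite spart_spart; case: ifP => _; last exact: rpred0.
  by apply/asboolP; constructor.
- by rewrite raddf0 rpred0.
- by rewrite spartD rpredD.
- rewrite spart_mul rpred_sum // => l _.
  rewrite spart_mul mulr_suml rpred_sum // => m _.
  exact: gidealM.
Qed.

Definition superquot : Type := (Quotient.quot gideal).
HB.instance Definition _ := GRing.Zmodule.on superquot.
HB.instance Definition _ := EqQuotient.on superquot.

Definition qproj (x : A) : superquot := \pi_superquot x.

Lemma qproj_repr (x : superquot) : qproj (repr x) = x.
Proof. exact: reprK. Qed.

Lemma qproj_eq x y : (qproj x = qproj y) <-> (x - y \in gideal).
Proof.
by split=> [e|e]; [rewrite Quotient.idealrBE; apply/eqP
                  |apply/eqP; rewrite -Quotient.idealrBE].
Qed.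

Fact qproj_is_zmod_morphism : zmod_morphism qproj.
Proof. exact: (pi_is_zmod_morphism (Quotient.quot gideal)). Qed.

HB.instance Definition _ :=
  GRing.isZmodMorphism.Build A superquot qproj qproj_is_zmod_morphism.

Lemma qproj_rel s : S s -> qproj s = 0.
Proof.
by move=> Ss; rewrite -(raddf0 qproj); apply/qproj_eq; rewrite subr0 gideal_mem.
Qed.

Definition quot_one : superquot := qproj 1.
Definition quot_mul (x y : superquot) : superquot := qproj (repr x * repr y).
Definition quot_spart i (x : superquot) : superquot := qproj (spart i (repr x)).

Lemma quot_mulE x y : quot_mul (qproj x) (qproj y) = qproj (x * y).
Proof.
have h z : repr (qproj z) - z \in gideal by apply/qproj_eq/qproj_repr.
apply/qproj_eq; rewrite -(subrKA (x * repr (qproj y))) rpredD //.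
  by rewrite -mulrBl -[_ * _]mul1r mulrA gidealM.
by rewrite -mulrBr -[_ * _]mulr1 gidealM.
Qed.

Lemma quot_spartE i x : quot_spart i (qproj x) = qproj (spart i x).
Proof.
by apply/qproj_eq; rewrite -raddfB gideal_spart //; apply/qproj_eq/qproj_repr.
Qed.

Lemma quot_ind (P : superquot -> Prop) : (forall x, P (qproj x)) -> forall x, P x.
Proof. by move=> h x; rewrite -(qproj_repr x). Qed.

Fact quot_mulA : associative quot_mul.
Proof.
by elim/quot_ind=> x; elim/quot_ind=> y; elim/quot_ind=> z; rewrite !quot_mulE mulrA.
Qed.
Fact quot_mul1l : left_id quot_one quot_mul.
Proof. by elim/quot_ind=> x; rewrite quot_mulE mul1r. Qed.
Fact quot_mul1r : right_id quot_one quot_mul.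
Proof. by elim/quot_ind=> x; rewrite quot_mulE mulr1. Qed.
Fact quot_mulDl : left_distributive quot_mul +%R.
Proof.
elim/quot_ind=> x; elim/quot_ind=> y; elim/quot_ind=> z.
by rewrite -raddfD !quot_mulE mulrDl raddfD.
Qed.
Fact quot_mulDr : right_distributive quot_mul +%R.
Proof.
elim/quot_ind=> x; elim/quot_ind=> y; elim/quot_ind=> z.
by rewrite -raddfD !quot_mulE mulrDr raddfD.
Qed.

HB.instance Definition _ := GRing.Zmodule_isPzRing.Build superquot
  quot_mulA quot_mul1l quot_mul1r quot_mulDl quot_mulDr.

Fact qproj_is_monoid_morphism : monoid_morphism qproj.
Proof. by split=> // x y; rewrite -quot_mulE. Qed.

HB.instance Definition _ :=
  GRing.isMonoidMorphism.Build A superquot qproj qproj_is_monoid_morphism.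

Definition quot_salg : {rmorphism K -> superquot} := qproj \o @salg K A.

Fact quot_salgC k x : quot_salg k * x = x * quot_salg k.
Proof. by elim/quot_ind: x => x; rewrite /= -!rmorphM salgC. Qed.
Fact quot_spartD i : {morph quot_spart i : x y / x + y}.
Proof.
elim/quot_ind=> x; elim/quot_ind=> y.
by rewrite -raddfD !quot_spartE spartD raddfD.
Qed.
Fact quot_spartZ i k x : quot_spart i (quot_salg k * x) = quot_salg k * quot_spart i x.
Proof.
by elim/quot_ind: x => x; rewrite /= quot_spartE -!rmorphM quot_spartE spartZ.
Qed.
Fact quot_spart_sum x : quot_spart false x + quot_spart true x = x.
Proof. by elim/quot_ind: x => x; rewrite !quot_spartE -raddfD spart_sum. Qed.
Fact quot_spart_spart i j x :
  quot_spart i (quot_spart j x) = if i == j then quot_spart j x else 0.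
Proof.
elim/quot_ind: x => x; rewrite !quot_spartE spart_spart.
by case: ifP => _ //; rewrite raddf0.
Qed.
Fact quot_spart1 : quot_spart false 1 = 1.
Proof. by rewrite [LHS]quot_spartE spart1. Qed.
Fact quot_spartM i j x y : quot_spart (i (+) j) (quot_spart i x * quot_spart j y) =
  quot_spart i x * quot_spart j y.
Proof.
elim/quot_ind: x => x; elim/quot_ind: y => y.
by rewrite (quot_spartE i x) (quot_spartE j y) [_ * _]quot_mulE quot_spartE spartM.
Qed.

HB.instance Definition _ := isSuperAlgebra.Build K superquot quot_salgC
  quot_spartD quot_spartZ quot_spart_sum quot_spart_spart quot_spart1 quot_spartM.

Fact qproj_salg (k : K) : qproj (salg k) = salg k. Proof. by []. Qed.
Fact qproj_spart i x : qproj (spart i x) = spart i (qproj x).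
Proof. by rewrite -quot_spartE. Qed.

HB.instance Definition _ :=
  isSuperMorphism.Build K A superquot qproj qproj_salg qproj_spart.

End Quotient.

(* The unital sub-superalgebra of A generated by S; for homogeneous S it is the
   subalgebra generated by S. *)
Section SubSuperalgebra.
Variables (K : comNzRingType) (A : superAlgType K) (S : A -> Prop).

Inductive super_generated : A -> Prop :=
| GenSpart i s : S s -> super_generated (spart i s)
| GenSalg k : super_generated (salg k)
| GenD x y : super_generated x -> super_generated y -> super_generated (x + y)
| GenM x y : super_generated x -> super_generated y -> super_generated (x * y).

Definition subgen : {pred A} := fun x => `[< super_generated x >].

Fact subgen_subring_closed : subring_closed subgen.
Proof.
have M x y : x \in subgen -> y \in subgen -> x * y \in subgen.
  by move=> /asboolP gx /asboolP gy; apply/asboolP/GenM.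
have sK k : salg k \in subgen by apply/asboolP/GenSalg.
split=> [|x y /asboolP gx gy|]; [by rewrite -(rmorph1 (@salg K A)) | | exact: M].
have /asboolP gNy : - y \in subgen by rewrite -mulN1r -(rmorphN1 (@salg K A)) M.
exact/asboolP/GenD.
Qed.

HB.instance Definition _ :=
  GRing.isSubringClosed.Build A subgen subgen_subring_closed.

Lemma subgen_mem s : S s -> s \in subgen.
Proof.
by move=> Ss; rewrite -(spart_sum s) rpredD //; apply/asboolP; constructor.
Qed.

Lemma subgen_salg k : salg k \in subgen.
Proof. by apply/asboolP/GenSalg. Qed.

Lemma subgen_spart i x : x \in subgen -> spart i x \in subgen.
Proof.
move=> /asboolP gx; elim: gx i => {x} [j s Ss i|k i|x y _ gx _ gy i|x y _ gx _ gy i].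
- rewrite spart_spart; case: ifP => _; last exact: rpred0.
  by apply/asboolP; constructor.
- rewrite spart_salg; case: i; [exact: rpred0 | exact: subgen_salg].
- by rewrite spartD rpredD.
- by rewrite spart_mul rpred_sum // => j _; rewrite rpredM.
Qed.

Record subsuper : Type := SubSuper {sub_val : A; _ : sub_val \in subgen}.

HB.instance Definition _ := [isSub for sub_val].
HB.instance Definition _ := [Choice of subsuper by <:].
HB.instance Definition _ := GRing.SubChoice_isSubPzRing.Build A subgen subsuper subgen_subring_closed.

Definition sub_salg (k : K) : subsuper := SubSuper (subgen_salg k).
Definition sub_spart i (x : subsuper) : subsuper :=
  SubSuper (subgen_spart i (valP x)).

Fact sub_salg_is_zmod_morphism : zmod_morphism sub_salg.
Proof. by move=> k l; apply: val_inj; rewrite raddfB /= rmorphB. Qed.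
Fact sub_salg_is_monoid_morphism : monoid_morphism sub_salg.
Proof.
by split=> [|k l]; apply: val_inj; rewrite ?rmorphM ?rmorph1 /= ?rmorphM ?rmorph1.
Qed.

HB.instance Definition _ :=
  GRing.isZmodMorphism.Build K subsuper sub_salg sub_salg_is_zmod_morphism.
HB.instance Definition _ :=
  GRing.isMonoidMorphism.Build K subsuper sub_salg sub_salg_is_monoid_morphism.

Fact sub_salgC k x : sub_salg k * x = x * sub_salg k.
Proof. by apply: val_inj; rewrite !rmorphM /= salgC. Qed.
Fact sub_spartD i : {morph sub_spart i : x y / x + y}.
Proof. by move=> x y; apply: val_inj; rewrite !rmorphD /= ?rmorphD spartD. Qed.
Fact sub_spartZ i k x : sub_spart i (sub_salg k * x) = sub_salg k * sub_spart i x.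
Proof. by apply: val_inj; rewrite !rmorphM /= ?rmorphM spartZ. Qed.
Fact sub_spart_sum x : sub_spart false x + sub_spart true x = x.
Proof. by apply: val_inj; rewrite !rmorphD /= spart_sum. Qed.
Fact sub_spart_spart i j x :
  sub_spart i (sub_spart j x) = if i == j then sub_spart j x else 0.
Proof. by apply: val_inj; rewrite /= spart_spart (fun_if val) rmorph0. Qed.
Fact sub_spart1 : sub_spart false 1 = 1.
Proof. by apply: val_inj; rewrite rmorph1 /= ?rmorph1 spart1. Qed.
Fact sub_spartM i j x y : sub_spart (i (+) j) (sub_spart i x * sub_spart j y) =
  sub_spart i x * sub_spart j y.
Proof. by apply: val_inj; rewrite !rmorphM /= ?rmorphM spartM. Qed.

HB.instance Definition _ := isSuperAlgebra.Build K subsuper sub_salgC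
  sub_spartD sub_spartZ sub_spart_sum sub_spart_spart sub_spart1 sub_spartM.

Fact sub_val_is_zmod_morphism : zmod_morphism sub_val.
Proof. exact: (rmorphB (val : subsuper -> A)). Qed.
Fact sub_val_is_monoid_morphism : monoid_morphism sub_val.
Proof.
by split=> [|x y]; [exact: (rmorph1 (val : subsuper -> A))
                   |exact: (rmorphM (val : subsuper -> A))].
Qed.
HB.instance Definition _ :=
  GRing.isZmodMorphism.Build subsuper A sub_val sub_val_is_zmod_morphism.
HB.instance Definition _ :=
  GRing.isMonoidMorphism.Build subsuper A sub_val sub_val_is_monoid_morphism.

Fact sub_val_salg (k : K) : sub_val (salg k) = salg k. Proof. by []. Qed.
Fact sub_val_spart i (x : subsuper) : sub_val (spart i x) = spart i (sub_val x).
Proof. by []. Qed.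
HB.instance Definition _ :=
  isSuperMorphism.Build K subsuper A sub_val sub_val_salg sub_val_spart.

End SubSuperalgebra.
(* The free superalgebra on X, the generator t having parity p t; only the
   grading depends on p. *)
Definition free_super (K : comNzRingType) (X : choiceType) (p : X -> bool) :
  Type := {malg K[{fmonom X}]}.

Section FreeSuperalgebra.
Variables (K : comNzRingType) (X : choiceType) (p : X -> bool).
Implicit Types (x y : {malg K[{fmonom X}]}) (m : {fmonom X}) (i j : bool).

Definition word_parity (m : {fmonom X}) : bool :=
  \big[addb/false]_(x <- (m : seq X)) p x.

Definition free_spart (i : bool) (x : {malg K[{fmonom X}]}) :
    {malg K[{fmonom X}]} :=
  [malg m in msupp x => if word_parity m == i then x@_m else 0].

Lemma free_spartE i x m :
  (free_spart i x)@_m = if word_parity m == i then x@_m else 0.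
Proof. by rewrite mcoeffE; case: msuppP => // _; rewrite if_same. Qed.

Lemma word_parity1 : word_parity mone = false.
Proof. by rewrite /word_parity [mone]fmoneE big_nil. Qed.

Lemma word_parityM m n : word_parity (mmul m n) = word_parity m (+) word_parity n.
Proof. by rewrite /word_parity [mmul m n]fmmulE big_cat. Qed.

Lemma free_spart_supp i x :
  (forall m, m \in msupp x -> word_parity m = i) -> free_spart i x = x.
Proof.
move=> h; apply/malgP => m; rewrite free_spartE; case: msuppP => [/h->|_].
  by rewrite eqxx.
by rewrite if_same.
Qed.

Lemma free_suppE i x m : m \in msupp (free_spart i x) -> word_parity m = i.
Proof. by rewrite -mcoeff_neq0 free_spartE; case: (_ =P i) => // _; rewrite eqxx. Qed.

HB.instance Definition _ := GRing.NzRing.copy (free_super K p) {malg K[{fmonom X}]}.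

Definition free_salg : {rmorphism K -> {malg K[{fmonom X}]}} := @malgC {fmonom X} K.

Fact free_salgC k x : free_salg k * x = x * free_salg k.
Proof.
rewrite [x]monalgE mulr_suml mulr_sumr; apply: eq_bigr => m _ /=.
by rewrite !malgM_def !fgmulUU mul1m mulm1 mulrC.
Qed.

Fact free_spartD i : {morph free_spart i : x y / x + y}.
Proof.
move=> x y; apply/malgP => m; rewrite mcoeffD !free_spartE mcoeffD.
by case: ifP; rewrite ?addr0.
Qed.

Fact free_spartZ i k x : free_spart i (free_salg k * x) = free_salg k * free_spart i x.
Proof.
apply/malgP => m; rewrite /= mcoeffCM !free_spartE mcoeffCM.
by case: ifP; rewrite ?mulr0.
Qed.

Fact free_spart_sum x : free_spart false x + free_spart true x = x.
Proof.
apply/malgP => m; rewrite mcoeffD !free_spartE.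
by case: (word_parity m); rewrite ?addr0 ?add0r.
Qed.

Fact free_spart_spart i j x :
  free_spart i (free_spart j x) = if i == j then free_spart j x else 0.
Proof.
apply/malgP => m; rewrite !free_spartE (fun_if (mcoeff m)) mcoeff0 free_spartE.
by case: (word_parity m); case: i; case: j.
Qed.

Fact free_spart1 : free_spart false 1 = 1.
Proof.
apply: free_spart_supp => m; rewrite msuppU oner_eq0 inE => /eqP->.
exact: word_parity1.
Qed.

Fact free_spartM i j x y : free_spart (i (+) j) (free_spart i x * free_spart j y) =
  free_spart i x * free_spart j y.
Proof.
apply: free_spart_supp => m /msuppM_le[m1 [m2 [/free_suppE e1 /free_suppE e2 ->]]].
by rewrite word_parityM e1 e2.
Qed.

HB.instance Definition _ := isSuperAlgebra.Build K (free_super K p) free_salgC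
  free_spartD free_spartZ free_spart_sum free_spart_spart free_spart1 free_spartM.

Definition fgen (t : X) : free_super K p := << fmu t >>.

Lemma spart_fgen t : spart (p t) (fgen t) = fgen t.
Proof.
apply: free_spart_supp => m; rewrite msuppU oner_eq0 inE => /eqP->.
by rewrite /word_parity fmuE big_seq1.
Qed.

End FreeSuperalgebra.

(* C[q, q^-1], inside the field of fractions of C[q] *)
Section Laurent.
Variable R : realType.
Local Notation C := R[i].
Local Notation "x %:F" := (FracField.tofrac x).

Definition laurent : {pred {fraction {poly C}}} :=
  fun x => `[< exists (p : {poly C}) (n : nat), x = p%:F / 'X%:F ^+ n >].

Let X_neq0 : 'X%:F != 0 :> {fraction {poly C}}.
Proof. by rewrite tofrac_eq0 polyX_eq0. Qed.

Fact laurent_subring_closed : subring_closed laurent.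
Proof.
split=> [|x y|x y].
- by apply/asboolP; exists 1, 0%N; rewrite expr0 divr1 tofrac1.
- move=> /asboolP[p [n ->]] /asboolP[r [m ->]]; apply/asboolP.
  exists (p * 'X ^+ m - r * 'X ^+ n), (n + m)%N.
  rewrite tofracB !tofracM !tofracXn exprD -mulNr.
  by rewrite addf_div ?expf_neq0 // mulNr.
- move=> /asboolP[p [n ->]] /asboolP[r [m ->]]; apply/asboolP.
  by exists (p * r), (n + m)%N; rewrite tofracM exprD mulf_div.
Qed.

HB.instance Definition _ :=
  GRing.isSubringClosed.Build {fraction {poly C}} laurent laurent_subring_closed.

Record Cq : Type := MkCq {Cq_val : {fraction {poly C}}; _ : Cq_val \in laurent}.

HB.instance Definition _ := [isSub for Cq_val].
HB.instance Definition _ := [Choice of Cq by <:].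
HB.instance Definition _ := [SubChoice_isSubComNzRing of Cq by <:].

Fact q_subproof : 'X%:F \in laurent.
Proof. by apply/asboolP; exists 'X, 0%N; rewrite expr0 divr1. Qed.
Fact qV_subproof : 'X%:F^-1 \in laurent.
Proof. by apply/asboolP; exists 1, 1%N; rewrite tofrac1 div1r. Qed.

Definition q : Cq := MkCq q_subproof.
Definition qV : Cq := MkCq qV_subproof.

Lemma q_qV : q * qV = 1.
Proof. by apply: val_inj; rewrite rmorphM rmorph1 /= mulfV. Qed.

End Laurent.

Arguments q {R}.
Arguments qV {R}.

(* Rows and columns are numbered from 0: the index i of the usual numbering is
   the element of 'I_5 with value i - 1, and only the last one is odd. *)
Definition idx_parity (i : 'I_5) : bool := i == ord_max.

Definition gen_parity (i j : 'I_5) : bool := idx_parity i (+) idx_parity j.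

Definition even_idx (i : 'I_4) : 'I_5 := widen_ord (leqnSn 4) i.

(* the number of inversions of s *)
Definition perm_length (s : 'S_4) : nat :=
  #|[set u : 'I_4 * 'I_4 | (u.1 < u.2)%N && (s u.2 < s u.1)%N]|.

Section QuantumMatrix.
Variables (R : realType) (A : superAlgType (Cq R)).

Section Relations.
Variable a : 'I_5 -> 'I_5 -> A.
Local Notation π := gen_parity.

(* q^((-1)^(p(i)+1)) *)
Definition q_idx (i : 'I_5) : A := salg (if idx_parity i then q else qV).

(* the elements set to 0 in the quantum matrix superalgebra *)
Inductive Mq_relator : A -> Prop :=
| Mq_odd (i j : 'I_5) : π i j -> Mq_relator (a i j ^+ 2)
| Mq_row (i j l : 'I_5) : (j < l)%N -> Mq_relator
    (a i j * a i l - (-1) ^+ (π i j && π i l) * q_idx i * (a i l * a i j))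
| Mq_col (i j k : 'I_5) : (i < k)%N -> Mq_relator
    (a i j * a k j - (-1) ^+ (π i j && π k j) * q_idx j * (a k j * a i j))
| Mq_anti (i j k l : 'I_5) : (i < k)%N && (j > l)%N || (i > k)%N && (j < l)%N ->
    Mq_relator (a i j * a k l - (-1) ^+ (π i j && π k l) * (a k l * a i j))
| Mq_diag (i j k l : 'I_5) : (i < k)%N -> (j < l)%N -> Mq_relator
    (a i j * a k l - (-1) ^+ (π i j && π k l) * (a k l * a i j)
     - (-1) ^+ (π i j && π k j) * salg (qV - q) * (a k j * a i l)).

End Relations.

(* For b i j = a_ij this is D_1: the factor (-q)^-l is written (-q^-1)^l. *)
Definition qdet (b : 'I_4 -> 'I_4 -> A) : A :=
  \sum_(s : 'S_4) salg ((- qV) ^+ perm_length s) * \prod_(i < 4) b i (s i).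

(* a_i1 a_j2 - q^-1 a_i2 a_j1 *)
Definition qminor12 (a : 'I_5 -> 'I_5 -> A) (i j : 'I_5) : A :=
  a i (inord 0) * a j (inord 1) - salg qV * (a i (inord 1) * a j (inord 0)).

End QuantumMatrix.

Section QuantumSupergroup.
Variable R : realType.

(* GL_q(4|1) is presented by the generators and relations of M_q(4|1) and two
   further even generators, inverse to D_1 and D_2: inl (i, j) is a_ij, inr false
   is D_1^-1 and inr true is D_2^-1. *)
Definition GLq_gen : choiceType := ('I_5 * 'I_5 + bool)%type.

Definition GLq_gen_parity (x : GLq_gen) : bool :=
  if x is inl (i, j) then gen_parity i j else false.

Definition GLq_free := free_super (Cq R) GLq_gen_parity.

Definition free_a (i j : 'I_5) : GLq_free := fgen _ GLq_gen_parity (inl (i, j)).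
Definition free_D1 : GLq_free := qdet (fun i j => free_a (even_idx i) (even_idx j)).
Definition free_D2 : GLq_free := free_a ord_max ord_max.
Definition free_D1V : GLq_free := fgen _ GLq_gen_parity (inr false).
Definition free_D2V : GLq_free := fgen _ GLq_gen_parity (inr true).

Inductive GLq_relator : GLq_free -> Prop :=
| GLq_Mq x : Mq_relator free_a x -> GLq_relator x
| GLq_D1r : GLq_relator (free_D1 * free_D1V - 1)
| GLq_D1l : GLq_relator (free_D1V * free_D1 - 1)
| GLq_D2r : GLq_relator (free_D2 * free_D2V - 1)
| GLq_D2l : GLq_relator (free_D2V * free_D2 - 1).

Definition GLq := superquot GLq_relator.

Definition GLq_a (i j : 'I_5) : GLq := qproj _ (free_a i j).
Definition GLq_a55V : GLq := qproj _ free_D2V.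

Definition Ber : GLq :=
  qdet (fun i j => GLq_a (even_idx i) (even_idx j) -
    GLq_a (even_idx i) ord_max * GLq_a55V * GLq_a ord_max (even_idx j)) * GLq_a55V.

Definition SLq := superquot (fun x : GLq => x = Ber - 1).

Definition SLq_a (i j : 'I_5) : SLq := qproj _ (GLq_a i j).

(* The first constructor gives D_ij for i < j <= 4 and also D_i5. *)
Inductive Grq_gen : SLq -> Prop :=
| Grq_D (i j : 'I_5) : (i < j)%N -> Grq_gen (qminor12 SLq_a i j)
| Grq_D55 : Grq_gen (SLq_a ord_max (inord 0) * SLq_a ord_max (inord 1)).

Definition Grq := subsuper Grq_gen.

End QuantumSupergroup.

(* Main.v *)
(* The difficulty is that C_q is not a field and that flatness of SL_q is not
   known, so that SL_q ⊗ Gr_q -> SL_q ⊗ SL_q has to be shown to be injective.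
   This follows once the semistandard words in the minors D_ij span Gr_q and are
   separated, with invertible leading coefficients, by C_q-linear forms defined on
   all of SL_q.  Spanning is the quantum straightening law.  For the linear forms,
   SL_q maps to operator algebras through lower bidiagonal matrices with one entry
   x below the diagonal; convolving such morphisms (as for the Feigin homomorphism)
   and taking the highest powers of x lowers the rows of the minors one by one,
   and the exponents met on the way determine a semistandard word.  Injectivity
   then gives a unique lift of Delta, which inherits multiplicativity,
   coassociativity and counitality. *)
Require Import Defs.
From HB Require Import structures.
From mathcomp Require Import all_boot all_order all_fingroup all_algebra.
From mathcomp Require Import generic_quotient.
From mathcomp.multinomials Require Import monalg.
From mathcomp Require Import boolp reals zify.

Set Implicit Arguments.
Unset Strict Implicit.
Unset Printing Implicit Defensive.

Import GRing.Theory.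
Local Open Scope ring_scope.

(** * Tensor products of morphisms *)

(** The powers of x become visible by letting x lower sequences: starting from a point mass at e and
    evaluating at 0 keeps the terms with exactly e factors x. In the odd row x squares to zero and
    can record only an exponent at most 1; this suffices because a semistandard word has at most one
    letter whose second row is the odd one. When all letters have been lowered to D_12, a diagonal
    morphism compatible with Ber = 1 reads their number. The straightening relations are certified
    by computing with symbols: reordering the entries of two columns preserves values, so a
    difference that reduces to the empty sum is zero. D_55 needs separate care: the q-minor with the
    odd row repeated is (1 + q^-2) D_55, and 1 + q^-2 is not a unit of C_q. Its comultiplication is
    therefore computed from a_51 a_52 directly, which keeps all leading coefficients invertible.
    Injectivity is proved with any superalgebra as left factor, since coassociativity is an identity
    in a triple tensor product. *)

Section TensorMapMorphism.
Variables (K : comNzRingType) (A B A' B' : superAlgType K).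
Variables (f : {supermorphism A -> A'}) (g : {supermorphism B -> B'}).

Fact tens_map_is_zmod_morphism : zmod_morphism (tens_map f g).
Proof.
have fgD := tens_liftD (tens_map_balanced f g).
by move=> x y; apply: (addIr (tens_map f g y)); rewrite addrNK -[LHS]fgD addrNK.
Qed.

HB.instance Definition _ :=
  GRing.isZmodMorphism.Build (tens A B) (tens A' B') (tens_map f g)
    tens_map_is_zmod_morphism.

Fact tens_map_is_monoid_morphism : monoid_morphism (tens_map f g).
Proof.
split=> [|x y]; first by rewrite [LHS]tens_mapE !rmorph1.
elim/tens_ind_hom: x => [|i1 j1 a b ha hb|x x' e e'].
- by rewrite !(mul0r, raddf0).
- elim/tens_ind_hom: y => [|i2 j2 c d hc hd|y y' e e'].
  + by rewrite !(mulr0, raddf0).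
  + rewrite (tens_mulE a d hb hc) !tens_mapE.
    rewrite (@tens_mulE _ _ _ j1 i2); last 2 first.
    * by rewrite -supermorph_spart hb.
    * by rewrite -supermorph_spart hc.
    by rewrite !rmorphM /= supermorph_salg.
  + by rewrite mulrDr !raddfD /= mulrDr e e'.
- by rewrite mulrDl !raddfD /= mulrDl e e'.
Qed.

HB.instance Definition _ :=
  GRing.isMonoidMorphism.Build (tens A B) (tens A' B') (tens_map f g)
    tens_map_is_monoid_morphism.

Lemma tens_map_salg k : tens_map f g (salg k) = salg k.
Proof. by rewrite [LHS]tens_mapE supermorph_salg rmorph1. Qed.

Lemma tens_map_spart i x : tens_map f g (spart i x) = spart i (tens_map f g x).
Proof.
elim/tens_ind: x => [|a b|x y e e']; rewrite ?raddf0 //; last first.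
  by rewrite !raddfD /= e e'.
have sE (C D : superAlgType K) (c : C) (d : D) :
    spart i (c ⊗ d) = \sum_(j : bool) spart j c ⊗ spart (i (+) j) d.
  exact: tens_spart_pure.
rewrite tens_mapE !sE raddf_sum; apply: eq_bigr => j _.
by rewrite /= tens_mapE !supermorph_spart.
Qed.

HB.instance Definition _ :=
  isSuperMorphism.Build K (tens A B) (tens A' B') (tens_map f g)
    tens_map_salg tens_map_spart.

End TensorMapMorphism.

(** Functoriality in the form of a commuting square compares two composites without giving the
    composites a supermorphism structure of their own. *)
Lemma tens_map_square (K : comNzRingType) (A B A1 B1 A1' B1' A2 B2 : superAlgType K)
  (f1 : {supermorphism A -> A1}) (f2 : {supermorphism A1 -> A2})
  (h1 : {supermorphism A -> A1'}) (h2 : {supermorphism A1' -> A2})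
  (g1 : {supermorphism B -> B1}) (g2 : {supermorphism B1 -> B2})
  (k1 : {supermorphism B -> B1'}) (k2 : {supermorphism B1' -> B2}) :
  (forall x, f2 (f1 x) = h2 (h1 x)) -> (forall y, g2 (g1 y) = k2 (k1 y)) ->
  forall z, tens_map f2 g2 (tens_map f1 g1 z) = tens_map h2 k2 (tens_map h1 k1 z).
Proof.
move=> ef eg; apply: tens_ext => [x y|x y|a b]; rewrite ?raddfD //.
by rewrite !tens_mapE ef eg.
Qed.

Section TensorAssoc.
Variables (K : comNzRingType) (A B C : superAlgType K).

Lemma tens_assoc_inner_balanced (c : C) :
  balanced (fun (a : A) (b : B) => a ⊗ (b ⊗ c)).
Proof.
split=> [x y y'|y x x'|k x y] /=; rewrite ?tpureDl ?tpureDr ?tpureZ //.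
by rewrite tens_salgZ tpureZ.
Qed.

Lemma tens_assoc_balanced :
  balanced (fun (t : A ⊗ B) (c : C) => tens_lift (fun a b => a ⊗ (b ⊗ c)) t).
Proof.
have LD c := tens_liftD (tens_assoc_inner_balanced c).
have LE c := tens_liftE (tens_assoc_inner_balanced c).
have L0 c := tens_lift0 (tens_assoc_inner_balanced c).
split=> [t c c'|c t t'|k t c] /=; rewrite ?LD //.
- elim/tens_ind: t => [|a b|x y e e']; first by rewrite !L0 addr0.
    by rewrite !LE !tpureDr.
  by rewrite !LD e e' addrACA.
- elim/tens_ind: t => [|a b|x y e e']; first by rewrite mulr0 !L0.
    by rewrite tens_salgZ !LE tpureZ tens_salgZ tpureZ.
  by rewrite mulrDr !LD e e'.
Qed.

Fact tens_assoc_is_zmod_morphism : zmod_morphism (@tens_assoc K A B C).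
Proof.
have fD := tens_liftD tens_assoc_balanced.
by move=> x y; apply: (addIr (tens_assoc y)); rewrite addrNK -[LHS]fD addrNK.
Qed.

HB.instance Definition _ :=
  GRing.isZmodMorphism.Build (tens (tens A B) C) (tens A (tens B C)) (@tens_assoc K A B C)
    tens_assoc_is_zmod_morphism.

Lemma tens_assocM : {morph (@tens_assoc K A B C) : x y / x * y}.
Proof.
have ind (P : (A ⊗ B) ⊗ C -> Prop) : P 0 ->
    (forall i j k a b c, spart i a = a -> spart j b = b -> spart k c = c ->
      P ((a ⊗ b) ⊗ c)) -> (forall x y, P x -> P y -> P (x + y)) -> forall x, P x.
  move=> P0 Pp PD; apply: tens_ind_hom => // _ k t c _ hc.
  elim/tens_ind_hom: t => [|i j a b ha hb|t t' e e'].
  - by rewrite tpure0l.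
  - exact: Pp ha hb hc.
  - by rewrite tpureDl; apply: PD.
have hom2 (D E : superAlgType K) i j (d : D) (e : E) : spart i d = d ->
    spart j e = e -> spart (i (+) j) (d ⊗ e) = d ⊗ e.
  by move=> hd he; rewrite [LHS](tens_spart_hom _ hd he) eqxx.
move=> x y; elim/ind: x => [|i1 j1 k1 a b c ha hb hc|x x' e e'].
- by rewrite !(mul0r, raddf0).
- elim/ind: y => [|i2 j2 k2 a' b' c' ha' hb' hc'|y y' e e'].
  + by rewrite !(mulr0, raddf0).
  + rewrite (tens_mulE _ _ hc (hom2 _ _ _ _ _ _ ha' hb')) (tens_mulE _ _ hb ha').
    rewrite tens_salgZ !tens_assocE (tens_mulE _ _ (hom2 _ _ _ _ _ _ hb hc) ha').
    rewrite (tens_mulE _ _ hc hb') -[X in _ = _ ⊗ X]tens_salgZ -[RHS]tpureZ !mulrA -!rmorphM -!signr_addb.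
    (* Koszul signs: with either bracketing, a' crosses b and c, and b' crosses c. *)
    by have -> : k1 && (i2 (+) j2) (+) j1 && i2 = k1 && j2 (+) (j1 (+) k1) && i2
      by case: (j1) (k1) (i2) (j2) => [] [] [] [].
  + by rewrite mulrDr !raddfD /= mulrDr e e'.
- by rewrite mulrDl !raddfD /= mulrDl e e'.
Qed.

Fact tens_assoc_is_monoid_morphism : monoid_morphism (@tens_assoc K A B C).
Proof. by split; [exact: tens_assocE | exact: tens_assocM]. Qed.

HB.instance Definition _ :=
  GRing.isMonoidMorphism.Build (tens (tens A B) C) (tens A (tens B C))
    (@tens_assoc K A B C) tens_assoc_is_monoid_morphism.

Definition tens_assocV : A ⊗ (B ⊗ C) -> (A ⊗ B) ⊗ C :=
  tens_lift (fun a t => tens_lift (fun b c => (a ⊗ b) ⊗ c) t).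

Lemma tens_assocK : cancel (@tens_assoc K A B C) tens_assocV.
Proof.
have bal a : balanced (fun (b : B) (c : C) => ((a : A) ⊗ b) ⊗ c).
  split=> [x y y'|y x x'|k x y] /=; first by rewrite tpureDr.
    by rewrite tpureDr tpureDl.
  by rewrite -tpureZ -tens_salgZ tpureZ.
have LD a := tens_liftD (bal a); have LE a := tens_liftE (bal a).
have L0 a := tens_lift0 (bal a).
have bal2 : balanced (fun (a : A) t => tens_lift (fun (b : B) (c : C) => (a ⊗ b) ⊗ c) t).
  split=> [a t t'|t a a'|k a t] /=; rewrite ?LD //.
  - elim/tens_ind: t => [|b c|x y e e']; first by rewrite !L0 addr0.
      by rewrite !LE !tpureDl.
    by rewrite !LD e e' addrACA.
  - elim/tens_ind: t => [|b c|x y e e']; first by rewrite mulr0 !L0.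
      by rewrite tens_salgZ !LE tpureZ.
    by rewrite mulrDr !LD e e'.
apply: tens_ext => [x y|//|t c]; first by rewrite raddfD /= [LHS](tens_liftD bal2).
elim/tens_ind: t => [|a b|x y e e'].
- by rewrite tpure0l raddf0 [LHS](tens_lift0 bal2).
- by rewrite tens_assocE [LHS](tens_liftE bal2) LE.
- by rewrite tpureDl raddfD /= [LHS](tens_liftD bal2); congr (_ + _).
Qed.

Lemma tens_assoc_surj x : exists y, @tens_assoc K A B C y = x.
Proof.
elim/tens_ind: x => [|a t|x x' [y <-] [y' <-]].
- by exists 0; rewrite raddf0.
- elim/tens_ind: t => [|b c|t t' [y ey] [y' ey']].
  + by exists 0; rewrite raddf0 tpure0r.
  + by exists ((a ⊗ b) ⊗ c); rewrite tens_assocE.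
  + by exists (y + y'); rewrite raddfD /= ey ey' tpureDr.
- by exists (y + y'); rewrite raddfD.
Qed.

End TensorAssoc.

Section TensorUnit.
Variables (K : comNzRingType) (A : superAlgType K).

Fact tens_unitl_is_zmod_morphism : zmod_morphism (@tens_unitl K A).
Proof.
have bal : balanced (fun (k : K^o) (x : A) => salg (k : K) * x).
  split=> [k y y'|y l l'|l m y] /=; rewrite ?mulrDr ?rmorphD ?mulrDl //.
  by rewrite rmorphM -mulrA salgA.
have fD := tens_liftD bal.
by move=> x y; apply: (addIr (tens_unitl y)); rewrite addrNK -[LHS]fD addrNK.
Qed.

HB.instance Definition _ :=
  GRing.isZmodMorphism.Build (tens K^o A) A (@tens_unitl K A)
    tens_unitl_is_zmod_morphism.

Lemma tens_unitlM : {morph (@tens_unitl K A) : x y / x * y}.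
Proof.
have ind (P : K^o ⊗ A -> Prop) : P 0 -> (forall k a, P ((k : K^o) ⊗ a)) ->
    (forall x y, P x -> P y -> P (x + y)) -> forall x, P x by exact: tens_ind.
have even (k : K^o) : spart false k = k by [].
move=> x y; elim/ind: x => [|k a|x x' e e'].
- by rewrite !(mul0r, raddf0).
- elim/ind: y => [|l b|y y' e e'].
  + by rewrite !(mulr0, raddf0).
  + rewrite -(spart_sum a) tpureDr mulrDl !raddfD /=.
    rewrite !(tens_mulE _ _ (spartK _ _) (even l)) !andbF rmorph1 mul1r.
    rewrite !tens_unitlE !rmorphM /= -!mulrDr -!mulrDl spart_sum.
    by rewrite -!mulrA; congr (_ * _); rewrite salgA.
  + by rewrite mulrDr !raddfD /= mulrDr e e'.
- by rewrite mulrDl !raddfD /= mulrDl e e'.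
Qed.

Fact tens_unitl_is_monoid_morphism : monoid_morphism (@tens_unitl K A).
Proof.
split; last exact: tens_unitlM.
by rewrite [LHS]tens_unitlE rmorph1 mul1r.
Qed.

HB.instance Definition _ :=
  GRing.isMonoidMorphism.Build (tens K^o A) A (@tens_unitl K A)
    tens_unitl_is_monoid_morphism.

End TensorUnit.

Lemma tpure_suml (K : comNzRingType) (A B : superAlgType K) (I : Type)
    (s : seq I) (F : I -> A) (y : B) :
  (\sum_(i <- s) F i) ⊗ y = \sum_(i <- s) F i ⊗ y.
Proof. exact: (big_morph (fun x : A => x ⊗ y) (fun x x' => tpureDl x x' y) (tpure0l _ y)). Qed.

Lemma tpure_sumr (K : comNzRingType) (A B : superAlgType K) (I : Type)
    (s : seq I) (F : I -> B) (x : A) :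
  x ⊗ (\sum_(i <- s) F i) = \sum_(i <- s) x ⊗ F i.
Proof. exact: (raddf_sum (tpure x)). Qed.

(** * Morphisms out of SL_q(4|1) *)

Section QuotientLift.
Variables (K : comNzRingType) (A : superAlgType K) (S : A -> Prop).
Variables (B : pzRingType) (phi : {rmorphism A -> B}).
Hypothesis phi_rel : forall i s, S s -> phi (spart i s) = 0.

(** The target is an ungraded ring, as the operator algebras below are; so both homogeneous parts of
    a relator have to be killed, these being the generators of the graded ideal. *)
Definition quot_lift (x : superquot S) : B := phi (repr x).

Lemma quot_liftE x : quot_lift (qproj S x) = phi x.
Proof.
have /qproj_eq/asboolP : qproj S (repr (qproj S x)) = qproj S x by exact: qproj_repr.
move=> Ix; apply/eqP; rewrite -subr_eq0 -rmorphB; apply/eqP.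
elim: Ix => [i s Ss| |y z _ ey _ ez|a y b _ ey].
- exact: phi_rel.
- exact: raddf0.
- by rewrite rmorphD /= ey ez addr0.
- by rewrite !rmorphM /= ey mulr0 mul0r.
Qed.

Fact quot_lift_is_zmod_morphism : zmod_morphism quot_lift.
Proof.
elim/quot_ind=> x; elim/quot_ind=> y.
by rewrite -raddfB !quot_liftE raddfB.
Qed.
Fact quot_lift_is_monoid_morphism : monoid_morphism quot_lift.
Proof.
split=> [|]; first by rewrite -(rmorph1 (qproj S)) quot_liftE rmorph1.
elim/quot_ind=> x; elim/quot_ind=> y.
by rewrite -rmorphM !quot_liftE rmorphM.
Qed.

HB.instance Definition _ :=
  GRing.isZmodMorphism.Build (superquot S) B quot_lift quot_lift_is_zmod_morphism.
HB.instance Definition _ :=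
  GRing.isMonoidMorphism.Build (superquot S) B quot_lift
    quot_lift_is_monoid_morphism.

Definition quot_liftR : {rmorphism superquot S -> B} := quot_lift.

End QuotientLift.

Section FreeLift.
Variables (K : comNzRingType) (X : choiceType) (p : X -> bool).
Variables (B : nzRingType) (kappa : {rmorphism K -> B}) (v : X -> B).
Hypothesis kappaC : forall k b, kappa k * b = b * kappa k.

Definition word_eval (m : {fmonom X}) : B := \prod_(x <- (m : seq X)) v x.

Fact word_eval_mmorphism : mmorphism word_eval.
Proof.
by split=> [m n|]; rewrite /word_eval ?[mmul m n]fmmulE ?[mone]fmoneE ?big_cat ?big_nil.
Qed.

HB.instance Definition _ :=
  isMultiplicative.Build {fmonom X} B word_eval word_eval_mmorphism.

Definition free_lift : free_super K p -> B := mmap kappa word_eval.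

Fact free_lift_is_zmod_morphism : zmod_morphism free_lift.
Proof. exact: mmap_is_additive. Qed.
Fact free_lift_is_monoid_morphism : monoid_morphism free_lift.
Proof.
have [M e] := commr_mmap_is_multiplicative (f := kappa) (h := word_eval)
  (fun g m m' => kappaC _ _).
by split.
Qed.

HB.instance Definition _ :=
  GRing.isZmodMorphism.Build (free_super K p) B free_lift free_lift_is_zmod_morphism.
HB.instance Definition _ :=
  GRing.isMonoidMorphism.Build (free_super K p) B free_lift
    free_lift_is_monoid_morphism.

Definition free_liftR : {rmorphism free_super K p -> B} := free_lift.

Lemma free_lift_fgen x : free_lift (fgen K p x) = v x.
Proof. by rewrite [LHS]mmapU /= rmorph1 mul1r /word_eval fmuE big_seq1. Qed.

Lemma free_lift_salg k : free_lift (salg k) = kappa k.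
Proof. exact: mmapC. Qed.

End FreeLift.

(** * Linear operators on sequences indexed by the integers *)

Section SequenceOperators.
Variable K : comNzRingType.
Local Notation F := (int -> K).
Implicit Types (k : K) (f g : F).

(** Weights and shifts of sequences realise the q-commutation relations over the base ring itself.
    The index runs over all integers so that the shift used for the torus is invertible. *)
Record seqop : Type := SeqOp {
  seqop_fun :> F -> F;
  seqopP : forall k f g,
    seqop_fun (fun n => k * f n + g n) = fun n => k * seqop_fun f n + seqop_fun g n
}.
Implicit Types (S T U : seqop).

Lemma seqop_ext S T : (forall f n, S f n = T f n) -> S = T.
Proof.
case: S T => [S sP] [T tP] /= e; have eST : S = T.
  by apply/funext => f; apply/funext => n.
by case: _ / eST in tP *; congr SeqOp; exact: Prop_irrelevance.
Qed.

HB.instance Definition _ := gen_eqMixin seqop.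
HB.instance Definition _ := gen_choiceMixin seqop.

Lemma seqopD T f g n : T (fun m => f m + g m) n = T f n + T g n.
Proof.
rewrite (_ : (fun m => _) = (fun m => 1 * f m + g m)) ?seqopP ?mul1r //.
by apply/funext => m; rewrite mul1r.
Qed.

Lemma seqop0 T n : T (fun=> 0) n = 0.
Proof.
rewrite -[LHS](addrK (T (fun=> 0) n)) -seqopD.
by rewrite (_ : (fun=> 0 + 0) = (fun=> 0)) ?subrr //; apply/funext => m; rewrite addr0.
Qed.

Lemma seqopZ T k f n : T (fun m => k * f m) n = k * T f n.
Proof.
rewrite (_ : (fun m => _) = (fun m => k * f m + (fun=> 0) m)); last first.
  by apply/funext => m; rewrite addr0.
by rewrite seqopP seqop0 addr0.
Qed.

Fact seqop_zero_subproof k f g :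
  (fun _ => 0) = (fun n => k * (fun _ : int => 0) n + (fun _ : int => 0) n) :> F.
Proof. by apply/funext => n; rewrite mulr0 addr0. Qed.
Definition seqop_zero := @SeqOp (fun _ _ => 0) seqop_zero_subproof.

Fact seqop_add_subproof S T k f g :
  (fun n => S (fun n => k * f n + g n) n + T (fun n => k * f n + g n) n) =
  (fun n => k * (S f n + T f n) + (S g n + T g n)) :> F.
Proof. by apply/funext => n; rewrite !seqopP mulrDr addrACA. Qed.
Definition seqop_add S T := SeqOp (seqop_add_subproof S T).

Fact seqop_scale_subproof c T k f g :
  (fun n => c * T (fun n => k * f n + g n) n) =
  (fun n => k * (c * T f n) + c * T g n) :> F.
Proof. by apply/funext => n; rewrite !seqopP mulrDr mulrCA. Qed.
Definition seqop_scale c T := SeqOp (seqop_scale_subproof c T).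

Fact seqop_mul_subproof S T k f g :
  S (T (fun n => k * f n + g n)) = (fun n => k * S (T f) n + S (T g) n) :> F.
Proof. by rewrite !seqopP. Qed.
Definition seqop_mul S T := SeqOp (seqop_mul_subproof S T).

Definition seqop_one := @SeqOp id (fun k f g => erefl).

Fact seqop_addA : associative seqop_add.
Proof. by move=> S T U; apply: seqop_ext => f n; apply: addrA. Qed.
Fact seqop_addC : commutative seqop_add.
Proof. by move=> S T; apply: seqop_ext => f n; apply: addrC. Qed.
Fact seqop_add0 : left_id seqop_zero seqop_add.
Proof. by move=> S; apply: seqop_ext => f n; apply: add0r. Qed.
Fact seqop_addN : left_inverse seqop_zero (seqop_scale (-1)) seqop_add.
Proof. by move=> S; apply: seqop_ext => f n; rewrite /= mulN1r addNr. Qed.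

HB.instance Definition _ :=
  GRing.isZmodule.Build seqop seqop_addA seqop_addC seqop_add0 seqop_addN.

Fact seqop_mulA : associative seqop_mul.
Proof. by move=> S T U; apply: seqop_ext. Qed.
Fact seqop_mul1l : left_id seqop_one seqop_mul.
Proof. by move=> S; apply: seqop_ext. Qed.
Fact seqop_mul1r : right_id seqop_one seqop_mul.
Proof. by move=> S; apply: seqop_ext. Qed.
Fact seqop_mulDl : left_distributive seqop_mul seqop_add.
Proof. by move=> S T U; apply: seqop_ext. Qed.
Fact seqop_mulDr : right_distributive seqop_mul seqop_add.
Proof. by move=> S T U; apply: seqop_ext => f n /=; rewrite -seqopD. Qed.
Fact seqop_one_neq0 : seqop_one != 0 :> seqop.
Proof.
apply/eqP => /(congr1 (fun T : seqop => T (fun=> 1) 0)) /eqP.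
by rewrite /= oner_eq0.
Qed.

HB.instance Definition _ := GRing.Zmodule_isNzRing.Build seqop
  seqop_mulA seqop_mul1l seqop_mul1r seqop_mulDl seqop_mulDr seqop_one_neq0.

Definition seqop_const k : seqop := seqop_scale k 1.

Fact seqop_const_is_zmod_morphism : zmod_morphism seqop_const.
Proof. by move=> k l; apply: seqop_ext => f n; rewrite /= mulN1r mulrBl. Qed.
Fact seqop_const_is_monoid_morphism : monoid_morphism seqop_const.
Proof.
by split=> [|k l]; apply: seqop_ext => f n /=; rewrite ?mul1r // -mulrA.
Qed.

HB.instance Definition _ :=
  GRing.isZmodMorphism.Build K seqop seqop_const seqop_const_is_zmod_morphism.
HB.instance Definition _ :=
  GRing.isMonoidMorphism.Build K seqop seqop_const seqop_const_is_monoid_morphism.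

Lemma seqop_constC k T : seqop_const k * T = T * seqop_const k.
Proof. by apply: seqop_ext => f n /=; rewrite seqopZ. Qed.

Lemma seqop_mulE S T f : (S * T) f = S (T f). Proof. by []. Qed.

Fact seqop_shift_subproof (w : int -> K) (s : int -> int) k f g :
  (fun n => w n * (k * f (s n) + g (s n))) =
  (fun n => k * (w n * f (s n)) + w n * g (s n)).
Proof. by apply/funext => n; rewrite mulrDr mulrCA. Qed.
Definition seqop_shift (w : int -> K) (s : int -> int) :=
  @SeqOp (fun f n => w n * f (s n)) (seqop_shift_subproof w s).

Definition seq_delta (n : int) : F := fun m => (m == n)%:R.

End SequenceOperators.

(** If s j <= j for all j, the equality of the sums of s j and of j forces equality termwise. For a
    lower triangular matrix this leaves only the identity in the quantum determinant. *)
Lemma perm_excedance n (s : 'S_n) : s != 1%g -> exists i : 'I_n, (i < s i)%N.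
Proof.
move=> ns; case: (pickP [pred i : 'I_n | (i < s i)%N]) => [i lti|le]; first by exists i.
case/eqP: ns; apply/permP => i; rewrite perm1; apply/val_inj/eqP.
have les j : (s j <= j)%N by move/negbT: (le j); rewrite -leqNgt.
have /leqif_sum : forall j : 'I_n, true -> (s j <= j ?= iff (s j == j :> nat))%N.
  by move=> j _; apply/leqif_eq/les.
have -> : (\sum_(j < n) s j = \sum_(j < n) j)%N.
  by rewrite [RHS](reindex_inj (@perm_inj _ s)).
by move=> [_]; rewrite eqxx => /esym/forallP/(_ i).
Qed.

Lemma prod_seq_eq0 (A : pzRingType) (I : eqType) (s : seq I) (F : I -> A) i :
  i \in s -> F i = 0 -> \prod_(j <- s) F j = 0.
Proof.
elim: s => // j s IHs; rewrite inE big_cons => /predU1P[<- ->|/IHs h /h ->].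
  exact: mul0r.
exact: mulr0.
Qed.

Lemma perm_length1 : perm_length 1%g = 0%N.
Proof.
by apply/eqP; rewrite cards_eq0 -subset0; apply/subsetP => -[i j];
  rewrite !inE !perm1 /=; lia.
Qed.

(** * Homogeneity of the relators and of the Berezinian *)

Section Homogeneous.
Variables (K : comNzRingType) (A : superAlgType K).
Implicit Types (x y : A).

Lemma homB p x y :
  spart p x = x -> spart p y = y -> spart p (x - y) = x - y.
Proof. by move=> hx hy; rewrite raddfB /= hx hy. Qed.

Lemma hom_sum (I : Type) (s : seq I) (P : pred I) (F : I -> A) p :
  (forall i, P i -> spart p (F i) = F i) ->
  spart p (\sum_(i <- s | P i) F i) = \sum_(i <- s | P i) F i.
Proof. by move=> hF; rewrite raddf_sum; apply: eq_bigr. Qed.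

Lemma hom_prod_even (I : Type) (s : seq I) (P : pred I) (F : I -> A) :
  (forall i, P i -> spart false (F i) = F i) ->
  spart false (\prod_(i <- s | P i) F i) = \prod_(i <- s | P i) F i.
Proof.
move=> hF; apply: (big_ind (fun y => spart false y = y)) => // [|y z hy hz].
  exact: spart1.
exact: (spart_homM hy hz).
Qed.

Lemma hom_evenM p x y :
  spart false x = x -> spart p y = y -> spart p (x * y) = x * y.
Proof. by move=> hx hy; rewrite -{1}(addFb p) spart_homM. Qed.

Lemma hom_sign n : spart false ((-1) ^+ n : A) = (-1) ^+ n.
Proof.
have -> : (-1) ^+ n = salg ((-1) ^+ n) :> A by rewrite rmorphXn rmorphN1.
by rewrite spart_salg.
Qed.

End Homogeneous.

Section Homogeneity.
Variable R : realType.

(** A graded ideal is generated by the homogeneous parts of the relators; for a homogeneous relator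
    these are the relator itself and 0, so a morphism need only kill the relator. *)
Lemma Mq_relator_hom (A : superAlgType (Cq R)) (a : 'I_5 -> 'I_5 -> A) y :
  (forall i j, spart (gen_parity i j) (a i j) = a i j) ->
  Mq_relator a y -> exists p, spart p y = y.
Proof.
move=> ha rel_y.
have hom2 i j k l p : gen_parity i j (+) gen_parity k l = p ->
    spart p (a i j * a k l) = a i j * a k l.
  by move=> <-; apply: spart_homM; apply: ha.
have signZ n (k : Cq R) : spart false ((-1) ^+ n * salg k : A) = (-1) ^+ n * salg k.
  by apply: hom_evenM; [exact: hom_sign|exact: spart_salg].
case: rel_y => [i j pij|i j l jl|i j k ik|i j k l ijkl|i j k l ik jl].
- by exists false; rewrite expr2 hom2 // pij.
- exists (gen_parity i j (+) gen_parity i l); apply: homB; first exact: hom2.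
  by apply: hom_evenM; [exact: signZ|apply: hom2; exact: addbC].
- exists (gen_parity i j (+) gen_parity k j); apply: homB; first exact: hom2.
  by apply: hom_evenM; [exact: signZ|apply: hom2; exact: addbC].
- exists (gen_parity i j (+) gen_parity k l); apply: homB; first exact: hom2.
  by apply: hom_evenM; [exact: hom_sign|apply: hom2; exact: addbC].
- exists (gen_parity i j (+) gen_parity k l); apply: homB; first apply: homB.
  + exact: hom2.
  + by apply: hom_evenM; [exact: hom_sign|apply: hom2; exact: addbC].
  + apply: hom_evenM; [exact: signZ|apply: hom2].
    by rewrite /gen_parity; do 4!case: (idx_parity _).
Qed.

Lemma qdet_hom (A : superAlgType (Cq R)) (b : 'I_4 -> 'I_4 -> A) :
  (forall i j, spart false (b i j) = b i j) -> spart false (qdet b) = qdet b.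
Proof.
move=> hb; apply: hom_sum => s _.
by apply: hom_evenM; [rewrite spart_salg | apply: hom_prod_even].
Qed.

Lemma even_idx_parity (i : 'I_4) : idx_parity (even_idx i) = false.
Proof. by rewrite /idx_parity -val_eqE /=; apply: ltn_eqF. Qed.

Lemma spart_free_a i j : spart (gen_parity i j) (free_a R i j) = free_a R i j.
Proof. exact: (spart_fgen (Cq R) GLq_gen_parity (inl (i, j))). Qed.

Lemma spart_free_aE i j p : gen_parity i j = p -> spart p (free_a R i j) = free_a R i j.
Proof. by move<-; exact: spart_free_a. Qed.

Lemma GLq_relator_hom (y : GLq_free R) : GLq_relator y -> exists p, spart p y = y.
Proof.
have h1 : spart false (free_D1 R) = free_D1 R.
  by apply: qdet_hom => i j; apply: spart_free_aE; rewrite /gen_parity !even_idx_parity.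
have h1V : spart false (free_D1V R) = free_D1V R.
  exact: (spart_fgen (Cq R) GLq_gen_parity (inr false)).
have h2 : spart false (free_D2 R) = free_D2 R.
  by apply: spart_free_aE; rewrite /gen_parity addbb.
have h2V : spart false (free_D2V R) = free_D2V R.
  exact: (spart_fgen (Cq R) GLq_gen_parity (inr true)).
case=> [{}y /Mq_relator_hom||||]; first by apply; exact: spart_free_a.
all: by exists false; rewrite homB ?spart1 // hom_evenM.
Qed.

Lemma Ber_hom : spart false (Ber R) = Ber R.
Proof.
have ha i j p : gen_parity i j = p -> spart p (GLq_a R i j) = GLq_a R i j.
  by move=> e; rewrite -supermorph_spart spart_free_aE.
have hV : spart false (GLq_a55V R) = GLq_a55V R.
  rewrite -supermorph_spart; congr (qproj _ _).
  exact: (spart_fgen (Cq R) GLq_gen_parity (inr true)).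
rewrite hom_evenM // qdet_hom // => i j; rewrite homB //.
  by apply: ha; rewrite /gen_parity !even_idx_parity.
rewrite -[false]/(true (+) true) spart_homM //; last first.
  by apply: ha; rewrite /gen_parity even_idx_parity /idx_parity eqxx.
rewrite -[true]/(true (+) false) spart_homM //.
by apply: ha; rewrite /gen_parity even_idx_parity /idx_parity eqxx.
Qed.

End Homogeneity.

(** * Morphisms given by lower bidiagonal matrices *)

Section Lift.
Variables (R : realType) (B : nzRingType) (kappa : {rmorphism Cq R -> B}).
Hypothesis kappaC : forall k b, kappa k * b = b * kappa k.
Variables (d : 'I_5 -> B) (r : nat) (x e : B).
Hypothesis dd : forall i j, d i * d j = d j * d i.
Hypothesis xd : forall i : 'I_5, (i : nat) != r -> (i : nat) != r.+1 -> x * d i = d i * x.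
Hypothesis dx_col : forall i : 'I_5, (i : nat) = r -> d i * x = kappa qV * (x * d i).
Hypothesis dx_row : forall i : 'I_5, (i : nat) = r.+1 ->
  x * d i = kappa (if r == 3%N then q else qV) * (d i * x).
Hypothesis xx : r = 3%N -> x * x = 0.
(* This makes the Berezinian of the matrix equal to 1. *)
Hypothesis d_det : \prod_(i < 4) d (even_idx i) = d ord_max.
Hypothesis de : d ord_max * e = 1.
Hypothesis ed : e * d ord_max = 1.

(** A value of r beyond the matrix leaves a diagonal matrix; the torus is obtained in this way. *)
Definition bidiag (i j : 'I_5) : B :=
  if i == j then d i else if (i == r.+1 :> nat) && (j == r :> nat) then x else 0.

Definition bidiag_gen (y : GLq_gen) : B := if y is inl (i, j) then bidiag i j else e.

Definition bidiag_free : {rmorphism GLq_free R -> B} :=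
  free_liftR GLq_gen_parity bidiag_gen kappaC.

Local Notation phi := bidiag_free.

Lemma bidiag_free_a i j : phi (free_a R i j) = bidiag i j.
Proof. exact: free_lift_fgen. Qed.
Lemma bidiag_free_salg k : phi (salg k) = kappa k.
Proof. exact: free_lift_salg. Qed.


Lemma bidiag_eq0 (i j : 'I_5) :
  (i != j :> nat) -> ~ (i = r.+1 :> nat /\ j = r :> nat) -> bidiag i j = 0.
Proof.
move=> nij nr; rewrite /bidiag ifN; last by rewrite -val_eqE.
by case: ifP => // /andP[/eqP ir /eqP jr]; case: nr.
Qed.

Variant bidiag_spec (i j : 'I_5) : B -> Type :=
| BidiagDiag of (i = j :> nat) : bidiag_spec i j (d i)
| BidiagX of (i = r.+1 :> nat) & (j = r :> nat) : bidiag_spec i j x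
| Bidiag0 of (i != j :> nat) & ~ (i = r.+1 :> nat /\ j = r :> nat) :
    bidiag_spec i j 0.

Lemma bidiagP i j : bidiag_spec i j (bidiag i j).
Proof.
rewrite /bidiag; case: (i =P j) => [->|nij]; first exact: BidiagDiag.
have vij : i != j :> nat by apply/eqP => /val_inj.
case: ifP => [/andP[/eqP ir /eqP jr]|/negbT]; first exact: BidiagX.
rewrite negb_and => nr; apply: Bidiag0 => // -[ir jr].
by move: nr; rewrite ir jr !eqxx.
Qed.

Section Evaluation.
Variables (A : superAlgType (Cq R)) (psi : {rmorphism A -> B}).
Variable a : 'I_5 -> 'I_5 -> A.
Hypothesis psi_salg : forall k, psi (salg k) = kappa k.
Hypothesis psi_a : forall i j, psi (a i j) = bidiag i j.

Let psi_q i : psi (q_idx A i) = kappa (if idx_parity i then q else qV).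
Proof. exact: psi_salg. Qed.
Let psi_sign n : psi ((-1) ^+ n) = (-1) ^+ n.
Proof. by rewrite rmorphXn rmorphN1. Qed.

Lemma bidiag_Mq y : Mq_relator a y -> psi y = 0.
Proof.
have r3 (i : 'I_5) : idx_parity i = (i == 4 :> nat) by rewrite /idx_parity -val_eqE.
case=> [i j pij|i j l jl|i j k ik|i j k l ijkl|i j k l ik jl].
- rewrite rmorphXn /= psi_a; case: bidiagP => [ij|ir jr|_ _].
  + by move: pij; rewrite /gen_parity !r3 ij addbb.
  + rewrite expr2 xx //; move: pij; rewrite /gen_parity !r3 ir jr.
    by have := ltn_ord i; lia.
  + by rewrite expr0n.
- rewrite rmorphB !rmorphM /= psi_sign psi_q !psi_a.
  case: (bidiagP i j) => [ij|ir jr|_ _]; last by rewrite mulr0 mul0r mulr0 subrr.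
    by rewrite (@bidiag_eq0 i l) ?mulr0 ?mul0r ?mulr0 ?subrr //; lia.
  case: (bidiagP i l) => [il|ir' lr|_ _]; last by rewrite mulr0 mul0r mulr0 subrr.
    have -> : idx_parity i = (r == 3) by rewrite r3; lia.
    by rewrite dx_row // /gen_parity (val_inj il) addbb andbF expr0 mul1r subrr.
  by lia.
- rewrite rmorphB !rmorphM /= psi_sign psi_q !psi_a.
  case: (bidiagP i j) => [ij|ir jr|_ _]; last by rewrite mulr0 mul0r mulr0 subrr.
    case: (bidiagP k j) => [kj|kr jr|_ _]; last by rewrite mulr0 mul0r mulr0 subrr.
      by lia.
    rewrite dx_col ?(etrans ij jr) // /gen_parity (val_inj ij) addbb expr0 mul1r r3 ifF ?subrr //.
    by have := ltn_ord k; lia.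
  by rewrite (@bidiag_eq0 k j) ?mulr0 ?mul0r ?mulr0 ?subrr //; lia.
- rewrite rmorphB !rmorphM /= psi_sign !psi_a.
  by case: (bidiagP i j) => [ij|ir jr|_ _]; case: (bidiagP k l) => [kl|kr lr|_ _];
    rewrite ?(mulr0, mul0r) ?subrr //; lia.
- rewrite !(rmorphB psi) !rmorphM /= !psi_sign !psi_a.
  (* If the second entry is not above the diagonal, then k > i >= l > j, which puts (k, j) at least
     two places below the diagonal. *)
  have -> : bidiag k j * bidiag i l = 0.
    by case: (bidiagP k j) => [kj|kr jr|_ _]; case: (bidiagP i l) => [il|ir lr|_ _];
      rewrite ?(mulr0, mul0r) //; lia.
  rewrite mulr0 subr0.
  case: (bidiagP i j) => [ij|ir jr|_ _]; case: (bidiagP k l) => [kl|kr lr|_ _];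
    rewrite ?(mulr0, mul0r) ?subrr //.
  + by rewrite dd /gen_parity (val_inj ij) addbb mul1r subrr.
  + by rewrite xd /gen_parity ?(val_inj ij) ?addbb ?mul1r ?subrr //; lia.
  + by rewrite -xd /gen_parity ?(val_inj kl) ?addbb ?andbF ?mul1r ?subrr //; lia.
  + by lia.
Qed.


Lemma bidiag_qdet (b : 'I_4 -> 'I_4 -> A) :
  (forall i j, psi (b i j) = bidiag (even_idx i) (even_idx j)) ->
  psi (qdet b) = d ord_max.
Proof.
move=> psi_b; rewrite rmorph_sum (bigD1 1%g) //= [X in _ + X]big1 => [|s ns].
  rewrite addr0 rmorphM rmorph_prod perm_length1 expr0 !rmorph1 mul1r -d_det.
  by apply: eq_bigr => i _; rewrite /= perm1 psi_b /bidiag eqxx.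
have [i lti] := perm_excedance ns.
rewrite rmorphM rmorph_prod (@prod_seq_eq0 _ _ _ _ i) ?mulr0 //= ?mem_index_enum //.
by rewrite psi_b bidiag_eq0 //=; lia.
Qed.

End Evaluation.

Lemma bidiag_free_rel i (s : GLq_free R) : GLq_relator s -> phi (spart i s) = 0.
Proof.
move=> rel_s; have [p hp] := GLq_relator_hom rel_s; rewrite (spart_hom i hp).
case: ifP => _; last exact: rmorph0.
have D1E : phi (free_D1 R) = d ord_max.
  by apply: bidiag_qdet => j l; exact: bidiag_free_a.
have VE b : phi (fgen _ GLq_gen_parity (inr b)) = e by apply: free_lift_fgen.
have D2E : phi (free_D2 R) = d ord_max by rewrite bidiag_free_a /bidiag eqxx.
have phiBM y z : phi (y * z - 1) = phi y * phi z - 1.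
  by rewrite rmorphB rmorph1 rmorphM.
case: rel_s {hp} => [y rel_y||||].
  exact: (bidiag_Mq bidiag_free_salg bidiag_free_a rel_y).
all: by rewrite phiBM ?D1E ?D2E VE ?de ?ed subrr.
Qed.

Definition bidiag_GL : {rmorphism GLq R -> B} := quot_liftR bidiag_free_rel.

Lemma bidiag_GL_a i j : bidiag_GL (GLq_a R i j) = bidiag i j.
Proof. exact: etrans (quot_liftE bidiag_free_rel _) (bidiag_free_a i j). Qed.

Lemma bidiag_GL_salg k : bidiag_GL (salg k) = kappa k.
Proof. exact: etrans (quot_liftE bidiag_free_rel _) (bidiag_free_salg k). Qed.

Lemma bidiag_GL_Ber i (s : GLq R) : s = Ber R - 1 -> bidiag_GL (spart i s) = 0.
Proof.
move=> ->; rewrite (@spart_hom _ _ false) ?homB ?spart1 ?Ber_hom //.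
case: ifP => _; rewrite ?rmorph0 // rmorphB rmorph1 rmorphM.
have -> : bidiag_GL (GLq_a55V R) = e.
  by apply: etrans (quot_liftE bidiag_free_rel _) _; apply: free_lift_fgen.
rewrite bidiag_qdet ?de ?subrr // => j l.
(* The last column vanishes above the diagonal, so the correction a_i5 a_55^-1 a_5j disappears and
   the Berezinian becomes D_1 a_55^-1. *)
rewrite rmorphB !rmorphM !bidiag_GL_a [X in X * _ * _]bidiag_eq0 ?mul0r ?subr0 //=.
  by have := ltn_ord j; lia.
by have := ltn_ord j; lia.
Qed.

Definition bidiag_SL : {rmorphism SLq R -> B} := quot_liftR bidiag_GL_Ber.

Lemma bidiag_SL_a i j : bidiag_SL (SLq_a R i j) = bidiag i j.
Proof. exact: etrans (quot_liftE bidiag_GL_Ber _) (bidiag_GL_a i j). Qed.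

Lemma bidiag_SL_salg k : bidiag_SL (salg k) = kappa k.
Proof. exact: etrans (quot_liftE bidiag_GL_Ber _) (bidiag_GL_salg k). Qed.

End Lift.

(** * The operators for one entry below the diagonal, and a one-parameter torus *)

Section LowerMorphisms.
Variable R : realType.
Local Notation K := (Cq R).

Definition unit_of (u : K) : Prop := exists v, v * u = 1.

Lemma unit_of1 : unit_of 1. Proof. by exists 1; rewrite mul1r. Qed.
Lemma unit_ofM u v : unit_of u -> unit_of v -> unit_of (u * v).
Proof. by move=> [u' eu] [v' ev]; exists (u' * v'); rewrite mulrACA eu ev mulr1. Qed.
Lemma unit_ofX u n : unit_of u -> unit_of (u ^+ n).
Proof. by move=> [v e]; exists (v ^+ n); rewrite -exprMn_comm ?e ?expr1n //; apply: mulrC. Qed.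
Lemma unit_ofN1 : unit_of (-1). Proof. by exists (-1); rewrite mulrNN mulr1. Qed.
Lemma unit_of_q : unit_of q. Proof. by exists qV; rewrite mulrC q_qV. Qed.
Lemma unit_of_qV : unit_of qV. Proof. by exists q; rewrite q_qV. Qed.

Definition lower_wt (c : K) : seqop K := seqop_shift (fun n => c ^+ `|n|%N) id.

(* With the weights c^|n| the relation x d = c d x needs |n + 1| = |n| + 1, hence
   the cut-off at n >= 0; for the odd entry (r = 3) the shift is cut off further,
   so that its square vanishes. *)
Definition lower_x (r : nat) : seqop K :=
  seqop_shift (fun n => (if r == 3%N then n == 0 else 0 <= n)%:R) (fun n => n + 1).

(** The weight in place r + 1 is forced by the Berezinian: it is inverse to that in place r when
    both rows are even, and equal to it when r + 1 is the odd row, where a_55 has to be the product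
    of the other diagonal entries. *)
Definition lower_d (r : nat) (i : 'I_5) : seqop K :=
  if i == r :> nat then lower_wt q
  else if i == r.+1 :> nat then lower_wt (if r == 3%N then q else qV) else 1.

Lemma lower_wtC b c : lower_wt b * lower_wt c = lower_wt c * lower_wt b.
Proof. by apply: seqop_ext => f n; rewrite /= mulrCA. Qed.

Lemma lower_wtK b c : b * c = 1 -> lower_wt b * lower_wt c = 1.
Proof.
move=> bc; apply: seqop_ext => f n /=.
by rewrite mulrA -exprMn_comm ?bc ?expr1n ?mul1r //; apply: mulrC.
Qed.

Lemma lower_xwt r c : lower_x r * lower_wt c = seqop_const c * (lower_wt c * lower_x r).
Proof.
apply: seqop_ext => f n /=; case: ifP => [_|_].
  by case: eqP => [->|_]; rewrite ?mul0r ?mulr0 //= expr1 expr0 !mul1r.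
case: n => n; last by rewrite !mul0r !mulr0.
by rewrite !mul1r -PoszD addn1 /= exprS -mulrA.
Qed.

Lemma lower_wt_x r b c : b * c = 1 ->
  lower_wt b * lower_x r = seqop_const c * (lower_x r * lower_wt b).
Proof. by move=> bc; rewrite lower_xwt mulrA -rmorphM [c * b]mulrC bc rmorph1 mul1r. Qed.

Lemma lower_dC r i j : lower_d r i * lower_d r j = lower_d r j * lower_d r i.
Proof.
by rewrite /lower_d; do !case: ifP => _; rewrite ?mul1r ?mulr1 // lower_wtC.
Qed.

Lemma lower_morphism r : (r < 4)%N ->
  exists beta : {rmorphism SLq R -> seqop K},
    (forall k, beta (salg k) = seqop_const k) /\
    (forall i j, beta (SLq_a R i j) = bidiag (lower_d r) r (lower_x r) i j).
Proof.
move=> r4; have qK := @q_qV R; have qVK : qV * q = 1 :> K by rewrite mulrC q_qV.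
pose e := if r == 3%N then lower_wt qV else 1.
have xd i : (i : 'I_5) != r :> nat -> i != r.+1 :> nat ->
    lower_x r * lower_d r i = lower_d r i * lower_x r.
  by move=> ir ir'; rewrite /lower_d !ifN // mulr1 mul1r.
have dx_col (i : 'I_5) : i = r :> nat ->
    lower_d r i * lower_x r = seqop_const qV * (lower_x r * lower_d r i).
  by move=> ir; rewrite /lower_d ir eqxx; apply: lower_wt_x.
have dx_row (i : 'I_5) : i = r.+1 :> nat -> lower_x r * lower_d r i =
    seqop_const (if r == 3%N then q else qV) * (lower_d r i * lower_x r).
  by move=> ir; rewrite /lower_d ir eqxx ifN ?lower_xwt //; lia.
have xx : r = 3%N -> lower_x r * lower_x r = 0.
  move=> ->; apply: seqop_ext => f n /=.
  by case: eqP => [->|_]; rewrite ?mul0r ?mulr0.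
have d_det : \prod_(i < 4) lower_d r (even_idx i) = lower_d r ord_max.
  rewrite !big_ord_recl big_ord0 /lower_d /=.
  by case: r r4 {e xd dx_col dx_row xx} => [|[|[|[|]]]] //= _;
    rewrite ?(mul1r, mulr1) ?lower_wtK.
have de : lower_d r ord_max * e = 1.
  rewrite /lower_d /e /=; case: r r4 {e xd dx_col dx_row xx d_det} => [|[|[|[|]]]] //= _;
    by rewrite ?mulr1 ?lower_wtK.
have ed : e * lower_d r ord_max = 1.
  rewrite /lower_d /e /=; case: r r4 {e xd dx_col dx_row xx d_det de} => [|[|[|[|]]]] //= _;
    by rewrite ?mulr1 ?lower_wtK.
exists (bidiag_SL (@seqop_constC _) (@lower_dC r) xd dx_col dx_row xx d_det de ed).
by split=> [k|i j]; [exact: bidiag_SL_salg | exact: bidiag_SL_a].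
Qed.

(** The first diagonal entry is the shift, so that D_12 acts by one shift; the last entry repeats it
    to make the Berezinian 1. *)
Definition torus_d (i : 'I_5) : seqop K :=
  if (i == 0%N :> nat) || (i == 4%N :> nat) then seqop_shift (fun=> 1) (fun n => n + 1)
  else 1.

Lemma torus_morphism : exists beta : {rmorphism SLq R -> seqop K},
    (forall k, beta (salg k) = seqop_const k) /\
    (forall i j, beta (SLq_a R i j) = if i == j then torus_d i else 0).
Proof.
pose e : seqop K := seqop_shift (fun=> 1) (fun n => n - 1).
have dC i j : torus_d i * torus_d j = torus_d j * torus_d i.
  by rewrite /torus_d; do !case: ifP => _; rewrite ?mul1r ?mulr1.
have xd (i : 'I_5) : i != 5%N :> nat -> i != 6%N :> nat -> 0 * torus_d i = torus_d i * 0.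
  by rewrite mulr0 mul0r.
have dx_col (i : 'I_5) : i = 5%N :> nat ->
    torus_d i * 0 = seqop_const qV * (0 * torus_d i).
  by rewrite mul0r !mulr0.
have dx_row (i : 'I_5) : i = 6%N :> nat ->
    0 * torus_d i = seqop_const (if 5%N == 3%N then q else qV) * (torus_d i * 0).
  by rewrite mul0r !mulr0.
have xx : 5%N = 3%N -> 0 * 0 = 0 :> seqop K by rewrite mulr0.
have d_det : \prod_(i < 4) torus_d (even_idx i) = torus_d ord_max.
  by rewrite !big_ord_recl big_ord0 /torus_d /= !mulr1.
have de : torus_d ord_max * e = 1.
  by apply: seqop_ext => f n /=; rewrite !mul1r addrK.
have ed : e * torus_d ord_max = 1.
  by apply: seqop_ext => f n /=; rewrite !mul1r subrK.
exists (bidiag_SL (@seqop_constC _) dC xd dx_col dx_row xx d_det de ed).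
split=> [k|i j]; first exact: bidiag_SL_salg.
by rewrite bidiag_SL_a /bidiag; case: ifP => // _; rewrite if_same.
Qed.

Lemma lower_d_delta r i (e : nat) : (r < 4)%N -> exists2 u, unit_of u &
  lower_d r i (seq_delta K e) = fun n => u * seq_delta K e n.
Proof.
have wt c : unit_of c -> exists2 u, unit_of u &
    lower_wt c (seq_delta K e) = fun n => u * seq_delta K e n.
  move=> uc; exists (c ^+ e); first exact: unit_ofX.
  by apply/funext => n; rewrite /= /seq_delta; case: eqP => [->|_]; rewrite ?mulr0.
move=> r4; rewrite /lower_d; case: ifP => _; first exact/wt/unit_of_q.
case: ifP => _.
  by apply: wt; case: ifP => _; [exact: unit_of_q | exact: unit_of_qV].
by exists 1; [exact: unit_of1 | apply/funext => n; rewrite mul1r].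
Qed.

(** On point masses x is a lowering operator, while the diagonal entries only multiply by units.
    Hence a product applied to the mass at e has a nonzero value at 0 only if it contains exactly e
    factors x. *)
Lemma lower_x_delta r (e : nat) :
  lower_x r (seq_delta K e) =
  if (0 < e)%N && ((r == 3%N) ==> (e == 1%N)) then seq_delta K e.-1%N else fun=> 0.
Proof.
apply/funext => n; rewrite /= /seq_delta.
case: e => [|e] /=.
  case: ifP => _; first by case: eqP => [->|_]; rewrite ?mul0r ?mulr0.
  by case: n => n; rewrite ?mul0r // -PoszD addn1 mulr0.
have -> : (n + 1 == e.+1) = (n == e) by lia.
case: ifP => _ /=; last by rewrite /=; case: n => n; rewrite ?mul0r ?mul1r.
rewrite eqSS; case: e => [|e] /=; first by case: eqP => _; rewrite ?mul0r ?mul1r.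
by case: eqP => [->|_]; rewrite ?mulr0 ?mul0r.
Qed.

End LowerMorphisms.

(** * The straightening law *)

Section StraighteningTable.
Local Open Scope nat_scope.

(* Rows are numbered from 0 to 4; the boolean is false for the first column and
   true for the second one.  The monomial (s, (m, n), w) stands for
   (-1)^s q^m (q^-1)^n times the product of the entries listed in w. *)
Definition entry := (nat * bool)%type.
Definition monomial := (bool * (nat * nat) * seq entry)%type.

Definition mono_mul (s t : monomial) : monomial :=
  (s.1.1 (+) t.1.1, ((s.1.2.1 + t.1.2.1), (s.1.2.2 + t.1.2.2)), s.2 ++ t.2).

(** For rows below 5, [None] means that the pair is in order: rows increase weakly and in a row the
    first column precedes the second. [Some [::]] is the vanishing square of an odd entry. *)
Definition swap_entries (x y : entry) : option (seq monomial) :=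
  if y.1 < x.1 < 5 then
    if x.2 == y.2 then Some [:: (false, (1, 0), [:: y; x])]
    else if y.2 then Some [:: (false, (0, 0), [:: y; x])]
    else Some [:: (false, (0, 0), [:: y; x]);
                  (true, (0, 1), [:: (y.1, true); (x.1, false)]);
                  (false, (1, 0), [:: (y.1, true); (x.1, false)])]
  else if x.1 == y.1 then
    if x.2 == y.2 then (if x.1 == 4 then Some [::] else None)
    else if (x.1 < 5) && x.2 then
      Some (if x.1 == 4 then [:: (true, (0, 1), [:: y; x])]
            else [:: (false, (1, 0), [:: y; x])])
    else None
  else None.

Fixpoint reorder (w : seq entry) : option (seq monomial) :=
  if w is x :: w' then
    if w' is y :: w'' then
      if swap_entries x y is Some ts then
        Some [seq mono_mul t (false, (0, 0), w'') | t <- ts]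
      else omap (map (mono_mul (false, (0, 0), [:: x]))) (reorder w')
    else None
  else None.

(** Truncated subtraction cancels q against q^-1 and leaves at most one nonzero exponent, so equal
    coefficients become syntactically equal and [mono_insert] can recognise opposite monomials. *)
Definition mono_norm (t : monomial) : monomial :=
  let: (s, (m, n), w) := t in (s, ((m - n), (n - m)), w).

Definition mono_opp (t : monomial) : monomial := (~~ t.1.1, t.1.2, t.2).

Definition mono_insert (t : monomial) (ts : seq monomial) : seq monomial :=
  if mono_opp t \in ts then rem (mono_opp t) ts else t :: ts.

(** Every outcome represents the same element as the input, also when the fuel runs out, since the
    unprocessed monomials are returned. Soundness alone thus makes an empty result a proof of
    vanishing. *)
Fixpoint normal_form (fuel : nat) (todo done : seq monomial) : seq monomial :=
  if fuel is fuel'.+1 then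
    if todo is t :: todo' then
      if reorder t.2 is Some ts then
        normal_form fuel' (map (mono_mul (t.1, [::])) ts ++ todo') done
      else normal_form fuel' todo' (mono_insert (mono_norm t) done)
    else done
  else todo ++ done.

Definition minor := (nat * nat)%type.

Definition minor_monos (l : minor) : seq monomial :=
  if l.1 == l.2 then [:: (false, (0, 0), [:: (l.1, false); (l.2, true)])]
  else [:: (false, (0, 0), [:: (l.1, false); (l.2, true)]);
           (true, (0, 1), [:: (l.1, true); (l.2, false)])].

(** The order of the list matters: it refines [standard], and the first letter moves strictly
    forward in it at each straightening step. *)
Definition minors : seq minor :=
  [:: (0, 1); (0, 2); (0, 3); (1, 2); (1, 3); (2, 3);
      (0, 4); (1, 4); (2, 4); (3, 4); (4, 4)].

(* The two columns (i, k), (j, l) form a semistandard tableau; the odd row 4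
   appears at most once in each row of the tableau. *)
Definition standard (g h : minor) : bool :=
  [&& (g.1 <= h.1), (g.2 <= h.2) & ~~ ((g.2 == 4) && (h.2 == 4))].

(** The cases are the relative positions of the row sets. Two minors with row 4 multiply to zero or
    to a multiple of an even minor times D_55; pairs that are separated or share a row q-commute;
    nested pairs obey the quantum Plücker relation; crossing pairs q-commute up to a term with
    coefficient q - q^3. *)
Definition straighten (g h : minor) : seq (bool * nat * (minor * minor)) :=
  let: ((i, j), (k, l)) := (g, h) in
  if (j == 4) && (l == 4) then
    if [|| i == 4, k == 4 | i == k] then [::]
    else if (i < k) then [:: (false, 1, ((i, k), (4, 4)))]
    else [:: (true, 0, ((k, i), (4, 4)))]
  else if (i == 4) || (l < i) then [:: (false, 2, (h, g))]
  else if [|| i == k, i == l, j == k | j == l] then [:: (false, 1, (h, g))]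
  else if (i < k) && (l < j) || (k < i) && (j < l) then
    [:: (false, 1, ((minn i k, minn j l), (maxn i k, maxn j l)));
        (true, 2, ((minn i k, maxn i k), (minn j l, maxn j l)))]
  else [:: (false, 2, (h, g)); (false, 1, ((k, i), (l, j)));
           (true, 3, ((k, i), (l, j)))].

Definition minors_mul (ss ts : seq monomial) := [seq mono_mul s t | s <- ss, t <- ts].

Definition straighten_monos (u : bool * nat * (minor * minor)) : seq monomial :=
  [seq mono_mul (u.1.1, (u.1.2, 0), [::]) t
     | t <- minors_mul (minor_monos u.2.1) (minor_monos u.2.2)].

(** The relation and the decrease that makes its iteration stop are tested together. The fuel 200
    covers all pairs of minors, as the evaluation below confirms. *)
Definition straighten_check (g h : minor) : bool :=
  standard g h ||
  (normal_form 200 (minors_mul (minor_monos g) (minor_monos h) ++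
    map mono_opp (flatten (map straighten_monos (straighten g h)))) [::] == [::])
  && all (fun u => [&& (index u.2.1 minors < index g minors),
                   u.2.1 \in minors & u.2.2 \in minors]) (straighten g h).

Lemma straighten_checked : all (fun g => all (straighten_check g) minors) minors.
Proof. by vm_compute. Qed.


End StraighteningTable.

(** * Soundness of the symbolic reordering *)

Section NormalForm.
Variables (K : comNzRingType) (q qV : K) (A : superAlgType K).
Variable a : nat -> bool -> A.
Hypothesis qK : q * qV = 1.
Hypothesis a_col : forall i k c, (i < k < 5)%N ->
  a k c * a i c = salg q * (a i c * a k c).
Hypothesis a_anti : forall i k, (i < k < 5)%N -> a k false * a i true = a i true * a k false.
Hypothesis a_diag : forall i k, (i < k < 5)%N ->
  a k true * a i false = a i false * a k true - salg (qV - q) * (a i true * a k false).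
Hypothesis a_row : forall i, (i < 4)%N -> a i true * a i false = salg q * (a i false * a i true).
Hypothesis a_row4 : a 4%N true * a 4%N false = - (salg qV * (a 4%N false * a 4%N true)).
Hypothesis a_sqr : forall c, a 4%N c * a 4%N c = 0.

Definition mono_coef (t : monomial) : A :=
  salg ((-1) ^+ t.1.1 * (q ^+ t.1.2.1 * qV ^+ t.1.2.2)).

Definition mono_eval (t : monomial) : A := mono_coef t * \prod_(x <- t.2) a x.1 x.2.

Definition monos_eval (ts : seq monomial) : A := \sum_(t <- ts) mono_eval t.

Lemma mono_evalM s t : mono_eval (mono_mul s t) = mono_eval s * mono_eval t.
Proof.
rewrite /mono_eval /mono_coef /mono_mul /= big_cat signr_addb !exprD -[RHS]mulrA.
rewrite -salgA [RHS]mulrA -rmorphM; congr (salg _ * _).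
by rewrite [RHS]mulrACA; congr (_ * _); rewrite mulrACA.
Qed.

Lemma mono_evalN t : mono_eval (mono_opp t) = - mono_eval t.
Proof. by rewrite /mono_eval /mono_coef /= signrN mulNr rmorphN mulNr. Qed.

Lemma mono_eval_norm t : mono_eval (mono_norm t) = mono_eval t.
Proof.
case: t => [[s [m n]] w]; congr (salg (_ * _) * _) => /=.
have [nm|/ltnW mn] := leqP n m.
  rewrite -[in RHS](subnK nm) exprD -mulrA -exprMn qK expr1n mulr1.
  by rewrite (eqP nm) expr0 mulr1.
rewrite -[in RHS](subnK mn) exprD mulrCA -exprMn qK expr1n mulr1.
by rewrite (eqP mn) expr0 mul1r.
Qed.

Lemma monos_eval_cat ss ts : monos_eval (ss ++ ts) = monos_eval ss + monos_eval ts.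
Proof. exact: big_cat. Qed.

Lemma monos_evalM ss ts : monos_eval (minors_mul ss ts) = monos_eval ss * monos_eval ts.
Proof.
rewrite /monos_eval big_allpairs_dep mulr_suml; apply: eq_bigr => s _.
by rewrite mulr_sumr; apply: eq_bigr => t _; apply: mono_evalM.
Qed.

Lemma monos_evalN ts : monos_eval (map mono_opp ts) = - monos_eval ts.
Proof.
by rewrite /monos_eval big_map -sumrN; apply: eq_bigr => t _; apply: mono_evalN.
Qed.

Lemma monos_eval_mull s ts :
  monos_eval (map (mono_mul s) ts) = mono_eval s * monos_eval ts.
Proof.
by rewrite /monos_eval big_map mulr_sumr; apply: eq_bigr => t _; apply: mono_evalM.
Qed.

Lemma mono_insertE t ts : monos_eval (mono_insert t ts) = mono_eval t + monos_eval ts.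
Proof.
rewrite /mono_insert; case: ifP => [tts|_]; last exact: big_cons.
rewrite [in RHS]/monos_eval (perm_big _ (perm_to_rem tts)) big_cons mono_evalN.
by rewrite addrA subrr add0r.
Qed.

Let entries_eval w := mono_eval (false, (0, 0)%N, w).

Let entries_evalE w : entries_eval w = \prod_(x <- w) a x.1 x.2.
Proof. by rewrite /entries_eval /mono_eval /mono_coef /= !expr0 !mul1r rmorph1 mul1r. Qed.

Let swap_entriesE x y ts :
  swap_entries x y = Some ts -> monos_eval ts = a x.1 x.2 * a y.1 y.2.
Proof.
have eval2 s m n (u v : entry) : mono_eval (s, (m, n), [:: u; v]) =
    salg ((-1) ^+ s * (q ^+ m * qV ^+ n)) * (a u.1 u.2 * a v.1 v.2).
  by rewrite /mono_eval !big_cons big_nil mulr1.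
case: x y => [k c] [i c']; rewrite /swap_entries /=.
case: ifP => [ik|_].
  case: eqP => [<-|cc']; first case=> <-.
    by rewrite /monos_eval big_seq1 eval2 /= !expr0 mul1r mulr1 expr1 [RHS]a_col.
  case: c' c cc' => [] [] // _ [<-].
    by rewrite /monos_eval big_seq1 eval2 /= !expr0 !mul1r rmorph1 mul1r [RHS]a_anti.
  rewrite /monos_eval !big_cons big_nil addr0 !eval2 /= !expr0 !expr1 !mul1r mulr1 rmorph1 mul1r.
  rewrite [RHS]a_diag //; congr (_ + _).
  by rewrite mulN1r -mulNr -rmorphN opprB rmorphB mulrBl rmorphN mulNr addrC.
case: eqP => // <-; case: eqP => [<-|cc'].
  by case: eqP => // -> [<-]; rewrite /monos_eval big_nil a_sqr.
case: ifP => // /andP[i5 hc]; case: c c' hc cc' => [] [] // _ _ [<-].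
case: eqP => [->|i4]; rewrite /monos_eval big_seq1 eval2 /= !expr0 !expr1 ?mul1r ?mulr1.
  by rewrite mulN1r rmorphN mulNr [RHS]a_row4.
by rewrite [RHS]a_row //; lia.
Qed.

Let reorderE w ts : reorder w = Some ts -> monos_eval ts = entries_eval w.
Proof.
elim: w ts => // x [//|y w] IHw ts.
rewrite -[reorder _]/(if swap_entries x y is Some us
  then Some [seq mono_mul t (false, (0, 0)%N, w) | t <- us]
  else omap (map (mono_mul (false, (0, 0)%N, [:: x]))) (reorder (y :: w))).
case sxy: (swap_entries x y) => [us|].
  case=> <-; rewrite entries_evalE 2!big_cons mulrA -(swap_entriesE sxy).
  rewrite /monos_eval big_map mulr_suml; apply: eq_bigr => t _.
  by rewrite mono_evalM -[X in _ * X]/(entries_eval w) entries_evalE.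
case rw: (reorder (y :: w)) => [us|//] [<-].
by rewrite monos_eval_mull (IHw _ rw) -[mono_eval _]/(entries_eval _) !entries_evalE big_seq1 [RHS]big_cons.
Qed.

Lemma normal_formE fuel todo done :
  monos_eval (normal_form fuel todo done) = monos_eval todo + monos_eval done.
Proof.
elim: fuel todo done => [|fuel IHf] todo done /=; first exact: monos_eval_cat.
case: todo => [|t todo]; first by rewrite /monos_eval big_nil add0r.
have -> : monos_eval (t :: todo) = mono_eval t + monos_eval todo by apply: big_cons.
case rt: (reorder t.2) => [ts|]; rewrite IHf.
  rewrite monos_eval_cat monos_eval_mull (reorderE rt); congr (_ + _ + _).
  by rewrite entries_evalE /mono_eval big_nil mulr1.
by rewrite mono_insertE mono_eval_norm addrCA addrA.
Qed.

Definition minor_eval (l : minor) : A :=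
  if l.1 == l.2 then a l.1 false * a l.2 true
  else a l.1 false * a l.2 true - salg qV * (a l.1 true * a l.2 false).

Lemma minor_monosE l : monos_eval (minor_monos l) = minor_eval l.
Proof.
rewrite /minor_monos /minor_eval; case: ifP => _.
  by rewrite /monos_eval big_seq1 -[LHS]/(entries_eval _) entries_evalE !big_cons big_nil mulr1.
rewrite /monos_eval !big_cons big_nil addr0 -[mono_eval (false, _, _)]/(entries_eval _) entries_evalE.
rewrite !big_cons big_nil mulr1; congr (_ + _).
by rewrite /mono_eval /mono_coef !big_cons big_nil mulr1 /= mul1r mulN1r rmorphN mulNr.
Qed.

Lemma straightenE g h : g \in minors -> h \in minors -> ~~ standard g h ->
  minor_eval g * minor_eval h = \sum_(u <- straighten g h)
    salg ((-1) ^+ u.1.1 * q ^+ u.1.2) * (minor_eval u.2.1 * minor_eval u.2.2).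
Proof.
move=> gin hin nstd; have /allP/(_ _ gin)/allP/(_ _ hin) := straighten_checked.
rewrite /straighten_check (negbTE nstd) => /andP[/eqP nf0 _].
have := normal_formE 200 (minors_mul (minor_monos g) (minor_monos h) ++
    map mono_opp (flatten (map straighten_monos (straighten g h)))) [::].
rewrite nf0 /= !monos_eval_cat monos_evalN monos_evalM !minor_monosE.
rewrite [monos_eval [::]]big_nil addr0 => /esym/eqP; rewrite subr_eq0 => /eqP->.
rewrite /monos_eval big_flatten big_map; apply: eq_bigr => u _.
rewrite -[LHS]/(monos_eval _) monos_eval_mull monos_evalM !minor_monosE.
by rewrite /mono_eval /mono_coef big_nil mulr1 /= mulr1.
Qed.

End NormalForm.

(** Relators are expressions in the entries, hence lift along any morphism. Applied to both quotient
    maps this carries the relations of M_q to SL_q. *)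
Lemma Mq_relator_lift (R : realType) (A B : superAlgType (Cq R))
    (psi : {supermorphism A -> B}) (a : 'I_5 -> 'I_5 -> A) y :
  Mq_relator (fun i j => psi (a i j)) y -> exists2 z, Mq_relator a z & y = psi z.
Proof.
have signE n : psi ((-1) ^+ n) = (-1) ^+ n by rewrite rmorphXn rmorphN1.
case=> [i j pij|i j l jl|i j k ik|i j k l ijkl|i j k l ik jl].
- by exists (a i j ^+ 2); [exact: Mq_odd | rewrite rmorphXn].
- eexists; first exact: (Mq_row _ i jl).
  by rewrite !(rmorphB, rmorphM) /= signE /q_idx supermorph_salg.
- eexists; first exact: (Mq_col _ j ik).
  by rewrite !(rmorphB, rmorphM) /= signE /q_idx supermorph_salg.
- eexists; first exact: (Mq_anti _ ijkl).
  by rewrite !(rmorphB, rmorphM) /= signE.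
- eexists; first exact: (Mq_diag _ ik jl).
  by rewrite 2!(rmorphB psi) !(rmorphM psi) /= !signE supermorph_salg.
Qed.

Lemma SLq_rel (R : realType) y : Mq_relator (SLq_a R) y -> y = 0.
Proof.
move=> /(@Mq_relator_lift _ _ _ (qproj (fun x => x = Ber R - 1)) (GLq_a R))[z rel_z ->].
have [t rel_t ->] := @Mq_relator_lift _ _ _ (qproj (@GLq_relator R)) (@free_a R) z rel_z.
have e0 : qproj (@GLq_relator R) t = 0 by apply/qproj_rel/GLq_Mq.
by rewrite /= e0 rmorph0.
Qed.

Lemma spart_SLq_a (R : realType) i j :
  spart (gen_parity i j) (SLq_a R i j) = SLq_a R i j.
Proof. by rewrite -!supermorph_spart spart_free_a. Qed.

(** * The q-minors of the first two columns *)

Section QuantumMatrixRelations.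
Variables (R : realType) (A : superAlgType (Cq R)) (a : 'I_5 -> 'I_5 -> A).
Hypothesis a_rel : forall y, Mq_relator a y -> y = 0.
Hypothesis a_hom : forall i j, spart (gen_parity i j) (a i j) = a i j.
Lemma Mq_rowE i (j l : 'I_5) : (j < l)%N -> a i j * a i l =
  (-1) ^+ (gen_parity i j && gen_parity i l) * q_idx _ i * (a i l * a i j).
Proof. by move=> jl; apply/eqP; rewrite -subr_eq0; apply/eqP/a_rel/Mq_row. Qed.

Lemma Mq_colE (i k j : 'I_5) : (i < k)%N -> a i j * a k j =
  (-1) ^+ (gen_parity i j && gen_parity k j) * q_idx _ j * (a k j * a i j).
Proof. by move=> ik; apply/eqP; rewrite -subr_eq0; apply/eqP/a_rel/Mq_col. Qed.

Lemma Mq_antiE (i k j l : 'I_5) : (i < k)%N -> (l < j)%N ->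
  a i j * a k l = (-1) ^+ (gen_parity i j && gen_parity k l) * (a k l * a i j).
Proof.
move=> ik lj; apply/eqP; rewrite -subr_eq0; apply/eqP/a_rel/Mq_anti.
by rewrite ik lj.
Qed.

Lemma Mq_diagE (i k j l : 'I_5) : (i < k)%N -> (j < l)%N ->
  a i j * a k l = (-1) ^+ (gen_parity i j && gen_parity k l) * (a k l * a i j) +
    (-1) ^+ (gen_parity i j && gen_parity k j) * salg (qV - q) * (a k j * a i l).
Proof.
move=> ik jl; apply/eqP; rewrite -subr_eq0 opprD addrA.
exact/eqP/a_rel/Mq_diag.
Qed.

Lemma Mq_oddE i j : gen_parity i j -> a i j * a i j = 0.
Proof. by move=> pij; apply/a_rel; rewrite -expr2; apply: Mq_odd. Qed.

Definition col12 (i : nat) (c : bool) : A := a (inord i) (inord c).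

Lemma idx_parity_inord i : (i < 5)%N -> idx_parity (inord i) = (i == 4%N).
Proof. by move=> i5; rewrite /idx_parity -val_eqE /= inordK. Qed.

Lemma idx_parity_col (c : bool) : idx_parity (inord c) = false.
Proof. by rewrite idx_parity_inord; case: c. Qed.

Lemma gen_parity_col12 i (c : bool) : (i < 5)%N ->
  gen_parity (inord i) (inord c) = (i == 4%N).
Proof. by move=> i5; rewrite /gen_parity idx_parity_col addbF idx_parity_inord. Qed.

Lemma gen_parity_col (i : 'I_5) (c : bool) :
  gen_parity i (inord c) = idx_parity i.
Proof. by rewrite /gen_parity idx_parity_col addbF. Qed.

Lemma salg_qK (x : A) : salg q * (salg qV * x) = x.
Proof. by rewrite mulrA -rmorphM q_qV rmorph1 mul1r. Qed.

Lemma salg_qVK (x : A) : salg qV * (salg q * x) = x.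
Proof. by rewrite mulrA -rmorphM mulrC q_qV rmorph1 mul1r. Qed.

Lemma Mq_col_even (i k : 'I_5) (c : bool) : (i < k)%N ->
  a k (inord c) * a i (inord c) = salg q * (a i (inord c) * a k (inord c)).
Proof.
move=> ik; rewrite (Mq_colE _ ik) !gen_parity_col /q_idx idx_parity_col.
have -> : idx_parity i = false by rewrite /idx_parity -val_eqE /=; have := ltn_ord k; lia.
by rewrite andFb expr0 mul1r salg_qK.
Qed.

Lemma Mq_anti01 (i k : 'I_5) : (i < k)%N ->
  a k (inord 0) * a i (inord 1) = a i (inord 1) * a k (inord 0).
Proof.
move=> ik; rewrite [RHS]Mq_antiE ?inordK //.
have -> : gen_parity i (inord 1) = false.
  rewrite (gen_parity_col i true) /idx_parity -val_eqE /=.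
  by have := ltn_ord k; lia.
by rewrite andFb expr0 mul1r.
Qed.

Lemma Mq_diag01 (i k : 'I_5) : (i < k)%N -> a k (inord 1) * a i (inord 0) =
  a i (inord 0) * a k (inord 1) - salg (qV - q) * (a i (inord 1) * a k (inord 0)).
Proof.
move=> ik; rewrite [X in X - _]Mq_diagE ?inordK //.
have -> : gen_parity i (inord 0) = false.
  rewrite (gen_parity_col i false) /idx_parity -val_eqE /=.
  by have := ltn_ord k; lia.
by rewrite !andFb !expr0 !mul1r Mq_anti01 // addrK.
Qed.

Lemma Mq_row_even (i : 'I_5) : (i < 4)%N ->
  a i (inord 1) * a i (inord 0) = salg q * (a i (inord 0) * a i (inord 1)).
Proof.
move=> i4; rewrite [in RHS]Mq_rowE ?inordK // (gen_parity_col i false) /q_idx.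
have -> : idx_parity i = false by rewrite /idx_parity -val_eqE /=; lia.
by rewrite andFb expr0 mul1r salg_qK.
Qed.

Lemma Mq_row_odd : a ord_max (inord 1) * a ord_max (inord 0) =
  - (salg qV * (a ord_max (inord 0) * a ord_max (inord 1))).
Proof.
rewrite [in RHS]Mq_rowE ?inordK // (gen_parity_col _ false) (gen_parity_col _ true).
rewrite /q_idx /idx_parity eqxx /= expr1 mulN1r !mulNr mulrN opprK.
by rewrite salg_qVK.
Qed.

Lemma inord4 : inord 4 = ord_max :> 'I_5.
Proof. by apply: val_inj; rewrite /= inordK. Qed.

Definition Dminor (l : minor) : A := minor_eval qV col12 l.

Lemma Dminor_straighten g h : g \in minors -> h \in minors -> ~~ standard g h ->
  Dminor g * Dminor h = \sum_(u <- straighten g h)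
    salg ((-1) ^+ u.1.1 * q ^+ u.1.2) * (Dminor u.2.1 * Dminor u.2.2).
Proof.
apply: straightenE; first exact: q_qV.
- move=> i k c /andP[ik k5]; apply: Mq_col_even.
  by rewrite !inordK //; lia.
- move=> i k /andP[ik k5]; apply: Mq_anti01; rewrite !inordK //; lia.
- move=> i k /andP[ik k5]; apply: Mq_diag01; rewrite !inordK //; lia.
- move=> i i4; apply: Mq_row_even; rewrite inordK //; lia.
- rewrite /col12 inord4; exact: Mq_row_odd.
- move=> c; apply: Mq_oddE; by rewrite gen_parity_col12.
Qed.

Definition Dword (w : seq minor) : A := \prod_(l <- w) Dminor l.

Definition minor_parity (l : minor) : bool := (l.1 == 4%N) (+) (l.2 == 4%N).

Lemma spart_a i j p : gen_parity i j = p -> spart p (a i j) = a i j.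
Proof. by move<-; exact: a_hom. Qed.

Local Notation m12 := (qminor12 a).

Lemma spart_qminor12 (i j : 'I_5) :
  spart (idx_parity i (+) idx_parity j) (m12 i j) = m12 i j.
Proof.
apply: homB; last apply: hom_evenM; rewrite ?spart_salg //; apply: spart_homM; apply: spart_a.
all: by rewrite -?[inord 0]/(inord false) -?[inord 1]/(inord true) gen_parity_col.
Qed.

Lemma Dminor_qminor12 (i j : nat) : i != j -> Dminor (i, j) = m12 (inord i) (inord j).
Proof. by move=> ij; rewrite /Dminor /minor_eval /= ifN. Qed.

Lemma Dminor44 : Dminor (4, 4)%N = a ord_max (inord 0) * a ord_max (inord 1).
Proof. by rewrite /Dminor /minor_eval /= /col12 !inord4. Qed.

Lemma ltn_minors (k l : 'I_5) : (k < l)%N -> (k : nat, l : nat) \in minors.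
Proof.
have := ltn_ord l; move: (k : nat) (l : nat) => {k l} k l l5 kl.
by case: l kl l5 => [|[|[|[|[|l]]]]] //; case: k => [|[|[|[|k]]]].
Qed.

Lemma minorsP l : l \in minors ->
  (l.1 < l.2 < 5)%N \/ l = (4, 4)%N.
Proof.
move=> lin; have /allP/(_ _ lin) : all (fun l => (l.1 < l.2 < 5)%N || (l == (4, 4)%N)) minors by [].
by case/orP => [->|/eqP->]; [left | right].
Qed.

Lemma spart_Dminor l : l \in minors -> spart (minor_parity l) (Dminor l) = Dminor l.
Proof.
case/minorsP => [|->]; last first.
  by rewrite Dminor44 -[minor_parity _]/(true (+) true) spart_homM // spart_a //
    -?[inord 0]/(inord false) -?[inord 1]/(inord true) gen_parity_col /idx_parity eqxx.
case: l => i j /andP[/= ij j5]; rewrite Dminor_qminor12; last by lia.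
rewrite -[RHS]spart_qminor12 /minor_parity /= -!idx_parity_inord //; lia.
Qed.

Lemma qminor12_eq0 (i : 'I_5) : (i < 4)%N -> m12 i i = 0.
Proof. by move=> i4; rewrite /qminor12 Mq_row_even // salg_qVK subrr. Qed.

Lemma qminor12_swap (i k : 'I_5) : (i < k)%N -> m12 k i = - (salg qV * m12 i k).
Proof.
move=> ik; rewrite /qminor12 (Mq_anti01 ik) (Mq_diag01 ik) !mulrBr.
rewrite rmorphB [in LHS]mulrBl mulrBr salg_qVK !opprB addrA.
by rewrite addrCA addrA addrK.
Qed.

(** Repeating the odd row does not give zero, but the factor 1 + q^-2 is not invertible; this is why
    D_55 is a generator in its own right. *)
Lemma qminor12_odd : m12 ord_max ord_max = salg (1 + qV * qV) * Dminor (4, 4)%N.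
Proof.
rewrite /qminor12 Mq_row_odd mulrN opprK -Dminor44 rmorphD rmorph1 mulrDl mul1r.
by rewrite rmorphM -mulrA.
Qed.

End QuantumMatrixRelations.

(** * Semistandard words and the exponents that determine them *)

Section StandardWords.
Local Open Scope nat_scope.

Definition minor_word (w : seq minor) : bool := all [in minors] w.

Definition standard_word (w : seq minor) : bool := minor_word w && sorted standard w.

Lemma standard_trans : transitive standard.
Proof. by move=> [i j] [k l] [m n]; rewrite /standard /=; lia. Qed.

(** A word read as a number in base 11, there being eleven minors. Straightening preserves the
    length, so comparing codes is comparing lexicographically. *)
Definition word_code (n : nat) (w : seq minor) : nat :=
  foldl (fun n l => n * 11 + index l minors)%N n w.

Lemma word_code_mono m n w : (m < n)%N -> (word_code m w < word_code n w)%N.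
Proof. by elim: w m n => //= l w IHw m n mn; apply: IHw; lia. Qed.

Lemma nonstandard_split (w : seq minor) : ~~ sorted standard w ->
  exists u g h v, w = u ++ g :: h :: v /\ ~~ standard g h.
Proof.
case: w => // g w; elim: w g => //= h w IHw g.
case: (boolP (standard g h)) => [_ /= /IHw[u [g' [h' [v [-> ns]]]]]|ns _].
  by exists (g :: u), g', h', v.
by exists [::], g, h, w.
Qed.


(* Row r + 1 is replaced by row r unless this would repeat a row: this is the term
   of highest degree in x when the comultiplication of the minor is followed by
   the bidiagonal morphism with its entry x in position (r + 1, r). *)
Definition lowers (r : nat) (l : minor) : bool :=
  (l.1 == r.+1) || (l.2 == r.+1) && (l.1 != r).

Definition lower_minor (r : nat) (l : minor) : minor :=
  if l.1 == r.+1 then (r, l.2)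
  else if (l.2 == r.+1) && (l.1 != r) then (l.1, r) else l.

(** The length is recorded at the end because [(0, 1)] is never lowered and would leave no other
    trace. *)
Fixpoint key (rs : seq nat) (w : seq minor) : seq nat :=
  if rs is r :: rs' then count (lowers r) w :: key rs' (map (lower_minor r) w)
  else [:: size w].

(* Two downward sweeps: the first brings the upper row of a minor to 0, the second
   brings its lower row to 1. *)
Definition steps : seq nat := [:: 3; 2; 1; 0; 3; 2; 1].

Lemma lower_minor_in r l : (r < 4)%N -> l \in minors -> lower_minor r l \in minors.
Proof.
move=> r4 lin; have /allP/(_ r)/(_ _)/allP/(_ _ lin) :
  all (fun r => all (fun l => lower_minor r l \in minors) minors) (iota 0 4) by [].
by apply; rewrite mem_iota.
Qed.

Lemma steps_end l : l \in minors -> foldl (fun l r => lower_minor r l) l steps = (0, 1).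
Proof.
by move=> lin; apply/eqP; have /allP/(_ _ lin) :
  all (fun l => foldl (fun l r => lower_minor r l) l steps == (0, 1)) minors by vm_compute.
Qed.

(** Makes every entry of a key a linear form in the eleven multiplicities, which reduces [key_inj]
    to integer arithmetic. *)
Lemma count_minors (P : pred minor) w : minor_word w ->
  count P w = sumn [seq (P l * count_mem l w)%N | l <- minors].
Proof.
move=> mw; rewrite sumnE big_map -sumn_count sumnE big_map.
under [RHS]eq_bigr => l _ do rewrite -sumn_count sumnE big_map big_distrr /=.
rewrite exchange_big /=; apply: eq_big_seq => x /(allP mw) xin.
rewrite (bigD1_seq x) //= eqxx muln1 big1 ?addn0 // => y.
by rewrite eq_sym => /negbTE ->; rewrite muln0.
Qed.

(** Two letters with second row 4 are never related by [standard], and by transitivity all pairs of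
    letters in a sorted word are related. This bounds the exponent of the odd x, whose square is
    zero. *)
Lemma count_odd_le1 (P : pred minor) w : standard_word w ->
  all (fun l => P l ==> (l.2 == 4)) minors -> count P w <= 1.
Proof.
move=> /andP[+ +] /allP P4; rewrite (sorted_pairwise standard_trans).
elim: w => //= g w IHw /andP[gin ww] /andP[/allP gw /(IHw ww) cw].
case Pg: (P g) => //=; rewrite (_ : count P w = 0) //.
apply/eqP; rewrite -leqn0 leqNgt -has_count; apply/hasP => -[h hw Ph].
have := implyP (P4 _ (allP ww _ hw)) Ph; have := implyP (P4 _ gin) Pg.
by move: (gw _ hw); rewrite /standard => /and3P[_ _ /negP n4] g4 h4; case: n4; rewrite g4 h4.
Qed.

Lemma count_standard_disjoint g h w : sorted standard w ->
  g != h -> ~~ standard g h -> ~~ standard h g -> count_mem g w = 0%N \/ count_mem h w = 0%N.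
Proof.
rewrite (sorted_pairwise standard_trans) => pw ngh gh hg.
case: (boolP (g \in w)) => [gw|/count_memPn]; last by left.
case: (boolP (h \in w)) => [hw|/count_memPn]; last by right.
exfalso; elim: w pw gw hw => //= x w IHw /andP[/allP xw /IHw{}IHw].
rewrite !inE => /predU1P[eg|gw] /predU1P[eh|hw]; last exact: IHw.
- by move: ngh; rewrite eg eh eqxx.
- by move: (xw h hw); rewrite -eg (negbTE gh).
- by move: (xw g gw); rewrite -eh (negbTE hg).
Qed.

(** A semistandard word is sorted for the total order of positions in [minors], hence determined by
    its multiset of letters. *)
Lemma standard_word_eq v w : standard_word v -> standard_word w ->
  (forall l, l \in minors -> count_mem l v = count_mem l w) -> v = w.
Proof.
move=> /andP[mv sv] /andP[mw sw] evw.
pose leT := relpre (index^~ minors) leq.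
have sorted_leT u : minor_word u -> sorted standard u -> sorted leT u.
  apply: (@sub_in_sorted _ [in minors] standard) => g h.
  have : all (fun g => all (fun h => standard g h ==> leT g h) minors) minors by vm_compute.
  by move=> /allP H gin hin; have /allP/(_ _ hin)/implyP := H _ gin.
have pvw : perm_eq v w.
  apply/allP => l; rewrite mem_cat => lvw; apply/eqP/evw.
  by case/orP: lvw => [/(allP mv)|/(allP mw)].
apply: (sorted_eq_in _ _ (sorted_leT _ mv sv) (sorted_leT _ mw sw) pvw).
  by move=> x y z _ _ _ /leq_trans; apply.
move=> x y xv yv; rewrite /leT /= -eqn_leq => /eqP.
exact: (index_inj (0, 1)%N (allP mv x xv) (allP mv y yv)).
Qed.

(** The key gives eight linear equations for eleven multiplicities. The missing information is that
    letters incomparable under [standard] do not occur together, and that row 4 is the second row of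
    at most one letter. *)
Lemma key_inj v w : standard_word v -> standard_word w ->
  key steps v = key steps w -> v = w.
Proof.
move=> sv sw; rewrite /key /steps -!count_predT !count_map => -[].
have /andP[mv ov] := sv; have /andP[mw ow] := sw.
rewrite !count_minors //=.
have odd1 u : standard_word u ->
    sumn [seq (l.2 == 4) * count_mem l u | l <- minors] <= 1.
  move=> su; have /andP[mu _] := su; rewrite -(@count_minors (fun l => l.2 == 4)) //.
  by apply: count_odd_le1.
move: (odd1 v sv) (odd1 w sw) => /=.
have disj u : sorted standard u ->
    [/\ count_mem (0, 3) u = 0 \/ count_mem (1, 2) u = 0,
        count_mem (0, 4) u = 0 \/
          [/\ count_mem (1, 2) u = 0, count_mem (1, 3) u = 0 & count_mem (2, 3) u = 0]
      & count_mem (1, 4) u = 0 \/ count_mem (2, 3) u = 0].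
  move=> su; have dj := count_standard_disjoint su; split; try exact: dj.
  have [-> | d1] := dj (0, 4) (1, 2) isT isT isT; first by left.
  have [-> | d2] := dj (0, 4) (1, 3) isT isT isT; first by left.
  by have [-> | d3] := dj (0, 4) (2, 3) isT isT isT; [left | right].
move: (disj v ov) (disj w ow) => dv dw lv lw e1 e2 e3 e4 e5 e6 e7 e8.
apply: standard_word_eq => // l lin; apply/eqP; move: l lin; apply/allP => /=.
move: dv dw lv lw e1 e2 e3 e4 e5 e6 e7 e8; rewrite !mul1n !mul0n !addn0 !add0n.
move: (count_mem (0, 1) v) (count_mem (0, 2) v) (count_mem (0, 3) v) (count_mem (1, 2) v) (count_mem (1, 3) v) (count_mem (2, 3) v) (count_mem (0, 4) v) (count_mem (1, 4) v) (count_mem (2, 4) v) (count_mem (3, 4) v) (count_mem (4, 4) v).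
move: (count_mem (0, 1) w) (count_mem (0, 2) w) (count_mem (0, 3) w) (count_mem (1, 2) w) (count_mem (1, 3) w) (count_mem (2, 3) w) (count_mem (0, 4) w) (count_mem (1, 4) w) (count_mem (2, 4) w) (count_mem (3, 4) w) (count_mem (4, 4) w).
move=> v0 v1 v2 v3 v4 v5 v6 v7 v8 v9 v10 w0 w1 w2 w3 w4 w5 w6 w7 w8 w9 w10.
case=> [[?|?] [?|[? ? ?]] [?|?]] [[?|?] [?|[? ? ?]] [?|?]] *; lia.
Qed.

End StandardWords.

(** * Spanning by semistandard words *)

Section Straightening.
Variables (R : realType) (A : superAlgType (Cq R)) (a : 'I_5 -> 'I_5 -> A).
Hypothesis a_rel : forall y, Mq_relator a y -> y = 0.
Hypothesis a_hom : forall i j, spart (gen_parity i j) (a i j) = a i j.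
Local Notation K := (Cq R).
Local Notation Dword := (Dword a).
Local Notation Dminor := (Dminor a).

Definition lincomb (s : seq (K * seq minor)) : A :=
  \sum_(u <- s) salg u.1 * Dword u.2.

Definition standard_span (x : A) : Prop :=
  exists2 s, all (standard_word \o snd) s & x = lincomb s.

Lemma standard_span0 : standard_span 0.
Proof. by exists [::] => //; rewrite /lincomb big_nil. Qed.

Lemma standard_spanD x y : standard_span x -> standard_span y -> standard_span (x + y).
Proof.
move=> [s ss ->] [t st ->]; exists (s ++ t); first by rewrite all_cat ss.
by rewrite /lincomb big_cat.
Qed.

Lemma standard_spanZ k x : standard_span x -> standard_span (salg k * x).
Proof.
move=> [s ss ->]; exists [seq (k * u.1, u.2) | u <- s].
  by rewrite all_map; apply: sub_all ss.
rewrite /lincomb big_map mulr_sumr; apply: eq_bigr => u _.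
by rewrite rmorphM mulrA.
Qed.

Lemma standard_span_sum (I : eqType) (s : seq I) (F : I -> A) :
  (forall i, i \in s -> standard_span (F i)) -> standard_span (\sum_(i <- s) F i).
Proof.
elim: s => [_|i s IHs hF]; first by rewrite big_nil; apply: standard_span0.
rewrite big_cons; apply: standard_spanD; first by apply: hF; rewrite mem_head.
by apply: IHs => j js; apply: hF; rewrite inE js orbT.
Qed.

Lemma Dword_cat v w : Dword (v ++ w) = Dword v * Dword w.
Proof. exact: big_cat. Qed.

Lemma Dword_cons l w : Dword (l :: w) = Dminor l * Dword w.
Proof. exact: big_cons. Qed.

(* Each straightening step lowers the word in the lexicographic order. *)
Lemma Dword_span w : minor_word w -> standard_span (Dword w).
Proof.
have [n] := ubnP (word_code 0 w); elim: n w => // n IHn w wn ww.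
case: (boolP (sorted standard w)) => [sw|/nonstandard_split[u [g [h [v [ew ns]]]]]].
  exists [:: (1, w)]; first by rewrite /= /standard_word ww sw.
  by rewrite /lincomb big_seq1 rmorph1 mul1r.
move: ww; rewrite /minor_word ew all_cat /= => /and4P[wu gin hin wv].
rewrite Dword_cat !Dword_cons [X in _ * X]mulrA (Dminor_straighten a_rel) //.
rewrite mulr_suml mulr_sumr; apply: standard_span_sum => t tin.
rewrite -!mulrA -salgA; apply: standard_spanZ.
rewrite -!Dword_cons -Dword_cat.
have /allP/(_ _ gin)/allP/(_ _ hin) := straighten_checked.
rewrite /straighten_check (negbTE ns) => /andP[_ /allP/(_ _ tin)/and3P[lt_tg t1 t2]].
apply: IHn; last by rewrite /minor_word all_cat /= wu t1 t2 wv.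
move: wn; rewrite ltnS; apply: leq_trans; rewrite ew /word_code !foldl_cat.
set n0 := foldl _ _ u.
(* The second letter may move back in the list, but as a digit below 11 it cannot offset the
   decrease of the first. *)
have lt2 : (index t.2.2 minors < 11)%N by move: t2; rewrite -index_mem.
apply: (@word_code_mono ((n0 * 11 + index t.2.1 minors) * 11 + index t.2.2 minors)
  ((n0 * 11 + index g minors) * 11 + index h minors)).
move: lt_tg lt2; move: (index t.2.1 _) (index t.2.2 _) (index g _) (index h _) n0.
by move=> *; lia.
Qed.

Lemma standard_spanM x y : standard_span x -> standard_span y -> standard_span (x * y).
Proof.
move=> [s ss ->] [t st ->]; rewrite /lincomb mulr_suml.
apply: standard_span_sum => u us; rewrite mulr_sumr.
apply: standard_span_sum => v vt; rewrite -mulrA -(salgA _ (Dword _)).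
do 2!apply: standard_spanZ; rewrite -Dword_cat; apply: Dword_span.
move: (allP ss _ us) (allP st _ vt) => /andP[wu _] /andP[wv _].
by rewrite /minor_word all_cat; apply/andP.
Qed.

Variable G : A -> Prop.
Hypothesis GP : forall s, G s -> exists2 l, l \in minors & s = Dminor l.

Lemma subgen_standard_span x : x \in subgen G -> standard_span x.
Proof.
move=> /asboolP; elim=> {x} [i s /GP[l lin ->]|k|x y _ hx _ hy|x y _ hx _ hy].
- rewrite (spart_hom i (spart_Dminor a_hom lin)); case: ifP => _.
    rewrite -[Dminor l]mulr1 -[1](_ : Dword [::] = 1) -?Dword_cons; last exact: big_nil.
    by apply: Dword_span; rewrite /minor_word /= lin.
  exact: standard_span0.
- rewrite -[salg k]mulr1; apply: standard_spanZ.
  by rewrite -[1](_ : Dword [::] = 1); [exact: Dword_span | exact: big_nil].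
- exact: standard_spanD.
- exact: standard_spanM.
Qed.

End Straightening.

(** * Linear forms separating semistandard words *)

Lemma double_sum_ord (V : nmodType) n (F : 'I_n -> 'I_n -> V) :
  \sum_i \sum_j F i j =
  \sum_i F i i + \sum_(i < n) \sum_(j < n | (i < j)%N) (F i j + F j i).
Proof.
have -> : \sum_(i < n) \sum_(j < n | (i < j)%N) (F i j + F j i) =
    \sum_(i < n) (\sum_(j < n | (i < j)%N) F i j + \sum_(j < n | (j < i)%N) F i j).
  rewrite [RHS]big_split /=.
  under eq_bigr => i _ do rewrite big_split.
  rewrite big_split /=; congr (_ + _).
  by rewrite (exchange_big_dep xpredT).
rewrite -big_split /=; apply: eq_bigr => i _.
rewrite (bigD1 i) //= (bigID (fun j : 'I_n => (i < j)%N)) /=; congr (_ + (_ + _)).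
  by apply: eq_bigl => j; rewrite -val_eqE /=; lia.
by apply: eq_bigl => j; rewrite -val_eqE /=; lia.
Qed.

Lemma tpureNl (K : comNzRingType) (A B : superAlgType K) (x : A) (y : B) :
  (- x) ⊗ y = - (x ⊗ y).
Proof. by apply: (addrI (x ⊗ y)); rewrite -tpureDl !subrr tpure0l. Qed.

(** * Comultiplication of the q-minors and convolution of linear forms *)

Section Comultiplication.
Variables (R : realType) (A : superAlgType (Cq R)) (a : 'I_5 -> 'I_5 -> A).
Hypothesis a_rel : forall y, Mq_relator a y -> y = 0.
Hypothesis a_hom : forall i j, spart (gen_parity i j) (a i j) = a i j.
Variable Delta : {supermorphism A -> A ⊗ A}.
Hypothesis Delta_a : forall i j, Delta (a i j) = \sum_(k < 5) a i k ⊗ a k j.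
Local Notation K := (Cq R).
Local Notation m12 := (qminor12 a).
Local Notation Dword := (Dword a).
Local Notation Dminor := (Dminor a).
Local Notation sgn k j l := ((-1) ^+ (idx_parity k && gen_parity j l) : K).

(** The sign arises when [a j l] passes [a k (inord c)], whose parity is that of k since the first
    two columns are even. It does not involve the columns, so the two products of a q-minor
    recombine. *)
Lemma Delta_aa i j (c d : bool) : Delta (a i (inord c) * a j (inord d)) =
  \sum_k \sum_l (salg (sgn k j l) * (a i k * a j l)) ⊗ (a k (inord c) * a l (inord d)).
Proof.
rewrite rmorphM /= !Delta_a mulr_suml; apply: eq_bigr => k _.
rewrite mulr_sumr; apply: eq_bigr => l _; apply: tens_mulE; last exact: a_hom.
by rewrite -{1}(gen_parity_col k c) a_hom.
Qed.

Lemma Delta_m12 i j : Delta (m12 i j) =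
  \sum_k \sum_l (salg (sgn k j l) * (a i k * a j l)) ⊗ m12 k l.
Proof.
rewrite rmorphB [X in _ - X]rmorphM /= supermorph_salg (Delta_aa _ _ false true) (Delta_aa _ _ true false).
rewrite mulr_sumr -sumrB; apply: eq_bigr => k _.
rewrite mulr_sumr -sumrB; apply: eq_bigr => l _.
by rewrite [X in _ - X]tens_salgZ [X in _ - X]tpureZ -[LHS](raddfB (tpure _)).
Qed.

Lemma Delta_D44 : Delta (Dminor (4, 4)%N) =
  (a ord_max ord_max * a ord_max ord_max) ⊗ Dminor (4, 4)%N +
  \sum_(k < 5) \sum_(l < 5 | (k < l)%N) (a ord_max k * a ord_max l) ⊗ m12 k l.
Proof.
rewrite Dminor44 (Delta_aa _ _ false true) double_sum_ord; congr (_ + _).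
  rewrite (bigD1 ord_max) //= big1 ?addr0 => [|k nk].
    by rewrite expr0 rmorph1 mul1r.
  by rewrite (Mq_oddE a_rel) ?mulr0 ?tpure0l.
apply: eq_bigr => k _; apply: eq_bigr => l kl.
have pk : idx_parity k = false by rewrite /idx_parity -val_eqE /=; have := ltn_ord l; lia.
have p4 : idx_parity ord_max by rewrite /idx_parity eqxx.
(* The sign has two origins: the relation between two odd entries if l < 4, the tensor product if l
   = 4. Either way the factor is -q^-1, so the terms (k, l) and (l, k) merge into one q-minor. *)
have -> : salg (sgn l ord_max k) * (a ord_max l * a ord_max k) =
    - (salg qV * (a ord_max k * a ord_max l)).
  rewrite [X in - (_ * X)](Mq_rowE a_rel _ kl) /q_idx p4 /gen_parity pk p4 /=.
  case: (idx_parity l) => /=; rewrite ?expr0 ?expr1 ?rmorphN ?rmorph1 ?mul1r ?mulN1r.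
    by rewrite salg_qVK.
  by rewrite !mulNr mulrN opprK salg_qVK.
rewrite pk expr0 rmorph1 mul1r /qminor12 (Mq_anti01 a_rel kl).
by rewrite raddfB /= tpureNl tpureZ.
Qed.


Definition linear_form (f : A -> K) : Prop :=
  {morph f : x y / x + y} /\ forall k x, f (salg k * x) = k * f x.

Lemma linear_form0 f : linear_form f -> f 0 = 0.
Proof. by move=> [fD _]; apply: (addrI (f 0)); rewrite -fD !addr0. Qed.

(** The sign automorphism multiplying x by (-1)^(p|x|); it records the Koszul sign of an element of
    parity p passing x, linearly in x. *)
Definition parity_twist (p : bool) (x : A) : A :=
  if p then spart false x - spart true x else x.

Lemma parity_twistD p : {morph parity_twist p : x y / x + y}.
Proof. by case: p => x y //=; rewrite !spartD opprD addrACA. Qed.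

Lemma parity_twistZ p k x : parity_twist p (salg k * x) = salg k * parity_twist p x.
Proof. by case: p => //=; rewrite !spartZ mulrBr. Qed.

Lemma parity_twist_hom p t x : spart t x = x ->
  parity_twist p x = (-1) ^+ (p && t) * x.
Proof.
case: p => /=; last by rewrite mul1r.
by move=> hx; rewrite !(spart_hom _ hx); case: t {hx}; rewrite /= ?sub0r ?subr0 ?mulN1r ?mul1r.
Qed.

Definition form_mulr (p : bool) (y : A) (f : A -> K) (x : A) : K :=
  f (parity_twist p x * y).

Lemma linear_form_mulr p y f : linear_form f -> linear_form (form_mulr p y f).
Proof.
move=> [fD fZ]; split=> [x x'|k x]; rewrite /form_mulr.
  by rewrite parity_twistD mulrDl fD.
by rewrite parity_twistZ -mulrA fZ.
Qed.

Section Convolution.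
Variable beta : {rmorphism A -> seqop K}.
Hypothesis beta_salg : forall k, beta (salg k) = seqop_const k.

(* Composed with Delta, this is the convolution of the linear forms
   x |-> (beta x phi) 0 and f. *)
Definition conv (phi : int -> K) (f : A -> K) : A ⊗ A -> K :=
  tens_lift (fun x y => beta x phi 0 * f y).

Section Conv.
Variable f : A -> K.
Hypothesis f_lin : linear_form f.

Lemma conv_balanced phi : balanced (fun x y : A => beta x phi 0 * f y).
Proof.
have [fD fZ] := f_lin; split=> [x y y'|y x x'|k x y] /=.
- by rewrite fD mulrDr.
- by rewrite rmorphD /= mulrDl.
- by rewrite rmorphM beta_salg /= fZ mulrA [k * _]mulrC -!mulrA.
Qed.

Lemma convE phi x y : conv phi f (x ⊗ y) = beta x phi 0 * f y.
Proof. exact: tens_liftE (conv_balanced phi) x y. Qed.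

Lemma convD phi : {morph conv phi f : x y / x + y}.
Proof. exact: tens_liftD (conv_balanced phi). Qed.

Lemma conv0 phi : conv phi f 0 = 0.
Proof. exact: tens_lift0 (conv_balanced phi). Qed.

Lemma conv_sum phi (I : Type) (s : seq I) (P : pred I) F :
  conv phi f (\sum_(i <- s | P i) F i) = \sum_(i <- s | P i) conv phi f (F i).
Proof. exact: (big_morph _ (convD phi) (conv0 phi)). Qed.

Lemma convZ phi k z : conv phi f (salg k * z) = k * conv phi f z.
Proof.
elim/tens_ind: z => [|x y|z z' e e']; first by rewrite mulr0 conv0 mulr0.
  by rewrite tens_salgZ !convE rmorphM beta_salg mulrA.
by rewrite mulrDr !convD mulrDr e e'.
Qed.

Lemma conv_scale phi k z : conv (fun n => k * phi n) f z = k * conv phi f z.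
Proof.
elim/tens_ind: z => [|x y|z z' e e']; first by rewrite !conv0 mulr0.
  by rewrite !convE seqopZ mulrA.
by rewrite !convD mulrDr e e'.
Qed.

Lemma conv_0 z : conv (fun=> 0) f z = 0.
Proof.
have -> : (fun=> 0) = (fun n : int => 0 * (0 : K)) by apply/funext => n; rewrite mul0r.
by rewrite conv_scale mul0r.
Qed.

End Conv.

(** Since [beta (x * c) phi = beta x (beta c phi)], a factor on the right is absorbed into the
    sequence and the form. Words are therefore consumed from their last letter. *)
Lemma conv_mulr phi f p c y z : linear_form f -> spart p c = c ->
  conv phi f (z * (c ⊗ y)) = conv (beta c phi) (form_mulr p y f) z.
Proof.
move=> f_lin hc; have g_lin := linear_form_mulr p y f_lin.
elim/tens_ind_hom: z => [|i j x x' hx hx'|z z' e e'].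
- by rewrite mul0r !conv0.
- rewrite (tens_mulE _ _ hx' hc) !convE // /form_mulr (parity_twist_hom p hx').
  have -> : (-1) ^+ (p && j) = salg ((-1) ^+ (p && j)) :> A by rewrite rmorphXn rmorphN1.
  rewrite -mulrA (proj2 f_lin) !rmorphM beta_salg /= [j && p]andbC.
  by rewrite mulrCA mulrA.
- by rewrite mulrDl !convD // e e'.
Qed.

End Convolution.

End Comultiplication.

(** * One lowering step on a single letter *)

Section Steps.
Variables (R : realType) (A : superAlgType (Cq R)) (a : 'I_5 -> 'I_5 -> A).
Hypothesis a_rel : forall y, Mq_relator a y -> y = 0.
Hypothesis a_hom : forall i j, spart (gen_parity i j) (a i j) = a i j.
Variable Delta : {supermorphism A -> A ⊗ A}.
Hypothesis Delta_a : forall i j, Delta (a i j) = \sum_(k < 5) a i k ⊗ a k j.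
Local Notation K := (Cq R).
Local Notation m12 := (qminor12 a).
Local Notation Dword := (Dword a).
Local Notation Dminor := (Dminor a).
Local Notation sgn k j l := ((-1) ^+ (idx_parity k && gen_parity j l) : K).
Local Notation delta e := (seq_delta K (Posz e)).

Lemma unit_of_sign n : unit_of ((-1) ^+ n : K).
Proof. exact/unit_ofX/unit_ofN1. Qed.

Section LowerStep.
Variables (r : nat) (beta : {rmorphism A -> seqop K}).
Hypothesis r4 : (r < 4)%N.
Hypothesis beta_salg : forall k, beta (salg k) = seqop_const k.
Hypothesis beta_a : forall i j, beta (a i j) = bidiag (lower_d R r) r (lower_x R r) i j.
Local Notation conv := (conv beta).

Definition step_ok (e : nat) : bool := (0 < e)%N && ((r == 3%N) ==> (e == 1%N)).

Lemma beta_diag i e : exists2 u, unit_of u &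
  beta (a i i) (delta e) = fun n => u * delta e n.
Proof. by rewrite beta_a /bidiag eqxx; apply: lower_d_delta. Qed.

Lemma beta_sub (i k : 'I_5) e : i = r.+1 :> nat -> k = r :> nat ->
  beta (a i k) (delta e) = if step_ok e then delta e.-1 else fun=> 0.
Proof.
move=> ir kr; have nik : (i == k) = false by rewrite -val_eqE /= ir kr; lia.
by rewrite beta_a /bidiag nik ir kr !eqxx lower_x_delta.
Qed.

Let G f z e (i j : 'I_5) (u : 'I_5 * 'I_5) : K :=
  sgn u.1 j u.2 * conv (beta (a i u.1) (beta (a j u.2) (delta e)))
    (form_mulr (gen_parity i u.1 (+) gen_parity j u.2) (m12 u.1 u.2) f) z.

Lemma conv_Delta_m12 f z e i j : linear_form f ->
  conv (delta e) f (z * Delta (m12 i j)) = \sum_u G f z e i j u.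
Proof.
move=> f_lin; rewrite (Delta_m12 a_hom Delta_a) mulr_sumr (conv_sum beta_salg) //.
rewrite -(pair_bigA _ (fun k l => G f z e i j (k, l))); apply: eq_bigr => k _.
rewrite mulr_sumr (conv_sum beta_salg) //; apply: eq_bigr => l _.
have hc : spart (gen_parity i k (+) gen_parity j l) (a i k * a j l) = a i k * a j l.
  exact: spart_homM.
rewrite -tens_salgZ -salgA (convZ beta_salg) // (conv_mulr beta_salg _ _ _ f_lin hc).
by rewrite rmorphM.
Qed.

(** Either one of the two matrix entries lies off the two diagonals, or an even row is repeated in
    the minor. *)
Lemma G_eq0 f z e (i j k l : 'I_5) : linear_form f ->
  (k != i :> nat) && ~~ ((i == r.+1 :> nat) && (k == r :> nat)) ||
  (l != j :> nat) && ~~ ((j == r.+1 :> nat) && (l == r :> nat)) ||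
  (k == l :> nat) && (k < 4)%N -> G f z e i j (k, l) = 0.
Proof.
move=> f_lin cond; rewrite /G /=.
have g_lin := linear_form_mulr (gen_parity i k (+) gen_parity j l) (m12 k l) f_lin.
have b0 (m n : 'I_5) : (n != m :> nat) && ~~ ((m == r.+1 :> nat) && (n == r :> nat)) ->
    beta (a m n) = 0.
  by move=> mn; rewrite beta_a bidiag_eq0 //; lia.
case/orP: cond => [/orP[/b0 ->|/b0 ->]|/andP[/eqP/val_inj<- k4]].
- by rewrite (conv_0 beta_salg g_lin) mulr0.
- rewrite (_ : beta (a i k) _ = fun=> 0); last by apply/funext => n; apply: seqop0.
  by rewrite (conv_0 beta_salg g_lin) mulr0.
- have -> : form_mulr (gen_parity i k (+) gen_parity j k) (m12 k k) f = fun=> 0.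
    by apply/funext => x; rewrite /form_mulr (qminor12_eq0 a_rel k4) mulr0 linear_form0.
  have zero_lin : @linear_form R A (fun=> 0).
    by split=> [x y|c x]; rewrite ?addr0 ?mulr0.
  have -> : conv (beta (a i k) (beta (a j k) (delta e))) (fun=> 0) z = 0.
    elim/tens_ind: z => [|x y|x y ex ey]. exact: (conv0 beta_salg zero_lin).
      by rewrite (convE beta_salg zero_lin) mulr0.
    by rewrite (convD beta_salg zero_lin) ex ey addr0.
  by rewrite mulr0.
Qed.

Lemma G_diag i j e : exists2 u, unit_of u & forall f z, linear_form f ->
  G f z e i j (i, j) = u * conv (delta e) (form_mulr false (m12 i j) f) z.
Proof.
have [u uu eu] := beta_diag j e; have [v vu ev] := beta_diag i e.
exists (sgn i j j * (u * v)); first exact/unit_ofM/unit_ofM/vu/uu/unit_of_sign.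
move=> f z f_lin; have g_lin p := linear_form_mulr p (m12 i j) f_lin.
rewrite /G /= eu (_ : beta (a i i) _ = fun n => (u * v) * delta e n).
  by rewrite (conv_scale beta_salg) // /gen_parity !addbb mulrA.
by apply/funext => n; rewrite seqopZ ev mulrA.
Qed.

Lemma gen_parity_sub (i k : 'I_5) : i = r.+1 :> nat -> k = r :> nat ->
  gen_parity i k = (r == 3%N).
Proof.
by move=> ir kr; rewrite /gen_parity /idx_parity -!val_eqE /= ir kr eqSS; lia.
Qed.

Lemma G_row (i j k : 'I_5) e : i = r.+1 :> nat -> k = r :> nat ->
  exists2 u, unit_of u & forall f z, linear_form f -> G f z e i j (k, j) =
    if step_ok e then u * conv (delta e.-1) (form_mulr (r == 3%N) (m12 k j) f) z else 0.
Proof.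
move=> ir kr; have [u uu eu] := beta_diag j e.
exists (sgn k j j * u); first exact/unit_ofM/uu/unit_of_sign.
move=> f z f_lin; have g_lin p := linear_form_mulr p (m12 k j) f_lin.
rewrite /G /= eu [gen_parity j j]addbb addbF gen_parity_sub //.
rewrite (_ : beta (a i k) _ = fun n => u * beta (a i k) (delta e) n).
  rewrite (conv_scale beta_salg) // beta_sub //; case: ifP => _; first by rewrite mulrA.
  by rewrite (conv_0 beta_salg) // !mulr0.
by apply/funext => n; rewrite seqopZ.
Qed.

Lemma G_col (i j l : 'I_5) e : j = r.+1 :> nat -> l = r :> nat ->
  exists2 u, unit_of u & forall f z, linear_form f -> G f z e i j (i, l) =
    if step_ok e then u * conv (delta e.-1) (form_mulr (r == 3%N) (m12 i l) f) z else 0.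
Proof.
move=> jr lr; have [u uu eu] := beta_diag i e.-1.
exists (sgn i j l * u); first exact/unit_ofM/uu/unit_of_sign.
move=> f z f_lin; have g_lin p := linear_form_mulr p (m12 i l) f_lin.
rewrite /G /= [gen_parity i i]addbb addFb gen_parity_sub // beta_sub //; case: ifP => _.
  by rewrite eu (conv_scale beta_salg) // mulrA.
rewrite (_ : beta (a i i) _ = fun=> 0); last by apply/funext => n; apply: seqop0.
by rewrite (conv_0 beta_salg) // mulr0.
Qed.

(** The two terms are the parts of degree 0 and 1 in x; the second uses up one factor, whence
    [e.-1]. *)
Definition letter_expansion (l : minor) (e : nat) : Prop :=
  exists u0 u1, [/\ unit_of u0, unit_of u1 & forall f z, linear_form f ->
    conv (delta e) f (z * Delta (Dminor l)) =
      u0 * conv (delta e) (form_mulr false (Dminor l) f) z +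
      (if lowers r l && step_ok e then
         u1 * conv (delta e.-1) (form_mulr (r == 3%N) (Dminor (lower_minor r l)) f) z
       else 0)].

(** Only one of the rows i < j can be r + 1, so at most one term other than the diagonal one
    survives. If i = r and j = r + 1 it would have the even row r twice and vanishes too. *)
Lemma letter_expansion_lt (i j : 'I_5) e : (i < j)%N ->
  letter_expansion (i : nat, j : nat) e.
Proof.
move=> ij; have DE (k l : 'I_5) : (k < l)%N -> Dminor (k : nat, l : nat) = m12 k l.
  by move=> kl; rewrite Dminor_qminor12 ?inord_val //; lia.
have [u0 u0u G0] := G_diag i j e.
have ltj := ltn_ord j.
have rest f z (P : pred ('I_5 * 'I_5)) : linear_form f ->
    (forall k l : 'I_5, P (k, l) ->
      (k != i :> nat) && ~~ ((i == r.+1 :> nat) && (k == r :> nat)) ||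
      (l != j :> nat) && ~~ ((j == r.+1 :> nat) && (l == r :> nat)) ||
      (k == l :> nat) && (k < 4)%N) -> \sum_(u | P u) G f z e i j u = 0.
  by move=> f_lin Pn; apply: big1 => -[k l] /Pn; apply: G_eq0.
have ne (k l m n : 'I_5) : ((k, l) != (m, n)) = (k != m :> nat) || (l != n :> nat).
  by rewrite xpair_eqE negb_and -!val_eqE.
have [ir|nir] := eqVneq (i : nat) r.+1.
  have r5 : (r < 5)%N by lia.
  have [u1 u1u G1] := G_row j e ir (erefl : Ordinal r5 = r :> nat).
  exists u0, u1; split=> // f z f_lin.
  rewrite DE // conv_Delta_m12 // (bigD1 (i, j)) //= G0 //; congr (_ + _).
  rewrite (bigD1 (Ordinal r5, j)) /=; last by rewrite ne /=; lia.
  rewrite G1 // rest // ?addr0; last first.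
    by move=> k l; rewrite !ne /=; lia.
  rewrite /lowers /lower_minor /= ir eqxx /=.
  by rewrite -[(r, _)]/(Ordinal r5 : nat, j : nat) DE //=; lia.
have [/andP[/eqP jr nr]|nm] := boolP ((j == r.+1 :> nat) && (i != r :> nat)).
  have r5 : (r < 5)%N by lia.
  have [u1 u1u G1] := G_col i e jr (erefl : Ordinal r5 = r :> nat).
  exists u0, u1; split=> // f z f_lin.
  rewrite DE // conv_Delta_m12 // (bigD1 (i, j)) //= G0 //; congr (_ + _).
  rewrite (bigD1 (i, Ordinal r5)) /=; last by rewrite ne /=; lia.
  rewrite G1 // rest // ?addr0; last first.
    by move=> k l; rewrite !ne /=; lia.
  rewrite /lowers /lower_minor /= jr eqxx (negbTE nir) nr /=.
  by rewrite -[(_, r)]/(i : nat, Ordinal r5 : nat) DE //=; lia.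
(* No row is lowered here, so the second term is 0 and 1 is a placeholder. *)
exists u0, 1; split=> // [|f z f_lin]; first exact: unit_of1.
rewrite DE // conv_Delta_m12 // (bigD1 (i, j)) //= G0 //; congr (_ + _).
rewrite rest // => [|k l]; last by rewrite ne /=; lia.
by rewrite /lowers /= (negbTE nir) (negbTE nm).
Qed.

(** For r = 3 either of the equal rows can be lowered; [Delta_D44] has already merged both ways into
    the single pair (3, 4), whose coefficient is a unit. *)
Lemma letter_expansion44 e : letter_expansion (4, 4)%N e.
Proof.
have [u uu eu] := beta_diag ord_max e.
have u2E : beta (a ord_max ord_max) (beta (a ord_max ord_max) (delta e)) =
    fun n => (u * u) * delta e n.
  by rewrite eu; apply/funext => n; rewrite seqopZ eu mulrA.
have movesE : lowers r (4, 4)%N = (r == 3%N) by rewrite /lowers /=; lia.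
have term f z (k l : 'I_5) : linear_form f ->
    conv (delta e) f (z * ((a ord_max k * a ord_max l) ⊗ m12 k l)) =
    conv (beta (a ord_max k) (beta (a ord_max l) (delta e)))
      (form_mulr (gen_parity ord_max k (+) gen_parity ord_max l) (m12 k l) f) z.
  move=> f_lin; have hc : spart (gen_parity ord_max k (+) gen_parity ord_max l)
      (a ord_max k * a ord_max l) = a ord_max k * a ord_max l by exact: spart_homM.
  by rewrite (conv_mulr beta_salg _ _ _ f_lin hc) rmorphM.
have term0 f z (k l : 'I_5) : linear_form f -> (k < l)%N ->
    ~~ ((r == 3%N) && (k == 3%N :> nat) && (l == 4%N :> nat)) ->
    conv (delta e) f (z * ((a ord_max k * a ord_max l) ⊗ m12 k l)) = 0.
  move=> f_lin kl nkl; rewrite term //.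
  set p := gen_parity _ _ (+) _; have g_lin := linear_form_mulr p (m12 k l) f_lin.
  have ltl := ltn_ord l.
  have [l4|nl4] := eqVneq (l : nat) 4%N.
    rewrite [beta (a ord_max k)]beta_a bidiag_eq0 /=; try lia.
    exact: (conv_0 beta_salg g_lin).
  rewrite (_ : beta (a ord_max k) _ = fun=> 0) ?(conv_0 beta_salg g_lin) //.
  apply/funext => n; have [k3 | nk3] := eqVneq (k : nat) r.
    rewrite [beta (a ord_max l)]beta_a bidiag_eq0 /=; try lia.
    exact: seqop0.
  by rewrite [beta (a ord_max k)]beta_a bidiag_eq0 //=; lia.
have diag f z : linear_form f ->
    conv (delta e) f (z * ((a ord_max ord_max * a ord_max ord_max) ⊗ Dminor (4, 4)%N)) =
    (u * u) * conv (delta e) (form_mulr false (Dminor (4, 4)%N) f) z.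
  move=> f_lin; have g_lin := linear_form_mulr false (Dminor (4, 4)%N) f_lin.
  have hc : spart false (a ord_max ord_max * a ord_max ord_max) =
      a ord_max ord_max * a ord_max ord_max.
    by rewrite -(addbb (gen_parity ord_max ord_max)); apply: spart_homM.
  by rewrite (conv_mulr beta_salg _ _ _ f_lin hc) rmorphM seqop_mulE u2E (conv_scale beta_salg g_lin).
have [r3|nr3] := eqVneq r 3%N; last first.
  exists (u * u), 1; split=> [||f z f_lin]; [exact: unit_ofM|exact: unit_of1|].
  rewrite (Delta_D44 a_rel a_hom Delta_a) mulrDr (convD beta_salg) // diag //; congr (_ + _).
  rewrite movesE (negbTE nr3) /= mulr_sumr (conv_sum beta_salg) // big1 // => k _.
  rewrite mulr_sumr (conv_sum beta_salg) // big1 // => l kl.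
  by rewrite term0 // (negbTE nr3).
have i3 : (3 < 5)%N by [].
exists (u * u), u; split=> [||f z f_lin]; [exact: unit_ofM|exact: uu|].
rewrite (Delta_D44 a_rel a_hom Delta_a) mulrDr (convD beta_salg) // diag //; congr (_ + _).
rewrite movesE r3 eqxx /= mulr_sumr (conv_sum beta_salg) //.
rewrite (bigD1 (Ordinal i3)) //= [X in _ + X]big1 ?addr0 => [|k nk].
  rewrite mulr_sumr (conv_sum beta_salg) //.
  rewrite (bigD1 ord_max) //= [X in _ + X]big1 ?addr0 => [|l /andP[kl nl]].
    rewrite term // [X in form_mulr X](_ : _ = true) //.
    rewrite eu (_ : beta (a _ (Ordinal i3)) _ = fun n => u * beta (a ord_max (Ordinal i3)) (delta e) n); last first.
      by apply/funext => n; rewrite seqopZ.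
    have g_lin := linear_form_mulr true (m12 (Ordinal i3) ord_max) f_lin.
    rewrite (conv_scale beta_salg g_lin) beta_sub ?r3 //; case: ifP => _.
      by rewrite /lower_minor /= Dminor_qminor12 // inord4 (_ : inord 3 = Ordinal i3) //; apply: val_inj; rewrite /= inordK.
    by rewrite (conv_0 beta_salg g_lin) mulr0.
  rewrite term0 // r3 /=; move: nl; rewrite -val_eqE /=; lia.
rewrite mulr_sumr (conv_sum beta_salg) // big1 // => l kl.
by rewrite term0 // r3 /=; move: nk; rewrite -val_eqE /= => /negbTE ->.
Qed.

Lemma letter_expansionP l e : l \in minors -> letter_expansion l e.
Proof.
case/minorsP => [|->]; last exact: letter_expansion44.
case: l => i j /andP[/= ij j5]; have i5 : (i < 5)%N by lia.
exact: (@letter_expansion_lt (Ordinal i5) (Ordinal j5)).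
Qed.

End LowerStep.

End Steps.

Import Order.Theory.

(** * Lowering whole words, and the separating forms *)

Section Separation.
Variables (R : realType) (A : superAlgType (Cq R)) (a : 'I_5 -> 'I_5 -> A).
Hypothesis a_rel : forall y, Mq_relator a y -> y = 0.
Hypothesis a_hom : forall i j, spart (gen_parity i j) (a i j) = a i j.
Variable Delta : {supermorphism A -> A ⊗ A}.
Hypothesis Delta_a : forall i j, Delta (a i j) = \sum_(k < 5) a i k ⊗ a k j.
Variable eps : {supermorphism A -> (Cq R)^o}.
Hypothesis eps_a : forall i j, eps (a i j) = (i == j)%:R.
Local Notation K := (Cq R).
Local Notation m12 := (qminor12 a).
Local Notation Dword := (Dword a).
Local Notation Dminor := (Dminor a).
Local Notation delta e := (seq_delta K (Posz e)).

Definition minor_word_parity (w : seq minor) : bool := \big[addb/false]_(l <- w) minor_parity l.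

Lemma spart_Dword w : minor_word w ->
  spart (minor_word_parity w) (Dword w) = Dword w.
Proof.
elim: w => [_|l w IHw /= /andP[lin /IHw{}IHw]].
  by rewrite /minor_word_parity /Dword !big_nil spart1.
rewrite /minor_word_parity big_cons Dword_cons; apply: spart_homM => //.
exact: spart_Dminor.
Qed.

Lemma Dword_rcons w l : Dword (rcons w l) = Dword w * Dminor l.
Proof. by rewrite -cats1 Dword_cat [X in _ * X]big_seq1. Qed.

Lemma minor_word_lower r w : (r < 4)%N -> minor_word w -> minor_word (map (lower_minor r) w).
Proof.
by move=> r4; rewrite /minor_word all_map; apply: sub_all => l; apply: lower_minor_in.
Qed.

Section LowerStep.
Variables (r : nat) (beta : {rmorphism A -> seqop K}).
Hypothesis r4 : (r < 4)%N.
Hypothesis beta_salg : forall k, beta (salg k) = seqop_const k.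
Hypothesis beta_a : forall i j, beta (a i j) = bidiag (lower_d R r) r (lower_x R r) i j.
Local Notation conv := (conv beta).

(** Each letter that [lowers r] accepts absorbs at most one factor x and the others absorb none.
    When e is the number of these letters, all of them must be lowered and a single term is left. *)
Lemma conv_word w e : minor_word w ->
  ((count (lowers r) w < e)%N ->
    forall f, linear_form f -> conv (delta e) f (Delta (Dword w)) = 0) /\
  (e = count (lowers r) w -> (r = 3%N -> (e <= 1)%N) ->
    exists2 u, unit_of u & forall f, linear_form f ->
      conv (delta e) f (Delta (Dword w)) = u * f (Dword (map (lower_minor r) w))).
Proof.
elim/last_ind: w e => [|w l IHw] e /=.
  move=> _; have E f : linear_form f -> conv (delta e) f (Delta (Dword [::])) =
      (e == 0%N)%:R * f (Dword [::]).
    move=> f_lin; rewrite [Dword _]big_nil rmorph1 (convE beta_salg) // rmorph1.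
    by rewrite /seq_delta /= eq_sym.
  split=> [e0 f f_lin|e0 _]; first by rewrite E // gtn_eqF ?mul0r.
  by exists 1 => [|f f_lin]; [exact: unit_of1 | rewrite E // e0].
rewrite /minor_word all_rcons => /andP[lin ww].
have [u0 [u1 [u0u u1u exp]]] :=
  letter_expansionP a_rel a_hom Delta_a r4 beta_salg beta_a e lin.
have {}exp f : linear_form f -> conv (delta e) f (Delta (Dword (rcons w l))) =
      u0 * conv (delta e) (form_mulr false (Dminor l) f) (Delta (Dword w)) +
      (if lowers r l && step_ok r e then
         u1 * conv (delta e.-1) (form_mulr (r == 3%N) (Dminor (lower_minor r l)) f)
           (Delta (Dword w))
       else 0).
  by move=> f_lin; rewrite Dword_rcons rmorphM /= exp.
have lin_m p y f (f_lin : linear_form f) := linear_form_mulr p y f_lin.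
have -> : count (lowers r) (rcons w l) = (count (lowers r) w + lowers r l)%N.
  by rewrite -cats1 count_cat /= addn0.
rewrite map_rcons.
case: (boolP (lowers r l)) exp => [ml|nml] exp.
  rewrite addn1; split=> [lte f f_lin|ee e1].
    rewrite exp // (proj1 (IHw e ww)) ?mulr0 ?add0r; [|lia|exact: lin_m].
    case: ifP => //= _; rewrite (proj1 (IHw e.-1 ww)) ?mulr0 //; [lia|exact: lin_m].
  have [u uu eu] := proj2 (IHw e.-1 ww) (ltac:(lia)) (ltac:(lia)).
  have hw := spart_Dword (minor_word_lower r4 ww).
  (* For r = 3 the entry x is odd, and the sign comes from its passing the lowered word. *)
  exists (u1 * (u * (-1) ^+ ((r == 3%N) && minor_word_parity (map (lower_minor r) w)))).
    by apply/unit_ofM/unit_ofM/unit_of_sign.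
  (* Leaving the last letter unchanged would ask e factors x of a word with only e - 1 letters to
     lower. *)
  move=> f f_lin; rewrite exp // (proj1 (IHw e ww)) ?mulr0 ?add0r; [|lia|exact: lin_m].
  have -> : step_ok r e by rewrite /step_ok; lia.
  rewrite /= eu; last exact: lin_m.
  rewrite /form_mulr (parity_twist_hom _ hw) Dword_rcons -!mulrA; congr (_ * (_ * _)).
  rewrite -(proj2 f_lin); congr f.
  by rewrite rmorphXn rmorphN1 mulrA.
rewrite addn0; split=> [lte f f_lin|ee e1].
  by rewrite exp // (proj1 (IHw e ww)) ?mulr0 ?add0r //; exact: lin_m.
have [u uu eu] := proj2 (IHw e ww) ee e1.
exists (u0 * u) => [|f f_lin]; first exact: unit_ofM.
rewrite exp //= addr0 eu ?mulrA; last exact: lin_m.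
have -> : lower_minor r l = l.
  by move: nml; rewrite /lowers /lower_minor; case: ifP => //= _; case: ifP.
by rewrite Dword_rcons.
Qed.

End LowerStep.

Lemma eps_linear : linear_form eps.
Proof.
by split=> [x y|k x]; rewrite ?raddfD // rmorphM /= supermorph_salg.
Qed.

Lemma eps_D01 : eps (Dminor (0, 1)%N) = 1.
Proof.
rewrite Dminor_qminor12 // rmorphB !rmorphM /= !eps_a.
by rewrite -!val_eqE /= !inordK //= mul0r mulr0 subr0 mulr1.
Qed.

Section TorusStep.
Variable beta : {rmorphism A -> seqop K}.
Hypothesis beta_salg : forall k, beta (salg k) = seqop_const k.
Hypothesis beta_a : forall i j, beta (a i j) = if i == j then torus_d R i else 0.

(** For a diagonal matrix only the term with rows 0 and 1 remains, and its coefficient acts as one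
    shift. *)
Lemma conv_torus_D01 phi f z : linear_form f ->
  conv beta phi f (z * Delta (Dminor (0, 1)%N)) =
  conv beta (fun n => phi (n + 1)) (form_mulr false (Dminor (0, 1)%N) f) z.
Proof.
move=> f_lin; rewrite Dminor_qminor12 //; set i : 'I_5 := inord 0; set j : 'I_5 := inord 1.
have hc k l : spart (gen_parity i k (+) gen_parity j l) (a i k * a j l) = a i k * a j l.
  exact: spart_homM.
have termE k l : conv beta phi f
      (z * ((salg ((-1) ^+ (idx_parity k && gen_parity j l)) * (a i k * a j l)) ⊗ m12 k l)) =
    (-1) ^+ (idx_parity k && gen_parity j l) * conv beta (beta (a i k) (beta (a j l) phi))
      (form_mulr (gen_parity i k (+) gen_parity j l) (m12 k l) f) z.
  rewrite -tens_salgZ -salgA (convZ beta_salg) // (conv_mulr beta_salg _ _ _ f_lin (hc k l)).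
  by rewrite rmorphM.
have lin_m p y := linear_form_mulr p y f_lin.
rewrite (Delta_m12 a_hom Delta_a) mulr_sumr (conv_sum beta_salg) // (bigD1 i) //=.
rewrite [X in _ + X]big1 ?addr0 => [|k nk]; last first.
  rewrite mulr_sumr (conv_sum beta_salg) // big1 // => l _.
  by rewrite termE beta_a eq_sym (negbTE nk) (conv_0 beta_salg) ?mulr0.
rewrite mulr_sumr (conv_sum beta_salg) // (bigD1 j) //= [X in _ + X]big1 ?addr0 => [|l nl].
  rewrite termE !beta_a !eqxx /gen_parity !addbb andbF expr0 mul1r.
  congr (conv _ _ _ _); apply/funext => n.
  by rewrite /torus_d /i /j !inordK //= mul1r.
rewrite termE [beta (a j l)]beta_a eq_sym (negbTE nl).
rewrite (_ : beta _ _ = fun=> 0) ?(conv_0 beta_salg) ?mulr0 //.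
by apply/funext => n; apply: seqop0.
Qed.

Lemma conv_torus phi m f : linear_form f ->
  conv beta phi f (Delta (Dword (nseq m (0, 1)%N))) =
  phi (Posz m) * f (Dword (nseq m (0, 1)%N)).
Proof.
elim: m phi f => [|m IHm] phi f f_lin.
  by rewrite [Dword _]big_nil rmorph1 (convE beta_salg) // rmorph1.
rewrite -[in Dword _]addn1 nseqD cats1 Dword_rcons rmorphM /= conv_torus_D01 // IHm.
  by rewrite -PoszD addn1.
exact: linear_form_mulr.
Qed.

End TorusStep.

Section StepForms.
Hypothesis lower : forall r, (r < 4)%N -> exists beta : {rmorphism A -> seqop K},
    (forall k, beta (salg k) = seqop_const k) /\
    (forall i j, beta (a i j) = bidiag (lower_d R r) r (lower_x R r) i j).
Hypothesis torus : exists beta : {rmorphism A -> seqop K},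
    (forall k, beta (salg k) = seqop_const k) /\
    (forall i j, beta (a i j) = if i == j then torus_d R i else 0).

Lemma conv_Delta_linear (beta : {rmorphism A -> seqop K}) phi f :
  (forall k, beta (salg k) = seqop_const k) -> linear_form f ->
  linear_form (fun x => conv beta phi f (Delta x)).
Proof.
move=> beta_salg f_lin; split=> [x y|k x].
  by rewrite raddfD /= (convD beta_salg).
by rewrite rmorphM /= supermorph_salg (convZ beta_salg).
Qed.

Lemma eps_Dword_nseq m : eps (Dword (nseq m (0, 1)%N)) = 1.
Proof.
elim: m => [|m IHm]; first by rewrite [Dword _]big_nil rmorph1.
by rewrite Dword_cons rmorphM /= IHm eps_D01 mulr1.
Qed.

(** The forms are built backwards: the last one is the counit after the torus, reading the length,
    and each step r with exponent e convolves with a point mass at e. Exponents above e are not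
    controlled, which is why keys are compared lexicographically. *)
Lemma key_form (rs es : seq nat) (n : nat) :
  all (fun r => r < 4)%N rs -> size es = size rs ->
  all (fun u => (u.1 == 3%N) ==> (u.2 <= 1)%N) (zip rs es) ->
  exists2 f, linear_form f & forall w, minor_word w ->
    {in w, forall l, foldl (fun l r => lower_minor r l) l rs = (0, 1)%N} ->
    (key rs w = rcons es n -> unit_of (f (Dword w))) /\
    ((key rs w : seqlexi nat) < (rcons es n : seqlexi nat) -> f (Dword w) = 0)%O.
Proof.
elim: rs es => [|r rs IHrs] [|e es] //= => [_ _ _|/andP[r4 rs4] [ses] /andP[e1 rse1]].
  have [beta [beta_salg beta_a]] := torus.
  exists (fun x => conv beta (delta n) eps (Delta x)).
    exact/conv_Delta_linear/eps_linear.
  move=> w ww w01; have -> : w = nseq (size w) (0, 1)%N.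
    by apply/all_pred1P/allP => l /w01 ->.
  rewrite size_nseq conv_torus //; last exact: eps_linear.
  rewrite eps_Dword_nseq mulr1 /seq_delta.
  split=> [[->]|]; first by rewrite eqxx; exact: unit_of1.
  rewrite ltxi_cons => /andP[le lt]; case: eqP => //= -[en].
  by move: lt; rewrite en lexx.
have [f f_lin fP] := IHrs es rs4 ses rse1.
have [beta [beta_salg beta_a]] := lower r4.
exists (fun x => conv beta (delta e) f (Delta x)); first exact: conv_Delta_linear.
move=> w ww w01.
have [c0 c1] := conv_word r4 beta_salg beta_a e ww.
have w01' : {in map (lower_minor r) w, forall l, foldl (fun l r => lower_minor r l) l rs = (0, 1)%N}.
  by move=> _ /mapP[l lw ->]; apply: w01.
have [f1 f0] := fP _ (minor_word_lower r4 ww) w01'.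
split=> [[ce ke]|].
  have [|u uu ->] := c1 (esym ce) _ => //; first by move=> r3; move: e1; rewrite r3.
  exact/unit_ofM/f1.
rewrite ltxi_cons => /andP[le lt].
case: (ltngtP (count (lowers r) w) e) => [cle|ecl|ce].
- exact: c0.
- by move: le; rewrite leNgt ltEnat /= ecl.
- have [|u uu ->] := c1 (esym ce) _ => //; first by move=> r3; move: e1; rewrite r3.
  by rewrite f0 ?mulr0 //; move: lt; rewrite ce lexx.
Qed.

Lemma standard_word_form w : standard_word w ->
  exists2 f, linear_form f & unit_of (f (Dword w)) /\
    forall v, standard_word v -> v != w ->
      ((key steps v : seqlexi nat) <= (key steps w : seqlexi nat))%O -> f (Dword v) = 0.
Proof.
move=> sw; have /andP[ww _] := sw.
have odd3 (P : pred minor) : all (fun l => P l ==> (l.2 == 4%N)) minors ->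
    (count P w <= 1)%N by exact: count_odd_le1.
have keyE : key steps w = rcons (take 7 (key steps w)) (size w).
  by rewrite /= !size_map.
have [|||f f_lin fP] := @key_form steps (take 7 (key steps w)) (size w).
- by [].
- by [].
(* The odd x is used in the first and the fifth step; in both, the letters lowered come from letters
   of w with second row 4. *)
- rewrite /= -!map_comp !count_map !andbT; apply/andP.
  by split; [exact: odd3 | apply: odd3; vm_compute].
have ends v : standard_word v ->
    {in v, forall l, foldl (fun l r => lower_minor r l) l steps = (0, 1)%N}.
  by move=> /andP[/allP vv _] l /vv; exact: steps_end.
exists f => //; split=> [|v sv nvw].
  by apply: (proj1 (fP w ww (ends _ sw))); exact: keyE.
rewrite le_eqVlt => /predU1P[/(key_inj sv sw)/eqP|]; first by rewrite (negbTE nvw).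
have /andP[vv _] := sv.
by rewrite keyE; apply: (proj2 (fP v vv (ends _ sv))).
Qed.

End StepForms.

End Separation.

(** * The coaction *)

Lemma max_key (s : seq (seq minor)) : s != [::] ->
  exists2 w, w \in s &
    {in s, forall v, ((key steps v : seqlexi nat) <= (key steps w : seqlexi nat))%O}.
Proof.
elim: s => // v [_ _|v' s IHs _].
  by exists v => [|v']; rewrite inE // => /eqP->.
have [//|w ws wmax] := IHs.
case: (leP (key steps v : seqlexi nat) (key steps w)) => [vw|/ltW wv].
  by exists w => [|v'']; rewrite inE ?ws ?orbT // => /predU1P[->|/wmax].
exists v => [|v'']; rewrite inE ?eqxx // => /predU1P[->|/wmax/le_trans]; last exact.
exact: lexx.
Qed.

Section Grassmannian.
Variables (R : realType) (A : superAlgType (Cq R)) (a : 'I_5 -> 'I_5 -> A).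
Hypothesis a_rel : forall y, Mq_relator a y -> y = 0.
Hypothesis a_hom : forall i j, spart (gen_parity i j) (a i j) = a i j.
Variable Delta : {supermorphism A -> A ⊗ A}.
Hypothesis Delta_a : forall i j, Delta (a i j) = \sum_(k < 5) a i k ⊗ a k j.
Variable eps : {supermorphism A -> (Cq R)^o}.
Hypothesis eps_a : forall i j, eps (a i j) = (i == j)%:R.
Hypothesis lower : forall r, (r < 4)%N -> exists beta : {rmorphism A -> seqop (Cq R)},
    (forall k, beta (salg k) = seqop_const k) /\
    (forall i j, beta (a i j) = bidiag (lower_d R r) r (lower_x R r) i j).
Hypothesis torus : exists beta : {rmorphism A -> seqop (Cq R)},
    (forall k, beta (salg k) = seqop_const k) /\
    (forall i j, beta (a i j) = if i == j then torus_d R i else 0).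
Variable G : A -> Prop.
Hypothesis GP : forall s, G s -> exists2 l, l \in minors & s = Dminor a l.
Hypothesis GD : forall l, l \in minors -> G (Dminor a l).
Local Notation K := (Cq R).
Local Notation m12 := (qminor12 a).
Local Notation Dword := (Dword a).
Local Notation Dminor := (Dminor a).
Local Notation Gr := (subsuper G).
Local Notation iota := (@sub_val _ _ G : {supermorphism Gr -> A}).

Lemma Dminor_subgen l : l \in minors -> Dminor l \in subgen G.
Proof. by move=> lin; apply/subgen_mem/GD. Qed.

Lemma Dword_subgen w : minor_word w -> Dword w \in subgen G.
Proof.
elim: w => [_|l w IHw /= /andP[lin /IHw{}IHw]].
  by rewrite [Dword _]big_nil rpred1.
by rewrite Dword_cons rpredM // Dminor_subgen.
Qed.

(** The default 0 does not occur for words in [minors], whose products lie in the subalgebra. *)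
Definition Grword (w : seq minor) : Gr := insubd 0 (Dword w).

Lemma Grword_val w : minor_word w -> sub_val (Grword w) = Dword w.
Proof. by move=> ww; apply: insubdK; apply: Dword_subgen. Qed.

(** * Injectivity after tensoring with an arbitrary superalgebra *)

Section Injectivity.
Variable H : superAlgType K.

Definition tens_words (s : seq (H * seq minor)) : H ⊗ Gr :=
  \sum_(u <- s) u.1 ⊗ Grword u.2.

Lemma tens_words_surj (z : H ⊗ Gr) :
  exists2 s, all (standard_word \o snd) s & z = tens_words s.
Proof.
elim/tens_ind: z => [|h x|z z' [s ss ->] [s' ss' ->]].
- by exists [::] => //; rewrite /tens_words big_nil.
- have [s ss sx] := subgen_standard_span a_rel a_hom GP (valP x).
  exists [seq (salg u.1 * h, u.2) | u <- s].
    by rewrite all_map; apply: sub_all ss.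
  have -> : x = \sum_(u <- s) salg u.1 * Grword u.2.
    apply: val_inj; rewrite [LHS]sx /lincomb -[RHS]/(iota _) raddf_sum.
    apply: eq_big_seq => u us; rewrite [RHS](rmorphM iota) [X in _ = _ * X]Grword_val //.
    by move: (allP ss _ us) => /andP[].
  rewrite tpure_sumr /tens_words big_map; apply: eq_bigr => u _.
  by rewrite tpureZ.
- exists (s ++ s'); first by rewrite all_cat ss.
  by rewrite /tens_words big_cat.
Qed.

(** The map id ⊗ f followed by the identification of H ⊗ K with H. *)
Definition form_eval (f : A -> K) : H ⊗ A -> H :=
  tens_lift (fun h y => salg (f y) * h).

Lemma form_eval_balanced f : linear_form f ->
  balanced (fun (h : H) (y : A) => salg (f y) * h).
Proof.
move=> [fD fZ]; split=> [h y y'|y h h'|k h y] /=.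
- by rewrite fD rmorphD mulrDl.
- by rewrite mulrDr.
- by rewrite fZ rmorphM -mulrA salgA.
Qed.

(* A linear form detecting a word of largest key kills all the other words of
   the sum, so the coefficient of that word vanishes. *)
Lemma tens_words_eq0 (s : seq (H * seq minor)) : all (standard_word \o snd) s ->
  \sum_(u <- s) u.1 ⊗ Dword u.2 = 0 :> H ⊗ A -> tens_words s = 0.
Proof.
have [n] := ubnP (size s); elim: n s => // n IHn s sn ss s0.
have [->|sN0] := eqVneq s [::]; first by rewrite /tens_words big_nil.
have [|w ws wmax] := @max_key (map snd s); first by case: (s) sN0.
have sw : standard_word w.
  by case/mapP: ws => u us ->; apply: (allP ss).
have [f f_lin [[v uv] f0]] :=
  standard_word_form a_rel a_hom Delta_a eps_a lower torus sw.
have coef0 : \sum_(u <- s | u.2 == w) u.1 = 0.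
  have /(congr1 (form_eval f)) := s0.
  have bal := form_eval_balanced f_lin.
  rewrite /form_eval (tens_lift0 bal) (big_morph _ (tens_liftD bal) (tens_lift0 bal)).
  rewrite (bigID (fun u => u.2 == w)) /= [X in _ + X]big_seq_cond.
  rewrite [X in _ + X]big1 ?addr0 => [|u /andP[us uw]].
    rewrite (eq_bigr (fun u => salg (f (Dword w)) * u.1)) => [|u /eqP uw]; last first.
      by rewrite (tens_liftE bal) uw.
    rewrite -mulr_sumr => /(congr1 (fun h => salg v * h)).
    by rewrite mulr0 mulrA -rmorphM uv rmorph1 mul1r.
  rewrite (tens_liftE bal) f0 ?rmorph0 ?mul0r //; first exact: (allP ss _ us).
  by apply: wmax; apply: map_f.
(* Generic in the target, since the same words are dropped from the sum over A and from the sum over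
   Gr. *)
have split_sum (B : superAlgType K) (g : seq minor -> B) :
    \sum_(u <- s) u.1 ⊗ g u.2 = \sum_(u <- [seq u <- s | u.2 != w]) u.1 ⊗ g u.2.
  rewrite (bigID (fun u => u.2 == w)) /=.
  rewrite [X in X + _](eq_bigr (fun u => u.1 ⊗ g w)) => [|u /eqP -> //].
  by rewrite -[X in X + _]big_filter -tpure_suml [X in X ⊗ _]big_filter coef0 tpure0l add0r big_filter.
rewrite /tens_words split_sum; apply: IHn.
- move: sn; rewrite ltnS; apply: leq_trans; rewrite size_filter -(count_predC (fun u => u.2 == w)).
  rewrite -[X in (X < _)%N]add0n ltn_add2r -has_count; apply/hasP.
  by case/mapP: ws => u us ew; exists u => //; apply/eqP.
- by rewrite all_filter; apply: sub_all ss => u /= ->; rewrite implybT.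
- by rewrite -split_sum.
Qed.

(** With H = A this makes the lift of Delta unique; H = A ⊗ A serves coassociativity. *)
Lemma tens_map_iota_inj : injective (tens_map (idfun : {supermorphism H -> H}) iota).
Proof.
move=> x y exy; apply/eqP; rewrite -subr_eq0; apply/eqP.
have : tens_map (idfun : {supermorphism H -> H}) iota (x - y) = 0.
  by rewrite raddfB /= exy subrr.
have [s ss ->] := tens_words_surj (x - y); rewrite raddf_sum /= => s0.
apply: tens_words_eq0 => //; rewrite -[RHS]s0; apply: eq_big_seq => u us.
rewrite tens_mapE; congr (_ ⊗ _); apply/esym/Grword_val.
by move: (allP ss _ us) => /andP[].
Qed.

End Injectivity.

(** The expansion of Delta on a q-minor runs over all pairs of rows, so pairs in decreasing order
    and repeated rows must be covered as well. *)
Lemma qminor12_subgen i j : m12 i j \in subgen G.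
Proof.
have lt_subgen (k l : 'I_5) : (k < l)%N -> m12 k l \in subgen G.
  move=> kl; have -> : m12 k l = Dminor (k : nat, l : nat).
    by rewrite Dminor_qminor12 ?inord_val //; lia.
  exact/Dminor_subgen/ltn_minors.
case: (ltngtP i j) => [|ji|/val_inj->]; first exact: lt_subgen.
  by rewrite (qminor12_swap a_rel ji) rpredN rpredM ?subgen_salg ?lt_subgen.
have [j4|j4] := ltnP j 4; first by rewrite (qminor12_eq0 a_rel j4) rpred0.
have -> : j = ord_max by apply/val_inj => /=; have := ltn_ord j; lia.
by rewrite (qminor12_odd a_rel) rpredM ?subgen_salg ?Dminor_subgen.
Qed.

Local Notation tens_iota := (tens_map (idfun : {supermorphism A -> A}) iota).

Lemma tens_iota_pure x y : y \in subgen G -> exists t, tens_iota t = x ⊗ y.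
Proof. by move=> Gy; exists (x ⊗ SubSuper Gy); rewrite tens_mapE. Qed.

Lemma tens_iota_sum (I : Type) (s : seq I) (P : pred I) (F : I -> A ⊗ A) :
  (forall i, P i -> exists t, tens_iota t = F i) ->
  exists t, tens_iota t = \sum_(i <- s | P i) F i.
Proof.
move=> PF; apply: (big_ind (fun y => exists t, tens_iota t = y)) => //.
  by exists 0; rewrite raddf0.
by move=> _ _ [t <-] [t' <-]; exists (t + t'); rewrite raddfD.
Qed.

Lemma Delta_Dminor_coideal l : l \in minors -> exists t, tens_iota t = Delta (Dminor l).
Proof.
case/minorsP => [|->]; last first.
  rewrite (Delta_D44 a_rel a_hom Delta_a).
  have [|t e] := @tens_iota_pure (a ord_max ord_max * a ord_max ord_max) (Dminor (4, 4)%N).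
    exact: Dminor_subgen.
  have [k _|t' e'] := @tens_iota_sum _ (index_enum 'I_5) xpredT
      (fun k => \sum_(l < 5 | (k < l)%N) (a ord_max k * a ord_max l) ⊗ m12 k l).
    by apply: tens_iota_sum => j _; apply/tens_iota_pure/qminor12_subgen.
  by exists (t + t'); rewrite raddfD /= e e'.
case: l => i j /andP[/= ij j5]; rewrite Dminor_qminor12; last by lia.
rewrite (Delta_m12 a_hom Delta_a); apply: tens_iota_sum => k _.
by apply: tens_iota_sum => l _; apply/tens_iota_pure/qminor12_subgen.
Qed.

Lemma Delta_coideal (x : Gr) : exists t, tens_iota t = Delta (sub_val x).
Proof.
case: x => x /= /asboolP; elim=> {x} [i s /GP[l lin ->]|k|x y _ [t e] _ [t' e']|x y _ [t e] _ [t' e']].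
- have [t e] := Delta_Dminor_coideal lin.
  by exists (spart i t); rewrite tens_map_spart e supermorph_spart.
- by exists (salg k); rewrite tens_map_salg supermorph_salg.
- by exists (t + t'); rewrite !raddfD /= e e'.
- by exists (t * t'); rewrite !rmorphM /= e e'.
Qed.

Definition coaction (x : Gr) : A ⊗ Gr := sval (cid (Delta_coideal x)).

Lemma coactionE x : tens_iota (coaction x) = Delta (sub_val x).
Proof. exact: svalP (cid (Delta_coideal x)). Qed.

Let inj := @tens_map_iota_inj A.

Fact coaction_is_zmod_morphism : zmod_morphism coaction.
Proof. by move=> x y; apply: inj; rewrite raddfB /= !coactionE -raddfB -raddfB. Qed.
Fact coaction_is_monoid_morphism : monoid_morphism coaction.
Proof.
by split=> [|x y]; apply: inj; rewrite ?rmorph1 ?rmorphM /= !coactionE;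
  rewrite -?rmorphM -?(rmorph1 Delta) -?rmorphM.
Qed.
Fact coaction_salg (k : K) : coaction (salg k) = salg k.
Proof. by apply: inj; rewrite coactionE !supermorph_salg. Qed.
Fact coaction_spart i x : coaction (spart i x) = spart i (coaction x).
Proof. by apply: inj; rewrite tens_map_spart !coactionE; exact: supermorph_spart. Qed.

HB.instance Definition _ :=
  GRing.isZmodMorphism.Build Gr (tens A Gr) coaction coaction_is_zmod_morphism.
HB.instance Definition _ :=
  GRing.isMonoidMorphism.Build Gr (tens A Gr) coaction coaction_is_monoid_morphism.
HB.instance Definition _ :=
  isSuperMorphism.Build K Gr (tens A Gr) coaction coaction_salg coaction_spart.

(** Elements of Gr_q are polynomials in the entries, free of D_1^-1 and D_2^-1. Hence
    coassociativity and the counit law hold on Gr_q as soon as they hold on the entries. *)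
Lemma rmorph_eq_subgen (X : pzRingType) (F1 F2 : {rmorphism A -> X}) :
  (forall k, F1 (salg k) = F2 (salg k)) -> (forall i j, F1 (a i j) = F2 (a i j)) ->
  forall x, x \in subgen G -> F1 x = F2 x.
Proof.
move=> Fk Fa x /asboolP.
elim=> {x} [i s /GP[l lin ->]|k|x y _ ex _ ey|x y _ ex _ ey]; last 3 first.
- exact: Fk.
- by rewrite !rmorphD /= ex ey.
- by rewrite !rmorphM /= ex ey.
rewrite (spart_hom i (spart_Dminor a_hom lin)); case: ifP => _; last by rewrite !rmorph0.
rewrite /Dminor /minor_eval; case: ifP => _; first by rewrite !rmorphM /= !Fa.
by rewrite !rmorphB !rmorphM /= !Fa !Fk.
Qed.

Local Notation idA B := (idfun : {supermorphism B -> B}).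

Lemma Delta_coassoc x : x \in subgen G ->
  tens_assoc (tens_map Delta (idA A) (Delta x)) = tens_map (idA A) Delta (Delta x).
Proof.
apply: (@rmorph_eq_subgen _
  (@tens_assoc _ A A A \o tens_map Delta (idA A) \o Delta)
  (tens_map (idA A) Delta \o Delta)) => [k|i j] /=.
  rewrite !supermorph_salg.
  by rewrite [LHS]tens_assocE.
rewrite !Delta_a (raddf_sum (tens_map Delta _)) (raddf_sum (@tens_assoc _ A A A)).
rewrite (raddf_sum (tens_map _ Delta)) /=.
transitivity (\sum_(k < 5) \sum_(l < 5) a i l ⊗ (a l k ⊗ a k j)).
  apply: eq_bigr => k _; rewrite tens_mapE /= Delta_a tpure_suml.
  by rewrite (raddf_sum (@tens_assoc _ A A A)); apply: eq_bigr => l _; rewrite /= tens_assocE.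
rewrite exchange_big; apply: eq_bigr => l _ /=.
by rewrite tens_mapE /= Delta_a tpure_sumr.
Qed.

Lemma Delta_counit x : x \in subgen G ->
  tens_unitl (tens_map eps (idA A) (Delta x)) = x.
Proof.
apply: (@rmorph_eq_subgen _
  (@tens_unitl _ A \o tens_map eps (idA A) \o Delta) idfun) => [k|i j] /=.
  by rewrite !supermorph_salg [LHS]tens_unitlE mulr1.
rewrite Delta_a (raddf_sum (tens_map eps _)) (raddf_sum (@tens_unitl _ A)) (bigD1 i) //= big1 ?addr0 => [|k nk].
  by rewrite tens_mapE eps_a eqxx tens_unitlE rmorph1 mul1r.
by rewrite tens_mapE eps_a eq_sym (negbTE nk) tens_unitlE rmorph0 mul0r.
Qed.

Lemma coaction_is_coaction : is_coaction Delta eps coaction.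
Proof.
split=> v.
  (* Writing the right-hand side as the reassociation of some t moves the comparison to (A ⊗ A) ⊗
     Gr, which embeds in (A ⊗ A) ⊗ A. *)
  have [t et] := tens_assoc_surj (tens_map (idA A) coaction (coaction v)).
  rewrite -et; congr tens_assoc.
  apply: (@tens_map_iota_inj (A ⊗ A)%type); apply: (can_inj (@tens_assocK _ _ _ _)).
  have nat_assoc (z : (A ⊗ A) ⊗ Gr) :
      tens_assoc (tens_map (idA _) iota z) = tens_map (idA A) tens_iota (tens_assoc z).
    move: z; apply: tens_ext => [x y|x y|z x]; rewrite ?raddfD //.
    elim/tens_ind: z => [|y z|y z ey ez].
    - by rewrite tpure0l !raddf0.
    - by rewrite tens_assocE !tens_mapE /= tens_assocE !tens_mapE.
    - by rewrite tpureDl !raddfD /= ey ez.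
  rewrite [RHS]nat_assoc et.
  rewrite (tens_map_square (h1 := idA A) (h2 := Delta) (k1 := iota) (k2 := idA A)) //.
  rewrite (tens_map_square (h1 := idA A) (h2 := idA A) (k1 := iota) (k2 := Delta)) //.
    rewrite coactionE; exact/Delta_coassoc/valP.
  exact: coactionE.
apply: val_inj.
have nat_unitl (z : K^o ⊗ Gr) :
    sub_val (tens_unitl z) = tens_unitl (tens_map (idA _) iota z).
  move: z; apply: tens_ext => [x y|x y|k x]; rewrite ?raddfD //.
  by rewrite tens_mapE !tens_unitlE.
rewrite [LHS]nat_unitl.
rewrite (tens_map_square (h1 := idA A) (h2 := eps) (k1 := iota) (k2 := idA A)) //.
rewrite coactionE; exact/Delta_counit/valP.
Qed.

Lemma restricted_coaction : exists delta : {supermorphism Gr -> A ⊗ Gr},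
  (forall x, tens_iota (delta x) = Delta (sub_val x)) /\ is_coaction Delta eps delta.
Proof. by exists coaction; split; [exact: coactionE | exact: coaction_is_coaction]. Qed.

End Grassmannian.

Theorem proposition5p6 (R : realType)
    (Delta : {supermorphism SLq R -> SLq R ⊗ SLq R})
    (eps : {supermorphism SLq R -> (Cq R)^o})
    (Delta_a : forall i j : 'I_5,
       Delta (SLq_a R i j) = \sum_(k < 5) SLq_a R i k ⊗ SLq_a R k j)
    (eps_a : forall i j : 'I_5, eps (SLq_a R i j) = (i == j)%:R) :
  exists delta : {supermorphism Grq R -> SLq R ⊗ Grq R},
    (forall x : Grq R,
       tens_map idfun (@sub_val _ _ (@Grq_gen R)) (delta x) =
       Delta (sub_val x)) /\
    is_coaction Delta eps delta.
Proof.
have GP s : Grq_gen s -> exists2 l, l \in minors & s = Dminor (SLq_a R) l.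
  case=> [i j ij|]; last by exists (4, 4)%N; rewrite ?Dminor44.
  exists (i : nat, j : nat); first exact: ltn_minors.
  by rewrite Dminor_qminor12 ?inord_val // neq_ltn ij.
have GD l : l \in minors -> Grq_gen (Dminor (SLq_a R) l).
  case/minorsP => [|->]; last by rewrite Dminor44; apply: Grq_D55.
  case: l => i j /andP[/= ij j5]; rewrite Dminor_qminor12 ?neq_ltn ?ij //.
  by apply: Grq_D; rewrite !inordK // (ltn_trans ij).
have a_rel := @SLq_rel R; have a_hom := @spart_SLq_a R.
have lower := @lower_morphism R; have torus := torus_morphism R.
exact: (restricted_coaction a_rel a_hom Delta_a eps_a lower torus GP GD).
Qed.
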